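(* Let $f \in \mathcal{S}_{\mathcal{AP}}^{*}$ and let $\Gamma_n$ ($n\ge 1$) be the inverse logarithmic coefficients of $f$. Then $$|\Gamma_1| \le \frac{3}{4}, \qquad |\Gamma_2| \le \frac{29}{32}, \qquad |\Gamma_3| \le \frac{925}{576}.$$ All these estimates are sharp, i.e. for each of the three inequalities there is a function in $\mathcal{S}_{\mathcal{AP}}^{*}$ for which equality holds.
   Context: Let $\mathbb{D}=\{z\in\mathbb{C}:|z|<1\}$, and let $\mathcal{A}$ be the class of analytic functions $f$ on $\mathbb{D}$ normalized by $f(0)=0$, $f'(0)=1$, written $f(z)=z+\sum_{n=2}^{\infty}a_nz^n$. For analytic $f,g$ on $\mathbb{D}$, $f\prec g$ (subordination) means that there is an analytic function $\omega$ on $\mathbb{D}$ with $\omega(0)=0$ and $|\omega(z)|<1$ (a Schwarz function) such that $f(z)=g(\omega(z))$ for $z\in\mathbb{D}$. The class $\mathcal{S}_{\mathcal{AP}}^{*}$ consists of all $f\in\mathcal{A}$ with $$\frac{zf'(z)}{f(z)}\prec\psi_{\mathcal{AP}}(z):=e^{z}\sqrt{1+z},\quad z\in\mathbb{D},$$ where the square root is the principal branch (value $1$ at $z=0$). It is a subclass of the univalent functions. The inverse logarithmic coefficients $\Gamma_n$ of $f$ are defined by $$\log\frac{f^{-1}(w)}{w}=2\sum_{n=1}^{\infty}\Gamma_n w^n,\qquad |w|<\tfrac14,$$ where the logarithm vanishes at $w=0$; explicitly, $\Gamma_1=-\frac12a_2$, $\Gamma_2=-\frac12a_3+\frac34a_2^2$,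 $\Gamma_3=-\frac12\left(a_4-4a_2a_3+\frac{10}{3}a_2^3\right)$. *)

(* Defs.v *)
(* Stdlib reals with Coquelicot's complex numbers. *)
From Stdlib Require Import Reals Lra.
From Coquelicot Require Import Coquelicot.
Open Scope R_scope.

Definition disc (r : R) (z : C) : Prop := Cmod z < r.

(* Complex differentiability (over [C_AbsRing]) at every point of [U]; used
   only for open [U], so that values of [f] outside [U] are irrelevant. *)
Definition analytic_on (U : C -> Prop) (f : C -> C) : Prop :=
  forall z : C, U z -> ex_derive f z.

Definition Cexp (z : C) : C :=
  (exp (Re z) * cos (Im z), exp (Re z) * sin (Im z)).

(* Principal square root in Cartesian form: the root with nonnegative real
   part, cut along the negative real axis (see [Csqrt_sqr], [Re_Csqrt_ge_0]). *)
Definition Csqrt (z : C) : C :=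
  (sqrt ((Cmod z + Re z) / 2),
   if Rlt_dec (Im z) 0 then - sqrt ((Cmod z - Re z) / 2)
   else sqrt ((Cmod z - Re z) / 2)).

Lemma Re_Csqrt_ge_0 (z : C) : 0 <= Re (Csqrt z).
Proof. apply sqrt_pos. Qed.

Lemma Csqrt_sqr (z : C) : (Csqrt z * Csqrt z)%C = z.
Proof.
assert (Hx := re_le_Cmod z).
assert (H2 := Cmod2_alt z).
apply Rabs_le_between in Hx.
destruct z as [x y]; unfold Csqrt, Cmult.
set (m := Cmod (x, y)) in *; simpl in *.
assert (Hp : 0 <= (m + x) / 2) by lra.
assert (Hm : 0 <= (m - x) / 2) by lra.
assert (Sp := sqrt_sqrt _ Hp).
assert (Sm := sqrt_sqrt _ Hm).
assert (Sy : sqrt ((m + x) / 2) * sqrt ((m - x) / 2) = Rabs y / 2).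
{ rewrite <- sqrt_mult by assumption.
  replace ((m + x) / 2 * ((m - x) / 2)) with (Rsqr (y / 2)).
  - rewrite sqrt_Rsqr_abs. unfold Rdiv. rewrite Rabs_mult.
    rewrite (Rabs_pos_eq (/ 2)); lra.
  - unfold Rsqr. nra. }
destruct (Rlt_dec y 0) as [Hy | Hy].
- rewrite Rabs_left in Sy by lra. f_equal; lra.
- rewrite Rabs_pos_eq in Sy by lra. f_equal; lra.
Qed.

Definition normalized_analytic (f : C -> C) : Prop :=
  analytic_on (disc 1) f /\ f 0 = 0 /\ C_derive f 0 = 1.

Definition schwarz_function (omega : C -> C) : Prop :=
  analytic_on (disc 1) omega /\ omega 0 = 0 /\
  (forall z : C, disc 1 z -> Cmod (omega z) < 1).

Definition subordinate (f g : C -> C) : Prop :=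
  exists omega : C -> C, schwarz_function omega /\
    forall z : C, disc 1 z -> f z = g (omega z).

(* z f'(z) / f(z), with its removable singularity at 0 filled in: the value
   there is 1 because f(0) = 0 and f'(0) = 1. *)
Definition starlike_quotient (f : C -> C) (z : C) : C :=
  if Ceq_dec z 0 then 1 else (z * C_derive f z / f z)%C.

Definition psi_AP (z : C) : C := (Cexp z * Csqrt (1 + z))%C.

(* Nonvanishing of f off 0 makes the quotient meaningful. *)
Definition S_AP (f : C -> C) : Prop :=
  normalized_analytic f /\
  (forall z : C, disc 1 z -> z <> 0 -> f z <> 0) /\
  subordinate (starlike_quotient f) psi_AP.

(* [g] is the two-sided inverse of [f] (restricted to the unit disc) over
   |w| < 1/4. *)
Definition inverse_on_quarter_disc (f g : C -> C) : Prop :=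
  forall w : C, disc (1 / 4) w ->
    disc 1 (g w) /\ (forall z : C, disc 1 z -> (f z = w <-> z = g w)).

(* [l] is the analytic branch of log (g(w) / w) on |w| < 1/4 vanishing at 0. *)
Definition log_quotient_branch (g l : C -> C) : Prop :=
  analytic_on (disc (1 / 4)) l /\ l 0 = 0 /\
  (forall w : C, disc (1 / 4) w -> w <> 0 -> Cexp (l w) = (g w / w)%C).

(* Only the terms [Gamma n] with n >= 1 matter. *)
Definition inverse_log_coefficients (f : C -> C) (Gamma : nat -> C) : Prop :=
  exists g l : C -> C,
    inverse_on_quarter_disc f g /\ log_quotient_branch g l /\
    forall w : C, disc (1 / 4) w ->
      is_series (fun n : nat => (2 * (Gamma (S n) * w ^ S n))%C) (l w).

(* Main.v *)
(* A Schwarz function om = c1 z + c2 z^2 + c3 z^3 + ... satisfies |c1| + |c_(k+1)| / 2 <= 1 for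
   k >= 1, as one sees by integrating om over circles against z^-1 times a kernel 1 + cos >= 0. If
   z f' / f = psi o om and L(z) = log (f^-1(w) / w) at w = f(z), then f = z exp (- L) and
   z L' = 1 - psi o om; comparing coefficients expresses Gamma_1, Gamma_2, Gamma_3 through the c_k:
     -3/4 c1,   -3/8 c2 + 29/32 c1^2,   -1/4 (c3 - 67/12 c1 c2 + 925/144 c1^3),
   and these linear constraints on the c_k already yield the three bounds.
   All three are attained for om(z) = z, that is f(z) = z exp (int_0^z (psi(t) - 1) / t dt). In the
   coordinate z = e^s the map log f has derivative psi(e^s), whose real part is positive: this gives
   injectivity, and with Harnack's inequality Re psi(z) >= (1 - |z|) / (1 + |z|) the growth bound
   |f(z)| >= |z| / (1 + |z|)^2, hence f covers the disc |w| < 1/4.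
   Since functions are only assumed complex differentiable, Cauchy's formula and Taylor expansions rest on Goursat's theorem. *)
Require Import Defs.
From Stdlib Require Import Reals Lra Lia ClassicalEpsilon.
From Coquelicot Require Import Coquelicot.
Open Scope R_scope.

(** * Complex differentiability *)

(** The recurring obstacle is a quotient such as (f(z) - f(w)) / (z - w) or (psi(z) - 1) / z:
    continuous, but not known to be differentiable at one point. Goursat's theorem is therefore
    proved with an exceptional vertical line on which only continuity is assumed. Under z = exp(s)
    this line becomes a circle about 0, so mean values tolerate an exceptional circle and Cauchy's
    formula follows without a theorem on removable singularities. The weak linear bounds on c_2 and
    c_3 suffice because the pure powers of c_1 carry large coefficients: after the triangle
    inequality the gap to each bound still contains the factor 1 - |c_1|. The upper bounds may
    assume an inverse on |w| < 1/4, whereas sharpness has to construct one. The growth bound tends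
    to 1/4 at the unit circle; it makes a half-plane invariant under a contraction whose fixed point
    is the preimage. Everything there rests on Re psi > 0, which in the variable sqrt(1 + z) is an
    inequality inside a lemniscate. *)

Lemma filterlim_Cmod {T : Type} (F : (T -> Prop) -> Prop) {FF : Filter F}
  (f : T -> C) (l : C) :
  filterlim f F (locally (T := C_UniformSpace) l) <->
  forall eps : R, 0 < eps -> F (fun x => Cmod (f x - l) < eps).
Proof.
split.
- intros H eps He.
  (* Balls of [C_UniformSpace] are products of real intervals, so passing to the modulus costs a
     factor sqrt 2. *)
  assert (Hs : 0 < sqrt 2) by (apply sqrt_lt_R0; lra).
  assert (He' : 0 < eps / sqrt 2) by (apply Rdiv_lt_0_compat; lra).
  generalize (proj1 (filterlim_locally (U := C_UniformSpace) f l) H (mkposreal _ He')).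
  apply filter_imp; intros x Hx.
  apply C_NormedModule_mixin_compat2 in Hx.
  replace eps with (sqrt 2 * (eps / sqrt 2)) by (field; lra).
  exact Hx.
- intros H. apply (filterlim_locally (U := C_UniformSpace)). intros eps.
  generalize (H eps (cond_pos eps)).
  apply filter_imp; intros x Hx.
  apply C_NormedModule_mixin_compat1. exact Hx.
Qed.

Lemma locally_Cmod (z : C) (P : C -> Prop) :
  locally (T := C_UniformSpace) z P <->
  exists d, 0 < d /\ forall x, Cmod (x - z) < d -> P x.
Proof.
split.
- intros [d Hd]. exists d; split; [apply cond_pos|].
  intros x Hx. apply Hd. now apply C_NormedModule_mixin_compat1.
- intros [d [Hd H]].
  assert (Hs : 0 < sqrt 2) by (apply sqrt_lt_R0; lra).
  assert (He' : 0 < d / sqrt 2) by (apply Rdiv_lt_0_compat; lra).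
  exists (mkposreal _ He'). intros x Hx. apply H.
  apply C_NormedModule_mixin_compat2 in Hx.
  replace d with (sqrt 2 * (d / sqrt 2)) by (field; lra). exact Hx.
Qed.

(** Fixes the product uniform structure on the codomain once, because C also carries the one of an
    absolute ring. *)
Definition ccont {U : UniformSpace} (f : U -> C) (x : U) : Prop :=
  continuous (U := C_UniformSpace) f x.

Lemma ccont_C_eps (f : C -> C) (z : C) :
  ccont (U := C_UniformSpace) f z <->
  forall eps, 0 < eps -> exists d, 0 < d /\
    forall x, Cmod (x - z) < d -> Cmod (f x - f z) < eps.
Proof.
unfold ccont, continuous. rewrite (filterlim_Cmod _ f (f z)).
split; intros H eps He; specialize (H eps He).
- now apply locally_Cmod in H.
- now apply locally_Cmod.
Qed.

Lemma ccont_parts {U : UniformSpace} (f : U -> C) (x : U) :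
  ccont f x <-> continuous (fun t => Re (f t)) x /\ continuous (fun t => Im (f t)) x.
Proof.
split.
- intros H; split.
  + apply (continuous_comp f (fun z : C_UniformSpace => fst z)); [exact H|]. apply continuous_fst.
  + apply (continuous_comp f (fun z : C_UniformSpace => snd z)); [exact H|]. apply continuous_snd.
- intros [H1 H2]. unfold ccont.
  apply (continuous_ext (fun t => (Re (f t), Im (f t)))).
  + intros t. now destruct (f t).
  + intros P [eps HP].
    generalize (H1 _ (locally_ball (Re (f x)) eps)) (H2 _ (locally_ball (Im (f x)) eps)).
    unfold filtermap. intros G1 G2. generalize (filter_and _ _ G1 G2).
    apply filter_imp. intros t [K1 K2]. apply HP. split; [exact K1|exact K2].
Qed.

Section Ccont.
Context {U : UniformSpace}.
Implicit Types (f g : U -> C) (x : U).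

Lemma ccont_plus f g x : ccont f x -> ccont g x -> ccont (fun t => f t + g t)%C x.
Proof.
rewrite !ccont_parts. intros [H1 H2] [H3 H4]; split.
- apply (continuous_plus (V := R_NormedModule) _ _ x H1 H3).
- apply (continuous_plus (V := R_NormedModule) _ _ x H2 H4).
Qed.

Lemma ccont_opp f x : ccont f x -> ccont (fun t => - f t)%C x.
Proof.
rewrite !ccont_parts. intros [H1 H2]; split.
- apply (continuous_opp (V := R_NormedModule) _ x H1).
- apply (continuous_opp (V := R_NormedModule) _ x H2).
Qed.

Lemma ccont_minus f g x : ccont f x -> ccont g x -> ccont (fun t => f t - g t)%C x.
Proof. intros H1 H2. apply ccont_plus; [exact H1 | now apply ccont_opp]. Qed.

Lemma ccont_mult f g x : ccont f x -> ccont g x -> ccont (fun t => f t * g t)%C x.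
Proof.
rewrite !ccont_parts. intros [H1 H2] [H3 H4]; split.
- apply (continuous_minus (V := R_NormedModule) (fun t => Re (f t) * Re (g t)) (fun t => Im (f t) * Im (g t))).
  + now apply (continuous_mult (K := R_AbsRing)).
  + now apply (continuous_mult (K := R_AbsRing)).
- apply (continuous_plus (V := R_NormedModule) (fun t => Re (f t) * Im (g t)) (fun t => Im (f t) * Re (g t))).
  + now apply (continuous_mult (K := R_AbsRing)).
  + now apply (continuous_mult (K := R_AbsRing)).
Qed.

Lemma ccont_const c x : ccont (fun _ : U => c) x.
Proof. apply continuous_const. Qed.

Lemma ccont_RtoC (h : U -> R) x : continuous h x -> ccont (fun t => RtoC (h t)) x.
Proof. intros H. apply ccont_parts; split; [exact H | apply continuous_const]. Qed.

Lemma ccont_comp (f : U -> C) (g : C -> C) x :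
  ccont f x -> ccont (U := C_UniformSpace) g (f x) -> ccont (fun t => g (f t)) x.
Proof. intros H1 H2. exact (continuous_comp f g x H1 H2). Qed.

Lemma ccont_ext f g x : (forall t, f t = g t) -> ccont f x -> ccont g x.
Proof. intros H. apply continuous_ext. exact H. Qed.

Lemma ccont_pow f n x : ccont f x -> ccont (fun t => f t ^ n)%C x.
Proof.
intros H. induction n as [|n IH]; simpl; [apply ccont_const | now apply ccont_mult].
Qed.

Lemma continuous_Cmod f x : ccont f x -> continuous (fun t => Cmod (f t)) x.
Proof.
intros H. apply ccont_parts in H. destruct H as [H1 H2]. unfold Cmod.
apply (continuous_comp _ sqrt).
- simpl. apply (continuous_plus (V := R_NormedModule)); apply (continuous_mult (K := R_AbsRing)); auto;
  apply (continuous_mult (K := R_AbsRing)); auto; apply continuous_const.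
- apply continuous_sqrt.
Qed.

Lemma ccont_inv f x : ccont f x -> f x <> 0 -> ccont (fun t => / f t)%C x.
Proof.
intros H Hn. unfold ccont, continuous in *.
apply (filterlim_Cmod _ (fun t => / f t)%C (/ f x)%C). intros eps He.
assert (Hm := proj1 (Cmod_gt_0 _) Hn). set (m := Cmod (f x)) in *.
(* The first bound keeps |f t| above m / 2; the second then puts |f t - f x| / (|f t| m) below
   eps. *)
pose (d := Rmin (m / 2) (eps * m * m / 4)).
assert (Hd : 0 < d). { apply Rmin_pos; [lra|]. repeat apply Rmult_lt_0_compat; lra. }
generalize (proj1 (filterlim_Cmod _ f (f x)) H d Hd). apply filter_imp. intros t Ht.
assert (Hd1 : d <= m / 2) by apply Rmin_l. assert (Hd2 : d <= eps * m * m / 4) by apply Rmin_r.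
assert (K : m / 2 < Cmod (f t)).
{ assert (E := Cmod_triangle (f t) (f x - f t)).
  replace (f t + (f x - f t))%C with (f x) in E by ring.
  replace (f x - f t)%C with (- (f t - f x))%C in E by ring.
  rewrite Cmod_opp in E. fold m in E. lra. }
assert (Hft : f t <> 0). { apply Cmod_gt_0. lra. }
replace (/ f t - / f x)%C with ((f x - f t) * / (f t * f x))%C by (field; auto).
rewrite Cmod_mult, Cmod_inv, Cmod_mult; [|now apply Cmult_neq_0]. fold m.
replace (f x - f t)%C with (- (f t - f x))%C by ring. rewrite Cmod_opp.
assert (P : 0 < Cmod (f t) * m) by (apply Rmult_lt_0_compat; lra).
apply Rmult_lt_reg_r with (1 := P).
rewrite Rmult_assoc, Rinv_l, Rmult_1_r by lra.
assert (0 < eps * m) by (apply Rmult_lt_0_compat; lra).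
nra.
Qed.
End Ccont.

Lemma ccont_id (z : C) : ccont (U := C_UniformSpace) (fun z => z) z.
Proof. intros P HP; exact HP. Qed.

Lemma ccont_Cexp (z : C) : ccont (U := C_UniformSpace) Cexp z.
Proof.
destruct (proj1 (ccont_parts (U := C_UniformSpace) (fun z => z) z) (ccont_id z)) as [H1 H2].
apply ccont_parts; split; simpl.
- apply (continuous_mult (K := R_AbsRing) (fun z : C_UniformSpace => exp (Re z))
    (fun z : C_UniformSpace => cos (Im z))).
  + apply (continuous_comp (fun z : C_UniformSpace => Re z) exp); [exact H1 | apply continuous_exp].
  + apply (continuous_comp (fun z : C_UniformSpace => Im z) cos); [exact H2 | apply continuous_cos].
- apply (continuous_mult (K := R_AbsRing) (fun z : C_UniformSpace => exp (Re z))
    (fun z : C_UniformSpace => sin (Im z))).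
  + apply (continuous_comp (fun z : C_UniformSpace => Re z) exp); [exact H1 | apply continuous_exp].
  + apply (continuous_comp (fun z : C_UniformSpace => Im z) sin); [exact H2 | apply continuous_sin].
Qed.

(* Caratheodory's formulation: it turns the rules of differentiation into continuity statements. *)
Definition Cdiff (f : C -> C) (z d : C) : Prop :=
  exists q : C -> C, q z = d /\ ccont (U := C_UniformSpace) q z /\
    forall x, f x = (f z + q x * (x - z))%C.

Lemma Cdiff_cont f z d : Cdiff f z d -> ccont (U := C_UniformSpace) f z.
Proof.
intros [q [_ [Hq H]]].
apply (ccont_ext (fun x => f z + q x * (x - z))%C); [intros; now rewrite <- H|].
apply ccont_plus; [apply ccont_const|]. apply ccont_mult; [exact Hq|].
apply ccont_minus; [apply ccont_id | apply ccont_const].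
Qed.

Lemma Cdiff_eps f z d : Cdiff f z d <->
  forall eps, 0 < eps -> exists del, 0 < del /\
    forall x, Cmod (x - z) < del -> Cmod (f x - f z - d * (x - z)) <= eps * Cmod (x - z).
Proof.
split.
- intros [q [Hd [Hq H]]] eps He.
  destruct (proj1 (ccont_C_eps q z) Hq eps He) as [del [Hdel K]].
  exists del; split; auto. intros x Hx. specialize (K x Hx).
  rewrite (H x). replace (f z + q x * (x - z) - f z - d * (x - z))%C with ((q x - d) * (x - z))%C by ring.
  rewrite Cmod_mult. apply Rmult_le_compat_r; [apply Cmod_ge_0|]. rewrite <- Hd. lra.
- intros H.
  exists (fun x => if Ceq_dec x z then d else ((f x - f z) / (x - z))%C).
  split; [|split].
  + destruct (Ceq_dec z z); congruence.
  + apply ccont_C_eps. intros eps He. destruct (H (eps / 2)) as [del [Hdel K]]; [lra|].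
    exists del; split; auto. intros x Hx.
    destruct (Ceq_dec z z) as [_|]; [|congruence].
    destruct (Ceq_dec x z) as [->|Hne].
    * replace (d - d)%C with (RtoC 0) by ring. rewrite Cmod_0. lra.
    * specialize (K x Hx). assert (Hne' := Cminus_eq_contra _ _ Hne).
      assert (P := proj1 (Cmod_gt_0 _) Hne').
      replace ((f x - f z) / (x - z) - d)%C with ((f x - f z - d * (x - z)) / (x - z))%C by (field; auto).
      rewrite Cmod_div by auto. apply Rle_lt_trans with (eps / 2); [|lra].
      apply Rmult_le_reg_r with (1 := P). unfold Rdiv at 1. rewrite Rmult_assoc, Rinv_l by lra. lra.
  + intros x. destruct (Ceq_dec x z) as [->|Hne]; [ring|].
    field. now apply Cminus_eq_contra.
Qed.

Lemma Cdiff_is_derive f z d :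
  Cdiff f z d <-> is_derive (K := C_AbsRing) (V := C_NormedModule) f z d.
Proof.
rewrite Cdiff_eps. split.
- intros H. split.
  + apply is_linear_scal_l.
  + intros x Hx. apply (is_filter_lim_locally_unique (V := AbsRing_NormedModule C_AbsRing)) in Hx. rewrite <- Hx. intros eps.
    destruct (H eps (cond_pos eps)) as [del [Hdel K]].
    exists (mkposreal _ Hdel). intros y Hy. specialize (K y Hy).
    change (Cmod (f y - f z - (y - z) * d) <= eps * Cmod (y - z)).
    now rewrite (Cmult_comm _ d).
- intros [_ H] eps He. specialize (H z (fun P HP => HP) (mkposreal _ He)).
  destruct H as [del K]. exists del; split; [apply cond_pos|].
  intros x Hx. specialize (K x Hx).
  change (Cmod (f x - f z - (x - z) * d) <= eps * Cmod (x - z)) in K.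
  now rewrite (Cmult_comm _ d) in K.
Qed.

Lemma Cdiff_C_derive f z d : Cdiff f z d -> C_derive f z = d.
Proof. intros H. apply is_C_derive_unique. now apply Cdiff_is_derive. Qed.

Lemma ex_derive_Cdiff f z :
  ex_derive (K := C_AbsRing) (V := C_NormedModule) f z -> Cdiff f z (C_derive f z).
Proof. intros [d H]. apply Cdiff_is_derive in H. now rewrite (Cdiff_C_derive _ _ _ H). Qed.

Lemma Cdiff_ex_derive f z d :
  Cdiff f z d -> ex_derive (K := C_AbsRing) (V := C_NormedModule) f z.
Proof. exists d. now apply Cdiff_is_derive. Qed.

Lemma Cdiff_eq f z d d' : Cdiff f z d -> d = d' -> Cdiff f z d'.
Proof. intros H <-. exact H. Qed.

(** Caratheodory's identity is required at every x, so locality is invisible in it and is obtained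
    from the epsilon form. *)
Lemma Cdiff_ext_loc f g z d del : 0 < del ->
  (forall x, Cmod (x - z) < del -> f x = g x) -> Cdiff f z d -> Cdiff g z d.
Proof.
rewrite !Cdiff_eps. intros Hdel E H eps He. destruct (H eps He) as [del' [Hdel' K]].
exists (Rmin del del'). split; [now apply Rmin_pos|]. intros x Hx.
rewrite <- (E x), <- (E z).
- apply K. apply Rlt_le_trans with (1 := Hx), Rmin_r.
- replace (z - z)%C with (RtoC 0) by ring. now rewrite Cmod_0.
- apply Rlt_le_trans with (1 := Hx), Rmin_l.
Qed.

Lemma Cdiff_ext f g z d : (forall x, f x = g x) -> Cdiff f z d -> Cdiff g z d.
Proof. intros E. apply (Cdiff_ext_loc _ _ _ _ 1); [lra | auto]. Qed.

Lemma Cdiff_const c z : Cdiff (fun _ => c) z 0.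
Proof. exists (fun _ => RtoC 0). split; [easy|split; [apply ccont_const|intros; ring]]. Qed.

Lemma Cdiff_id z : Cdiff (fun x => x) z 1.
Proof. exists (fun _ => RtoC 1). split; [easy|split; [apply ccont_const|intros; ring]]. Qed.

Lemma Cdiff_plus f g z a b : Cdiff f z a -> Cdiff g z b -> Cdiff (fun x => f x + g x)%C z (a + b).
Proof.
intros [q [<- [Cq Eq]]] [r [<- [Cr Er]]]. exists (fun x => q x + r x)%C.
split; [easy|split; [now apply ccont_plus|]]. intros x. rewrite (Eq x), (Er x). ring.
Qed.

Lemma Cdiff_opp f z a : Cdiff f z a -> Cdiff (fun x => - f x)%C z (- a).
Proof.
intros [q [<- [Cq Eq]]]. exists (fun x => - q x)%C.
split; [easy|split; [now apply ccont_opp|]]. intros x. rewrite (Eq x). ring.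
Qed.

Lemma Cdiff_minus f g z a b : Cdiff f z a -> Cdiff g z b -> Cdiff (fun x => f x - g x)%C z (a - b).
Proof. intros H1 H2. apply Cdiff_plus; [exact H1 | now apply Cdiff_opp]. Qed.

Lemma Cdiff_mult f g z a b : Cdiff f z a -> Cdiff g z b ->
  Cdiff (fun x => f x * g x)%C z (a * g z + f z * b).
Proof.
intros H. assert (Cf := Cdiff_cont _ _ _ H). revert H.
intros [q [<- [Cq Eq]]] [r [<- [Cr Er]]]. exists (fun x => q x * g z + f x * r x)%C.
split; [easy|split].
- apply ccont_plus; apply ccont_mult; auto. apply ccont_const.
- intros x. rewrite (Er x), (Eq x). ring.
Qed.

Lemma Cdiff_comp f g z a b : Cdiff g z a -> Cdiff f (g z) b -> Cdiff (fun x => f (g x)) z (b * a).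
Proof.
intros H. assert (Cg := Cdiff_cont _ _ _ H). revert H.
intros [q [<- [Cq Eq]]] [r [<- [Cr Er]]]. exists (fun x => r (g x) * q x)%C.
split; [easy|split].
- apply ccont_mult; auto. now apply (ccont_comp (U := C_UniformSpace) g r).
- intros x. rewrite (Er (g x)), (Eq x) at 1. ring_simplify. rewrite (Eq x). ring.
Qed.

Lemma Cdiff_inv f z a : Cdiff f z a -> f z <> 0 -> Cdiff (fun x => / f x)%C z (- a / (f z * f z)).
Proof.
intros H Hn. assert (Cf := Cdiff_cont _ _ _ H).
destruct (proj1 (ccont_C_eps f z) Cf (Cmod (f z))) as [del [Hdel K]]; [now apply Cmod_gt_0|].
destruct H as [q [<- [Cq Eq]]].
(* The slope identity would fail at zeros of f away from z; there the function is replaced by the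
   value that the identity prescribes. *)
apply (Cdiff_ext_loc (fun x => if Rlt_dec (Cmod (x - z)) del then / f x else
   / f z + - q x * / (f x * f z) * (x - z))%C _ _ _ del Hdel).
{ intros x Hx. destruct (Rlt_dec (Cmod (x - z)) del); easy. }
exists (fun x => - q x * / (f x * f z))%C. split; [easy|split].
- apply ccont_mult; [now apply ccont_opp|]. apply ccont_inv.
  + apply ccont_mult; [exact Cf | apply ccont_const].
  + now apply Cmult_neq_0.
- intros x. destruct (Rlt_dec (Cmod (z - z)) del) as [_|n].
  2: { destruct n. replace (z - z)%C with (RtoC 0) by ring. now rewrite Cmod_0. }
  destruct (Rlt_dec (Cmod (x - z)) del) as [Hx|_]; [|easy].
  assert (Hfx : f x <> 0).
  { intros E. specialize (K x Hx). rewrite E in K.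
    replace (0 - f z)%C with (- f z)%C in K by ring. rewrite Cmod_opp in K. lra. }
  assert (E : (q x * (x - z) = f x - f z)%C) by (rewrite (Eq x); ring).
  replace (- q x * / (f x * f z) * (x - z))%C with (- (q x * (x - z)) * / (f x * f z))%C by ring.
  rewrite E. field. auto.
Qed.

Lemma Cdiff_pow n z : Cdiff (fun x => x ^ n)%C z (INR n * z ^ pred n).
Proof.
induction n as [|n IH].
- apply (Cdiff_eq _ _ 0); [exact (Cdiff_const 1 z)|]. simpl. ring.
- eapply Cdiff_eq; [exact (Cdiff_mult _ _ _ _ _ (Cdiff_id z) IH)|].
  rewrite S_INR, RtoC_plus. destruct n; simpl; ring.
Qed.

(** * The exponential, the mean value inequality and integrals of curves *)

Lemma Cexp_plus a b : Cexp (a + b) = (Cexp a * Cexp b)%C.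
Proof.
unfold Cexp, Cmult. rewrite re_plus, im_plus, exp_plus, cos_plus, sin_plus. simpl.
f_equal; ring.
Qed.

Lemma Cexp_0 : Cexp 0 = 1.
Proof.
unfold Cexp. rewrite re_RtoC, im_RtoC, exp_0, cos_0, sin_0. unfold RtoC.
apply injective_projections; simpl; ring.
Qed.

Lemma Cmod_Cexp z : Cmod (Cexp z) = exp (Re z).
Proof.
unfold Cmod, Cexp; simpl.
transitivity (sqrt (exp (Re z) * exp (Re z))); [f_equal|apply sqrt_square; left; apply exp_pos].
assert (E := sin2_cos2 (Im z)). unfold Rsqr in E.
transitivity (exp (Re z) * exp (Re z) * (sin (Im z) * sin (Im z) + cos (Im z) * cos (Im z))); [ring|].
rewrite E; ring.
Qed.

Lemma Cexp_neq_0 z : Cexp z <> 0.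
Proof. apply Cmod_gt_0. rewrite Cmod_Cexp. apply exp_pos. Qed.

Lemma Cexp_opp z : Cexp (- z) = (/ Cexp z)%C.
Proof.
assert (H := Cexp_neq_0 z).
assert (E : (Cexp (- z) * Cexp z)%C = 1).
{ rewrite <- Cexp_plus. replace (- z + z)%C with (RtoC 0) by ring. apply Cexp_0. }
transitivity (Cexp (- z) * Cexp z / Cexp z)%C; [now field|]. rewrite E. now field.
Qed.

Lemma Cmod_le_parts z : Cmod z <= Rabs (Re z) + Rabs (Im z).
Proof.
replace z with (RtoC (Re z) + Ci * RtoC (Im z))%C at 1.
- eapply Rle_trans; [apply Cmod_triangle|]. rewrite Cmod_mult, !Cmod_R, Cmod_Ci. lra.
- destruct z; unfold Cplus, Cmult, Ci, RtoC; simpl. f_equal; ring.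
Qed.

Lemma im_le_Cmod z : Rabs (Im z) <= Cmod z.
Proof. eapply Rle_trans; [|apply Rmax_Cmod]. apply Rmax_r. Qed.

Lemma Cdiff_Cexp_0 : Cdiff Cexp 0 1.
Proof.
apply Cdiff_eps. intros eps He.
(* Each coordinate of the remainder will be at most 3 e |h|, hence the divisor 6. *)
pose (e := Rmin 1 (eps / 6)). assert (He' : 0 < e) by (apply Rmin_pos; lra).
assert (e1 : e <= 1) by apply Rmin_l. assert (e2 : e <= eps / 6) by apply Rmin_r.
assert (D1 := derivable_pt_lim_exp 0). rewrite exp_0 in D1.
assert (D2 := derivable_pt_lim_cos 0). rewrite sin_0 in D2.
assert (D3 := derivable_pt_lim_sin 0). rewrite cos_0 in D3.
assert (K : forall g l, derivable_pt_lim g 0 l -> exists d, 0 < d /\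
  forall x, Rabs x < d -> Rabs (g x - g 0 - l * x) <= e * Rabs x).
{ intros g l D. destruct (D e He') as [[d Hd] K]. exists d; split; auto.
  intros x Hx. destruct (Req_dec x 0) as [->|Hn].
  - replace (g 0 - g 0 - l * 0) with 0 by ring. rewrite Rabs_R0. lra.
  - specialize (K x Hn Hx). rewrite Rplus_0_l in K.
    replace (g x - g 0 - l * x) with (((g x - g 0) / x - l) * x) by (field; auto).
    rewrite Rabs_mult. apply Rmult_le_compat_r; [apply Rabs_pos|lra]. }
destruct (K _ _ D1) as [d1 [Hd1 K1]]. destruct (K _ _ D2) as [d2 [Hd2 K2]].
destruct (K _ _ D3) as [d3 [Hd3 K3]].
rewrite exp_0 in K1. rewrite cos_0 in K2. rewrite sin_0 in K3.
(* The radius e / 2 yields |exp x - 1| <= 2 |x| <= e, which controls the mixed term (exp x - 1) y of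
   the imaginary part. *)
exists (Rmin (e / 2) (Rmin d1 (Rmin d2 d3))). split; [repeat apply Rmin_pos; lra|].
intros h Hh. replace (h - 0)%C with h in * by ring.
assert (Hx := re_le_Cmod h). assert (Hy := im_le_Cmod h).
set (x := Re h) in *. set (y := Im h) in *. set (r := Cmod h) in *.
assert (L := Rmin_l (e / 2) (Rmin d1 (Rmin d2 d3))).
assert (L' := Rmin_r (e / 2) (Rmin d1 (Rmin d2 d3))).
assert (L1 := Rmin_l d1 (Rmin d2 d3)). assert (L1' := Rmin_r d1 (Rmin d2 d3)).
assert (L2 := Rmin_l d2 d3). assert (L2' := Rmin_r d2 d3).
specialize (K1 x ltac:(lra)). specialize (K2 y ltac:(lra)). specialize (K3 y ltac:(lra)).
rewrite Cexp_0. eapply Rle_trans; [apply Cmod_le_parts|].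
assert (Px := Rabs_pos x). assert (Py := Rabs_pos y).
assert (X1 : Rabs (exp x - 1) <= 2 * Rabs x).
{ replace (exp x - 1) with ((exp x - 1 - 1 * x) + x) by ring.
  eapply Rle_trans; [apply Rabs_triang|]. nra. }
assert (X2 : 0 < exp x <= 2).
{ split; [apply exp_pos|]. assert (Z := Rle_abs (exp x - 1)). lra. }
assert (A : Rabs (Re (Cexp h - 1 - 1 * h)) <= 3 * e * r).
{ replace (Re (Cexp h - 1 - 1 * h)%C) with (exp x * (cos y - 1 - -0 * y) + (exp x - 1 - 1 * x)).
  2: { unfold x, y. destruct h. unfold Cexp. simpl. ring. }
  eapply Rle_trans; [apply Rabs_triang|]. rewrite Rabs_mult, (Rabs_pos_eq (exp x)) by lra.
  assert (exp x * Rabs (cos y - 1 - -0 * y) <= 2 * (e * Rabs y)).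
  { apply Rmult_le_compat; try lra. apply Rabs_pos. }
  nra. }
assert (B : Rabs (Im (Cexp h - 1 - 1 * h)) <= 3 * e * r).
{ replace (Im (Cexp h - 1 - 1 * h)%C) with (exp x * (sin y - 0 - 1 * y) + (exp x - 1) * y).
  2: { unfold x, y. destruct h. unfold Cexp. simpl. ring. }
  eapply Rle_trans; [apply Rabs_triang|]. rewrite !Rabs_mult, (Rabs_pos_eq (exp x)) by lra.
  assert (exp x * Rabs (sin y - 0 - 1 * y) <= 2 * (e * Rabs y)).
  { apply Rmult_le_compat; try lra. apply Rabs_pos. }
  assert (Rabs (exp x - 1) * Rabs y <= e * Rabs y).
  { apply Rmult_le_compat_r; lra. }
  nra. }
assert (0 <= r) by apply Cmod_ge_0. nra.
Qed.

Lemma Cdiff_Cexp z : Cdiff Cexp z (Cexp z).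
Proof.
apply (Cdiff_ext (fun x => Cexp z * Cexp (x - z))%C).
{ intros x. rewrite <- Cexp_plus. f_equal. ring. }
eapply Cdiff_eq.
- apply Cdiff_mult; [apply Cdiff_const|].
  apply (Cdiff_comp Cexp (fun x => x - z)%C).
  + apply Cdiff_minus; [apply Cdiff_id | apply Cdiff_const].
  + replace (z - z)%C with (RtoC 0) by ring. apply Cdiff_Cexp_0.
- cbv beta. ring.
Qed.

(** The mean value theorem is real, so a complex function is tested along a segment through a real
    linear functional Re (u .); the factor u is free for later choice. *)
Lemma seg_derive f a b (u : C) t d : Cdiff f (a + RtoC t * b)%C d ->
  is_derive (fun s : R => Re (u * f (a + RtoC s * b)%C)) t (Re (u * d * b)).
Proof.
intros H. apply is_derive_Reals. intros eps He.
assert (Hu := Cmod_ge_0 u). assert (Hb := Cmod_ge_0 b).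
set (k := Cmod u * Cmod b + 1). assert (Hk : 0 < k) by (unfold k; nra).
destruct (proj1 (Cdiff_eps _ _ _) H (eps / 2 / k)) as [del [Hdel K]].
{ apply Rdiv_lt_0_compat; lra. }
assert (Hdel' : 0 < del / (Cmod b + 1)) by (apply Rdiv_lt_0_compat; lra).
exists (mkposreal _ Hdel'). intros h Hh Hl. simpl in Hl.
specialize (K (a + RtoC (t + h) * b)%C).
replace (a + RtoC (t + h) * b - (a + RtoC t * b))%C with (RtoC h * b)%C in K by (rewrite RtoC_plus; ring).
rewrite Cmod_mult, Cmod_R in K.
assert (Ph : 0 < Rabs h) by now apply Rabs_pos_lt.
assert (Q : Rabs h * Cmod b < del).
{ apply Rle_lt_trans with (Rabs h * (Cmod b + 1)); [nra|].
  apply Rmult_lt_reg_r with (/ (Cmod b + 1)); [apply Rinv_0_lt_compat; lra|].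
  rewrite Rmult_assoc, Rinv_r by lra. lra. }
specialize (K Q).
replace ((Re (u * f (a + RtoC (t + h) * b)%C) - Re (u * f (a + RtoC t * b)%C)) / h - Re (u * d * b))
  with (Re (u * (f (a + RtoC (t + h) * b)%C - f (a + RtoC t * b)%C - d * (RtoC h * b))) / h).
2: {
  set (p := f (a + RtoC (t + h) * b)%C). set (q := f (a + RtoC t * b)%C).
  clearbody p q. clear - Hh. destruct p, q, u, d, b. simpl. field. exact Hh. }
unfold Rdiv. rewrite Rabs_mult, Rabs_inv.
apply Rle_lt_trans with (Cmod u * (eps / 2 / k * (Rabs h * Cmod b)) * / Rabs h).
- apply Rmult_le_compat_r; [left; now apply Rinv_0_lt_compat|].
  eapply Rle_trans; [apply re_le_Cmod|]. rewrite Cmod_mult. now apply Rmult_le_compat_l.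
- replace (Cmod u * (eps / 2 / k * (Rabs h * Cmod b)) * / Rabs h) with (eps / 2 * ((k - 1) / k)).
  2: { unfold k. field. split; [|unfold k in Hk]; lra. }
  assert ((k - 1) / k < 1).
  { apply Rmult_lt_reg_r with (1 := Hk). unfold Rdiv. rewrite Rmult_assoc, Rinv_l; lra. }
  assert (0 <= (k - 1) / k). { apply Rdiv_le_0_compat; [unfold k; nra | lra]. }
  nra.
Qed.

Lemma ccont_seg a b (t : R) : ccont (fun s : R => a + RtoC s * b)%C t.
Proof.
apply ccont_plus; [apply ccont_const|]. apply ccont_mult; [|apply ccont_const].
apply ccont_RtoC, continuous_id.
Qed.

Lemma seg_MVT f df a b (u : C) :
  (forall t, 0 < t < 1 -> Cdiff f (a + RtoC t * b)%C (df t)) ->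
  (forall t, 0 <= t <= 1 -> ccont (U := C_UniformSpace) f (a + RtoC t * b)%C) ->
  exists t, 0 < t < 1 /\ Re (u * (f (a + b)%C - f a)) = Re (u * df t * b).
Proof.
intros H1 H2.
(* The real mean value theorem returns a point of the closed interval, while [df] is meaningful only
   inside; clipping makes the point interior without changing the derivative there. *)
pose (clip t := if Rlt_dec 0 t then if Rlt_dec t 1 then t else 1 / 2 else 1 / 2).
assert (Hc : forall t, 0 < clip t < 1).
{ intros t. unfold clip. destruct (Rlt_dec 0 t); [destruct (Rlt_dec t 1)|]; lra. }
assert (Hc' : forall t, 0 < t < 1 -> clip t = t).
{ intros t Ht. unfold clip. destruct (Rlt_dec 0 t); [destruct (Rlt_dec t 1)|]; lra. }
destruct (MVT_gen (fun s : R => Re (u * f (a + RtoC s * b)%C)) 0 1 (fun t => Re (u * df (clip t) * b)))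
  as [t [_ Ht]].
- rewrite Rmin_left, Rmax_right by lra. intros t Ht. rewrite Hc' by lra.
  apply seg_derive. auto.
- rewrite Rmin_left, Rmax_right by lra. intros t Ht. apply continuity_pt_filterlim.
  assert (K : ccont (fun s : R => u * f (a + RtoC s * b)%C)%C t).
  { apply ccont_mult; [apply ccont_const|].
    apply (ccont_comp (fun s : R => a + RtoC s * b)%C f); [apply ccont_seg | auto]. }
  apply ccont_parts in K. exact (proj1 K).
- exists (clip t). split; [apply Hc|].
  replace (a + RtoC 1 * b)%C with (a + b)%C in Ht by ring.
  replace (a + RtoC 0 * b)%C with a in Ht by ring.
  replace (u * (f (a + b)%C - f a))%C with (u * f (a + b)%C - u * f a)%C by ring.
  unfold Cminus. rewrite re_plus, re_opp. lra.
Qed.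

(** Testing with the conjugate of the increment D makes the left side of [seg_MVT] equal to |D|^2,
    and one factor |D| cancels. *)
Lemma seg_bound f df a b M :
  (forall t, 0 < t < 1 -> Cdiff f (a + RtoC t * b)%C (df t)) ->
  (forall t, 0 <= t <= 1 -> ccont (U := C_UniformSpace) f (a + RtoC t * b)%C) ->
  (forall t, 0 < t < 1 -> Cmod (df t) <= M) ->
  Cmod (f (a + b)%C - f a) <= M * Cmod b.
Proof.
intros H1 H2 HM. set (D := (f (a + b)%C - f a)%C).
destruct (seg_MVT f df a b (Cconj D) H1 H2) as [t [Ht E]]. fold D in E.
assert (E2 : Re (Cconj D * D) = Cmod D * Cmod D).
{ assert (Z := Cmod2_alt D). destruct D; simpl in *. nra. }
assert (Z := re_le_Cmod (Cconj D * df t * b)). rewrite !Cmod_mult, Cmod_conj in Z.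
assert (Z2 := Rle_abs (Re (Cconj D * df t * b))).
assert (P := Cmod_ge_0 D). assert (Pb := Cmod_ge_0 b). specialize (HM t Ht).
destruct (Rle_lt_or_eq_dec _ _ P) as [P'|P'].
- apply Rmult_le_reg_l with (1 := P'). rewrite <- E2, E.
  apply Rle_trans with (1 := Z2). apply Rle_trans with (1 := Z).
  rewrite Rmult_assoc. apply Rmult_le_compat_l; auto. now apply Rmult_le_compat_r.
- rewrite <- P'. apply Rmult_le_pos; auto. eapply Rle_trans; [apply Cmod_ge_0 | exact HM].
Qed.

(** * Integrals of complex-valued functions on real intervals *)

Definition CInt (f : R -> C) (a b : R) : C := RInt (V := C_R_CompleteNormedModule) f a b.
Definition cint (f : R -> C) (a b : R) : Prop := ex_RInt (V := C_R_NormedModule) f a b.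

Lemma cint_ccont f a b : a <= b -> (forall t, a <= t <= b -> ccont f t) -> cint f a b.
Proof.
intros Hab H. apply (ex_RInt_continuous (V := C_R_CompleteNormedModule)).
rewrite Rmin_left, Rmax_right by lra. exact H.
Qed.

Lemma CInt_correct f a b : cint f a b -> is_RInt (V := C_R_NormedModule) f a b (CInt f a b).
Proof. apply (RInt_correct (V := C_R_CompleteNormedModule)). Qed.

Lemma CInt_unique f a b l : is_RInt (V := C_R_NormedModule) f a b l -> CInt f a b = l.
Proof. apply (is_RInt_unique (V := C_R_CompleteNormedModule)). Qed.

Lemma CInt_plus f g a b : cint f a b -> cint g a b ->
  CInt (fun t => f t + g t)%C a b = (CInt f a b + CInt g a b)%C.
Proof. apply (RInt_plus (V := C_R_CompleteNormedModule)). Qed.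

Lemma CInt_minus f g a b : cint f a b -> cint g a b ->
  CInt (fun t => f t - g t)%C a b = (CInt f a b - CInt g a b)%C.
Proof. apply (RInt_minus (V := C_R_CompleteNormedModule)). Qed.

Lemma CInt_Chasles f a b c : cint f a b -> cint f b c -> (CInt f a b + CInt f b c)%C = CInt f a c.
Proof. apply (RInt_Chasles (V := C_R_CompleteNormedModule)). Qed.

(** The integral lives in a real normed module, so complex scalars act through the two
    coordinates. *)
Lemma is_RInt_scalC k f a b l : is_RInt (V := C_R_NormedModule) f a b l ->
  is_RInt (V := C_R_NormedModule) (fun t => k * f t)%C a b (k * l)%C.
Proof.
intros H.
assert (H1 := is_RInt_fct_extend_fst (U := R_NormedModule) (V := R_NormedModule) f a b l H).
assert (H2 := is_RInt_fct_extend_snd (U := R_NormedModule) (V := R_NormedModule) f a b l H).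
apply (is_RInt_fct_extend_pair (U := R_NormedModule) (V := R_NormedModule)).
- apply (is_RInt_minus (V := R_NormedModule) (fun t => fst k * fst (f t)) (fun t => snd k * snd (f t))).
  + now apply (is_RInt_scal (V := R_NormedModule)).
  + now apply (is_RInt_scal (V := R_NormedModule)).
- apply (is_RInt_plus (V := R_NormedModule) (fun t => fst k * snd (f t)) (fun t => snd k * fst (f t))).
  + now apply (is_RInt_scal (V := R_NormedModule)).
  + now apply (is_RInt_scal (V := R_NormedModule)).
Qed.

Lemma CInt_scal k f a b : cint f a b -> CInt (fun t => k * f t)%C a b = (k * CInt f a b)%C.
Proof. intros H. apply CInt_unique, is_RInt_scalC, CInt_correct, H. Qed.

Lemma CInt_const (k : C) a b : CInt (fun _ => k) a b = (RtoC (b - a) * k)%C.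
Proof.
apply CInt_unique. rewrite <- scal_R_Cmult. apply (is_RInt_const (V := C_R_NormedModule)).
Qed.

Lemma CInt_ext f g a b : a <= b -> (forall t, a <= t <= b -> f t = g t) -> CInt f a b = CInt g a b.
Proof.
intros Hab H. apply (RInt_ext (V := C_R_CompleteNormedModule)).
rewrite Rmin_left, Rmax_right by lra. intros t Ht. apply H. lra.
Qed.

Lemma norm_C_R (z : C) : norm (K := R_AbsRing) (V := C_R_NormedModule) z = Cmod z.
Proof.
change (sqrt (Rabs (fst z) ^ 2 + Rabs (snd z) ^ 2) = sqrt (fst z ^ 2 + snd z ^ 2)).
now rewrite !pow2_abs.
Qed.

Lemma CInt_bound f a b M : a <= b -> cint f a b -> (forall t, a <= t <= b -> Cmod (f t) <= M) ->
  Cmod (CInt f a b) <= (b - a) * M.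
Proof.
intros Hab Hf HM. rewrite <- norm_C_R.
apply (norm_RInt_le_const (V := C_R_NormedModule) f a b _ M Hab); [|now apply CInt_correct].
intros t Ht. rewrite norm_C_R. now apply HM.
Qed.

(** * Goursat's theorem *)

Lemma nested_intervals (a b : nat -> R) :
  (forall n, a n <= a (S n)) -> (forall n, b (S n) <= b n) -> (forall n, a n <= b n) ->
  exists x, forall n, a n <= x <= b n.
Proof.
intros Ha Hb Hab.
assert (Ha' : forall n k, a n <= a (n + k)%nat).
{ intros n k; induction k as [|k IH]; [rewrite Nat.add_0_r; lra|].
  rewrite Nat.add_succ_r. specialize (Ha (n + k)%nat). lra. }
assert (Hb' : forall n k, b (n + k)%nat <= b n).
{ intros n k; induction k as [|k IH]; [rewrite Nat.add_0_r; lra|].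
  rewrite Nat.add_succ_r. specialize (Hb (n + k)%nat). lra. }
assert (Hx : forall n m, a n <= b m).
{ intros n m. specialize (Ha' n m). specialize (Hb' m n). rewrite Nat.add_comm in Hb'.
  specialize (Hab (n + m)%nat). lra. }
destruct (completeness (fun r => exists n, r = a n)) as [x [Hx1 Hx2]].
- exists (b 0%nat). intros r [n ->]. apply Hx.
- exists (a 0%nat). now exists 0%nat.
- exists x. intros n. split.
  + apply Hx1. now exists n.
  + apply Hx2. intros r [m ->]. apply Hx.
Qed.

Section Bisection.
Variable P : R -> R -> R -> R -> Prop.
Let rect : Type := (R * R * R * R)%type.
Let PR (r : rect) : Prop := let '(a, b, c, d) := r in P a b c d.
Let quarter (r : rect) : rect :=
  let '(a, b, c, d) := r in
  let m := (a + b) / 2 in let n := (c + d) / 2 in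
  if excluded_middle_informative (P a m c n) then
  if excluded_middle_informative (P m b c n) then
  if excluded_middle_informative (P a m n d) then (m, b, n, d)
  else (a, m, n, d) else (m, b, c, n) else (a, m, c, n).

(** If P failed, gluing would give a quarter on which it fails, and [quarter] selects one; the
    nested rectangles shrink to a point where the local hypothesis is violated. Halving preserves
    the ratio of the sides, so the local hypothesis only has to treat rectangles similar to the
    first one, whose squared perimeter is comparable to their area. *)
Lemma bisection (a b c d : R) : a < b -> c < d ->
  (forall a' b' c' d', a <= a' -> a' < b' -> b' <= b -> c <= c' -> c' < d' -> d' <= d ->
     let m := (a' + b') / 2 in let n := (c' + d') / 2 in
     P a' m c' n -> P m b' c' n -> P a' m n d' -> P m b' n d' -> P a' b' c' d') ->
  (forall x y, a <= x <= b -> c <= y <= d -> exists del, 0 < del /\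
     forall a' b' c' d', a <= a' -> a' <= x <= b' -> b' <= b -> c <= c' -> c' <= y <= d' -> d' <= d ->
     0 < b' - a' < del -> 0 < d' - c' < del -> (b' - a') * (d - c) = (d' - c') * (b - a) ->
     P a' b' c' d') ->
  P a b c d.
Proof.
intros Hab Hcd Hglue Hloc. apply NNPP; intros HP.
pose (rr := fun n => Nat.iter n quarter (a, b, c, d)).
pose (ra n := fst (fst (fst (rr n)))). pose (rb n := snd (fst (fst (rr n)))).
pose (rc n := snd (fst (rr n))). pose (rd n := snd (rr n)).
assert (E : forall n, rr n = (ra n, rb n, rc n, rd n)).
{ intros n. unfold ra, rb, rc, rd. now destruct (rr n) as [[[? ?] ?] ?]. }
assert (inv : forall n, (a <= ra n /\ rb n <= b /\ c <= rc n /\ rd n <= d) /\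
   rb n - ra n = (b - a) / 2 ^ n /\ rd n - rc n = (d - c) / 2 ^ n /\ ~ P (ra n) (rb n) (rc n) (rd n)).
{ intros n. induction n as [|n IH].
  - unfold ra, rb, rc, rd; simpl. repeat split; try lra. exact HP.
  - destruct IH as [[I1 [I2 [I3 I4]]] [I5 [I6 I7]]].
    assert (P2 : 0 < / 2 ^ n) by (apply Rinv_0_lt_compat, pow_lt; lra).
    assert (Wa : 0 < (b - a) / 2 ^ n) by (apply Rmult_lt_0_compat; lra).
    assert (Wc : 0 < (d - c) / 2 ^ n) by (apply Rmult_lt_0_compat; lra).
    assert (G := Hglue (ra n) (rb n) (rc n) (rd n) I1 ltac:(lra) I2 I3 ltac:(lra) I4).
    assert (E5 : (b - a) / 2 ^ S n = (b - a) / 2 ^ n / 2) by (simpl; field; apply pow_nonzero; lra).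
    assert (E6 : (d - c) / 2 ^ S n = (d - c) / 2 ^ n / 2) by (simpl; field; apply pow_nonzero; lra).
    assert (En : rr (S n) = quarter (ra n, rb n, rc n, rd n)) by (rewrite <- E; reflexivity).
    rewrite E5, E6. cut (let '(a1, b1, c1, d1) := rr (S n) in
      (a <= a1 /\ b1 <= b /\ c <= c1 /\ d1 <= d) /\ b1 - a1 = (b - a) / 2 ^ n / 2 /\
      d1 - c1 = (d - c) / 2 ^ n / 2 /\ ~ P a1 b1 c1 d1).
    { unfold ra, rb, rc, rd. now destruct (rr (S n)) as [[[? ?] ?] ?]. }
    rewrite En. unfold quarter. cbv zeta in G.
    destruct (excluded_middle_informative _) as [q1|q1]; [|simpl; repeat split; try lra; exact q1].
    destruct (excluded_middle_informative _) as [q2|q2]; [|simpl; repeat split; try lra; exact q2].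
    destruct (excluded_middle_informative _) as [q3|q3]; [|simpl; repeat split; try lra; exact q3].
    simpl; repeat split; try lra. intros q4. apply I7. now apply G. }
assert (mono : forall n, ra n <= ra (S n) /\ rb (S n) <= rb n /\ rc n <= rc (S n) /\ rd (S n) <= rd n).
{ intros n. destruct (inv n) as [_ [I5 [I6 _]]].
  assert (P2 : 0 < / 2 ^ n) by (apply Rinv_0_lt_compat, pow_lt; lra).
  assert (Wa : 0 < (b - a) / 2 ^ n) by (apply Rmult_lt_0_compat; lra).
  assert (Wc : 0 < (d - c) / 2 ^ n) by (apply Rmult_lt_0_compat; lra).
  assert (En : rr (S n) = quarter (ra n, rb n, rc n, rd n)) by (rewrite <- E; reflexivity).
  cut (let '(a1, b1, c1, d1) := rr (S n) in ra n <= a1 /\ b1 <= rb n /\ rc n <= c1 /\ d1 <= rd n).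
  { intros Hr. unfold ra at 2, rb at 1, rc at 2, rd at 1. now destruct (rr (S n)) as [[[? ?] ?] ?]. }
  rewrite En. unfold quarter.
  destruct (excluded_middle_informative _); [|simpl; repeat split; lra].
  destruct (excluded_middle_informative _); [|simpl; repeat split; lra].
  destruct (excluded_middle_informative _); simpl; repeat split; lra. }
assert (wid : forall n, 0 < rb n - ra n /\ 0 < rd n - rc n).
{ intros n. destruct (inv n) as [_ [I5 [I6 _]]].
  assert (P2 : 0 < / 2 ^ n) by (apply Rinv_0_lt_compat, pow_lt; lra).
  rewrite I5, I6. split; apply Rmult_lt_0_compat; lra. }
destruct (nested_intervals ra rb) as [x Hx]; try (intros n; apply mono).
{ intros n. destruct (wid n). lra. }
destruct (nested_intervals rc rd) as [y Hy]; try (intros n; apply mono).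
{ intros n. destruct (wid n). lra. }
destruct (Hloc x y) as [del [Hdel K]].
{ destruct (inv 0%nat) as [J _]. specialize (Hx 0%nat). lra. }
{ destruct (inv 0%nat) as [J _]. specialize (Hy 0%nat). lra. }
set (W := (b - a) + (d - c)). assert (HW : 0 < W) by (unfold W; lra).
destruct (pow_lt_1_zero (1 / 2)) with (y := del / W) as [N HN].
{ rewrite Rabs_pos_eq; lra. } { now apply Rdiv_lt_0_compat. }
specialize (HN N (le_n N)). rewrite Rabs_pos_eq in HN by (apply pow_le; lra).
assert (HN' : W * / 2 ^ N < del).
{ unfold Rdiv in HN. rewrite Rmult_1_l, pow_inv in HN.
  apply Rmult_lt_reg_r with (/ W); [now apply Rinv_0_lt_compat|]. rewrite Rmult_comm, <- Rmult_assoc, Rinv_l by lra.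
  lra. }
destruct (inv N) as [J [I5 [I6 I7]]]. destruct (wid N) as [w1 w2]. apply I7.
assert (P2 : 0 < / 2 ^ N) by (apply Rinv_0_lt_compat, pow_lt; lra).
apply K; try (apply J); auto.
- split; auto. rewrite I5. unfold W in HN'. unfold Rdiv. nra.
- split; auto. rewrite I6. unfold W in HN'. unfold Rdiv. nra.
- rewrite I5, I6. field. apply pow_nonzero; lra.
Qed.
End Bisection.

(** The counterclockwise contour integral of f dz over the boundary: dz is dt on horizontal sides
    and i ds on vertical ones. *)
Definition rectI (f : C -> C) (a b c d : R) : C :=
  (CInt (fun t => f (t, c)) a b - CInt (fun t => f (t, d)) a b +
   Ci * (CInt (fun s => f (b, s)) c d - CInt (fun s => f (a, s)) c d))%C.

Definition rect_cont (f : C -> C) (a b c d : R) : Prop :=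
  forall x y, a <= x <= b -> c <= y <= d -> ccont (U := C_UniformSpace) f (x, y).

Lemma ccont_hline f x y : ccont (U := C_UniformSpace) f (x, y) -> ccont (fun t : R => f (t, y)) x.
Proof.
intros H. apply (ccont_comp (fun t : R => (t, y)) f); [|exact H].
apply ccont_parts; split; [apply continuous_id | apply continuous_const].
Qed.

Lemma ccont_vline f x y : ccont (U := C_UniformSpace) f (x, y) -> ccont (fun s : R => f (x, s)) y.
Proof.
intros H. apply (ccont_comp (fun s : R => (x, s)) f); [|exact H].
apply ccont_parts; split; [apply continuous_const | apply continuous_id].
Qed.

Lemma rect_hint f a b c d a' b' y : rect_cont f a b c d -> a <= a' <= b' -> b' <= b -> c <= y <= d ->
  cint (fun t => f (t, y)) a' b'.
Proof. intros H ? ? ?. apply cint_ccont; [lra|]. intros t Ht. apply ccont_hline, H; lra. Qed.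

Lemma rect_vint f a b c d c' d' x : rect_cont f a b c d -> c <= c' <= d' -> d' <= d -> a <= x <= b ->
  cint (fun s => f (x, s)) c' d'.
Proof. intros H ? ? ?. apply cint_ccont; [lra|]. intros t Ht. apply ccont_vline, H; lra. Qed.

Ltac rect_int f a b c d :=
  match goal with
  | |- cint (fun t => f (t, ?y)) _ _ => apply (rect_hint f a b c d)
  | |- cint (fun s => f (?x, s)) _ _ => apply (rect_vint f a b c d)
  end; [assumption | lra | lra | lra].

Lemma rectI_split f a m b c n d : a <= m <= b -> c <= n <= d -> rect_cont f a b c d ->
  rectI f a b c d = (rectI f a m c n + rectI f m b c n + rectI f a m n d + rectI f m b n d)%C.
Proof.
intros Hm Hn H. unfold rectI.
rewrite <- (CInt_Chasles (fun t => f (t, c)) a m b), <- (CInt_Chasles (fun t => f (t, d)) a m b),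
  <- (CInt_Chasles (fun s => f (b, s)) c n d), <- (CInt_Chasles (fun s => f (a, s)) c n d);
  try rect_int f a b c d.
ring.
Qed.

Lemma rectI_minus f g a b c d : a <= b -> c <= d -> rect_cont f a b c d -> rect_cont g a b c d ->
  rectI (fun z => f z - g z)%C a b c d = (rectI f a b c d - rectI g a b c d)%C.
Proof.
intros Hab Hcd Hf Hg. unfold rectI.
rewrite !CInt_minus; try rect_int f a b c d; try rect_int g a b c d.
ring.
Qed.

Lemma rectI_bound f a b c d M : a <= b -> c <= d -> rect_cont f a b c d ->
  (forall x y, a <= x <= b -> c <= y <= d -> Cmod (f (x, y)) <= M) ->
  Cmod (rectI f a b c d) <= 2 * ((b - a) + (d - c)) * M.
Proof.
intros Hab Hcd Hf HM. unfold rectI.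
assert (B1 : forall y, c <= y <= d -> Cmod (CInt (fun t => f (t, y)) a b) <= (b - a) * M).
{ intros y Hy. apply CInt_bound; auto. apply (rect_hint f a b c d); auto; lra. }
assert (B2 : forall x, a <= x <= b -> Cmod (CInt (fun s => f (x, s)) c d) <= (d - c) * M).
{ intros x Hx. apply CInt_bound; auto. apply (rect_vint f a b c d); auto; lra. }
assert (b1 := B1 c ltac:(lra)). assert (b2 := B1 d ltac:(lra)).
assert (b3 := B2 a ltac:(lra)). assert (b4 := B2 b ltac:(lra)).
eapply Rle_trans; [apply Cmod_triangle|]. rewrite Cmod_mult, Cmod_Ci.
unfold Cminus.
set (u1 := CInt (fun t => f (t, c)) a b) in *. set (u2 := CInt (fun t => f (t, d)) a b) in *.
set (u3 := CInt (fun s => f (b, s)) c d) in *. set (u4 := CInt (fun s => f (a, s)) c d) in *.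
assert (T1 := Cmod_triangle u1 (- u2)). assert (T2 := Cmod_triangle u3 (- u4)).
rewrite Cmod_opp in T1, T2. lra.
Qed.

(** Values on opposite sides differ by a constant: bottom minus top is - i l (d - c), right minus
    left is l (b - a), and the two contributions cancel. *)
Lemma rectI_affine (k l z : C) a b c d : a <= b -> c <= d ->
  rectI (fun x => k + l * (x - z))%C a b c d = 0.
Proof.
intros Hab Hcd.
set (f := fun x => (k + l * (x - z))%C).
assert (H : rect_cont f a b c d).
{ intros x y _ _. apply ccont_plus; [apply ccont_const|]. apply ccont_mult; [apply ccont_const|].
  apply ccont_minus; [apply ccont_id | apply ccont_const]. }
unfold rectI.
rewrite <- !CInt_minus; try rect_int f a b c d. unfold f.
rewrite (CInt_ext _ (fun _ => l * (- Ci * RtoC (d - c)))%C a b) by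
  (auto; intros; destruct l, k, z; unfold Cplus, Cminus, Cmult, Copp, Cplus; simpl; f_equal; ring).
rewrite (CInt_ext _ (fun _ => l * RtoC (b - a))%C c d) by
  (auto; intros; destruct l, k, z; unfold Cplus, Cminus, Cmult, Copp, Cplus; simpl; f_equal; ring).
rewrite !CInt_const. ring.
Qed.

(* The jump function [nu] makes [(nu b - nu a) * (d - c)] an additive set function that dominates
   the perimeter of every small rectangle meeting the exceptional line. *)
Theorem Goursat f a b c d s0 : a < b -> c < d -> rect_cont f a b c d ->
  (forall x y, a <= x <= b -> c <= y <= d -> x <> s0 -> exists l, Cdiff f (x, y) l) ->
  rectI f a b c d = 0.
Proof.
intros Hab Hcd Hc Hd.
(* The middle value 1 at s0 gives a jump of at least 1 also to intervals that merely end or begin at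
   s0. *)
pose (nu x := if Rlt_dec x s0 then 0 else if Rlt_dec s0 x then 2 else 1).
assert (Hnu : forall x y, x <= y -> nu x <= nu y).
{ intros x y Hxy. unfold nu. destruct (Rlt_dec x s0), (Rlt_dec y s0), (Rlt_dec s0 x), (Rlt_dec s0 y); lra. }
assert (Hnu1 : forall x y, x <= s0 <= y -> x < y -> 1 <= nu y - nu x).
{ intros x y Hxy Hlt. unfold nu. destruct (Rlt_dec x s0), (Rlt_dec y s0), (Rlt_dec s0 x), (Rlt_dec s0 y); lra. }
set (W := b - a). set (H := d - c).
assert (HW : 0 < W) by (unfold W; lra). assert (HH : 0 < H) by (unfold H; lra).
assert (main : forall eps, 0 < eps ->
  Cmod (rectI f a b c d) <= eps * ((b - a) * (d - c) + (nu b - nu a) * (d - c))).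
{ intros eps He.
  apply (bisection (fun a b c d => Cmod (rectI f a b c d) <= eps * ((b - a) * (d - c) + (nu b - nu a) * (d - c))));
    auto.
  - intros a' b' c' d' I1 I2 I3 I4 I5 I6 m n Q1 Q2 Q3 Q4.
    rewrite (rectI_split f a' m b' c' n d'); [| unfold m; lra | unfold n; lra |].
    2: { intros x y Hx Hy. apply Hc; lra. }
    set (r1 := rectI f a' m c' n) in *. set (r2 := rectI f m b' c' n) in *.
    set (r3 := rectI f a' m n d') in *. set (r4 := rectI f m b' n d') in *.
    assert (T1 := Cmod_triangle (r1 + r2 + r3) r4). assert (T2 := Cmod_triangle (r1 + r2) r3).
    assert (T3 := Cmod_triangle r1 r2).
    replace (eps * ((b' - a') * (d' - c') + (nu b' - nu a') * (d' - c'))) with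
      (eps * ((m - a') * (n - c') + (nu m - nu a') * (n - c')) +
       eps * ((b' - m) * (n - c') + (nu b' - nu m) * (n - c')) +
       eps * ((m - a') * (d' - n) + (nu m - nu a') * (d' - n)) +
       eps * ((b' - m) * (d' - n) + (nu b' - nu m) * (d' - n))) by ring.
    lra.
  - intros x y Hx Hy. destruct (Req_dec x s0) as [Hs|Hs].
    (* On the exceptional line only a constant can be subtracted. By similarity the perimeter is 2
       (W + H) / H times the height, so this tolerance yields eps times the height, which the jump
       term absorbs. *)
    + assert (He' : 0 < eps * H / (2 * (W + H))).
      { apply Rdiv_lt_0_compat; [apply Rmult_lt_0_compat; lra | lra]. }
      destruct (proj1 (ccont_C_eps _ _) (Hc x y Hx Hy) _ He') as [del [Hdel K]].
      exists (del / 2). split; [lra|].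
      intros a' b' c' d' I1 I2 I3 I4 I5 I6 w1 w2 E.
      set (k := f (x, y)) in *.
      assert (Hc' : rect_cont f a' b' c' d') by (intros u v Hu Hv; apply Hc; lra).
      assert (Z : rectI (fun z => f z - (k + 0 * (z - 0)))%C a' b' c' d' = rectI f a' b' c' d').
      { rewrite rectI_minus, rectI_affine; try lra; auto; [ring|].
        intros u v _ _. apply ccont_plus; [apply ccont_const|]. apply ccont_mult; [apply ccont_const|].
        apply ccont_minus; [apply ccont_id | apply ccont_const]. }
      rewrite <- Z. eapply Rle_trans.
      * apply rectI_bound with (M := eps * H / (2 * (W + H))); try lra.
        { intros u v Hu Hv. apply ccont_minus; [now apply Hc'|].
          apply ccont_plus; [apply ccont_const|]. apply ccont_mult; [apply ccont_const|].
          apply ccont_minus; [apply ccont_id | apply ccont_const]. }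
        intros u v Hu Hv. left. replace (f (u, v) - (k + 0 * ((u, v) - 0)))%C with (f (u, v) - k)%C by ring.
        apply K. eapply Rle_lt_trans; [apply Cmod_le_parts|]. simpl.
        assert (Rabs (u + - x) <= b' - a') by (apply Rabs_le; lra).
        assert (Rabs (v + - y) <= d' - c') by (apply Rabs_le; lra). lra.
      * assert (E' : b' - a' = (d' - c') * W / H) by
          (apply Rmult_eq_reg_r with H; [unfold Rdiv; rewrite (Rmult_assoc _ (/ H)), Rinv_l, Rmult_1_r by lra; exact E|lra]).
        rewrite E' at 1.
        replace (2 * ((d' - c') * W / H + (d' - c')) * (eps * H / (2 * (W + H))))
          with (eps * (1 * (d' - c'))) by (field; lra).
        apply Rmult_le_compat_l; [lra|].
        assert (1 * (d' - c') <= (nu b' - nu a') * (d' - c')).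
        { apply Rmult_le_compat_r; [lra|]. apply Hnu1; lra. }
        assert (0 <= (b' - a') * (d' - c')) by (apply Rmult_le_pos; lra). lra.
    + destruct (Hd x y Hx Hy Hs) as [l Hl].
      (* By similarity 2 (w + h)^2 = K0 w h for the sides w, h of every rectangle considered, so
         perimeter times diameter is turned into area. *)
      set (K0 := 2 * (W + H) * (W + H) / (W * H)).
      assert (HK0 : 0 < K0).
      { apply Rdiv_lt_0_compat; repeat apply Rmult_lt_0_compat; lra. }
      destruct (proj1 (Cdiff_eps _ _ _) Hl (eps / K0)) as [del [Hdel K]]; [now apply Rdiv_lt_0_compat|].
      exists (del / 2). split; [lra|].
      intros a' b' c' d' I1 I2 I3 I4 I5 I6 w1 w2 E.
      set (k := f (x, y)) in *.
      assert (Hc' : rect_cont f a' b' c' d') by (intros u v Hu Hv; apply Hc; lra).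
      assert (Z : rectI (fun z => f z - (k + l * (z - (x, y))))%C a' b' c' d' = rectI f a' b' c' d').
      { rewrite rectI_minus, rectI_affine; try lra; auto; [ring|].
        intros u v _ _. apply ccont_plus; [apply ccont_const|]. apply ccont_mult; [apply ccont_const|].
        apply ccont_minus; [apply ccont_id | apply ccont_const]. }
      rewrite <- Z. eapply Rle_trans.
      * apply rectI_bound with (M := eps / K0 * ((b' - a') + (d' - c'))); try lra.
        { intros u v Hu Hv. apply ccont_minus; [now apply Hc'|].
          apply ccont_plus; [apply ccont_const|]. apply ccont_mult; [apply ccont_const|].
          apply ccont_minus; [apply ccont_id | apply ccont_const]. }
        intros u v Hu Hv.
        assert (D : Cmod ((u, v) - (x, y)) <= (b' - a') + (d' - c')).
        { eapply Rle_trans; [apply Cmod_le_parts|]. simpl.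
          assert (Rabs (u + - x) <= b' - a') by (apply Rabs_le; lra).
          assert (Rabs (v + - y) <= d' - c') by (apply Rabs_le; lra). lra. }
        replace (f (u, v) - (k + l * ((u, v) - (x, y))))%C with (f (u, v) - k - l * ((u, v) - (x, y)))%C by ring.
        eapply Rle_trans; [apply K; lra|]. apply Rmult_le_compat_l; [|exact D].
        left; now apply Rdiv_lt_0_compat.
      * assert (E' : b' - a' = (d' - c') * W / H) by
          (apply Rmult_eq_reg_r with H; [unfold Rdiv; rewrite (Rmult_assoc _ (/ H)), Rinv_l, Rmult_1_r by lra; exact E|lra]).
        assert (0 <= (nu b' - nu a') * (d' - c')).
        { apply Rmult_le_pos; [|lra]. assert (nu a' <= nu b') by (apply Hnu; lra). lra. }
        apply Rle_trans with (eps * ((b' - a') * (d' - c'))).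
        2: { apply Rmult_le_compat_l; lra. }
        right. rewrite E'. unfold K0. field. lra. }
apply Cmod_eq_0. apply Rle_antisym; [|apply Cmod_ge_0].
set (M := (b - a) * (d - c) + (nu b - nu a) * (d - c)) in *.
assert (HM : 0 <= M).
{ specialize (Hnu a b ltac:(lra)). unfold M.
  apply Rplus_le_le_0_compat; apply Rmult_le_pos; lra. }
apply le_epsilon. intros eps He. rewrite Rplus_0_l.
eapply Rle_trans; [apply (main (eps / (M + 1))); apply Rdiv_lt_0_compat; lra|].
apply Rmult_le_reg_r with (M + 1); [lra|].
replace (eps / (M + 1) * M * (M + 1)) with (eps * M) by (field; lra). nra.
Qed.

(** * Circle means and Taylor expansions *)

Definition cpt (r t : R) : C := (r * cos t, r * sin t).
(** The factor 1 / (2 PI) is left out. Since dt = dz / (i z), the Cauchy kernel appears below as z /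
    (z - w). *)
Definition cmean (q : C -> C) (r : R) : C := CInt (fun t => q (cpt r t)) 0 (2 * PI).

Lemma Cmod_cpt r t : 0 <= r -> Cmod (cpt r t) = r.
Proof.
intros Hr. unfold Cmod, cpt; simpl. transitivity (sqrt (r * r)); [f_equal|now apply sqrt_square].
assert (E := sin2_cos2 t). unfold Rsqr in E.
transitivity (r * r * (sin t * sin t + cos t * cos t)); [ring|]. rewrite E; ring.
Qed.

Lemma ccont_cpt r t : ccont (fun t : R => cpt r t) t.
Proof.
apply ccont_parts; split.
- apply (continuous_mult (K := R_AbsRing)); [apply continuous_const|apply continuous_cos].
- apply (continuous_mult (K := R_AbsRing)); [apply continuous_const|apply continuous_sin].
Qed.

Definition circ_cont (q : C -> C) (r : R) : Prop :=
  forall z, Cmod z = r -> ccont (U := C_UniformSpace) q z.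

Lemma circ_ccont q r t : 0 <= r -> circ_cont q r -> ccont (fun t : R => q (cpt r t)) t.
Proof.
intros Hr H. apply (ccont_comp (fun t : R => cpt r t) q); [apply ccont_cpt|].
apply H. now apply Cmod_cpt.
Qed.

Lemma circ_cint q r : 0 <= r -> circ_cont q r -> cint (fun t => q (cpt r t)) 0 (2 * PI).
Proof.
intros Hr H. apply cint_ccont; [assert (Z := PI_RGT_0); lra|]. intros t _. now apply circ_ccont.
Qed.

Lemma cmean_plus f g r : 0 <= r -> circ_cont f r -> circ_cont g r ->
  cmean (fun z => f z + g z)%C r = (cmean f r + cmean g r)%C.
Proof.
intros Hr Hf Hg. apply (CInt_plus (fun t => f (cpt r t)) (fun t => g (cpt r t))); now apply circ_cint.
Qed.

Lemma cmean_minus f g r : 0 <= r -> circ_cont f r -> circ_cont g r ->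
  cmean (fun z => f z - g z)%C r = (cmean f r - cmean g r)%C.
Proof.
intros Hr Hf Hg. apply (CInt_minus (fun t => f (cpt r t)) (fun t => g (cpt r t))); now apply circ_cint.
Qed.

Lemma cmean_scal k f r : 0 <= r -> circ_cont f r -> cmean (fun z => k * f z)%C r = (k * cmean f r)%C.
Proof. intros Hr Hf. apply (CInt_scal k (fun t => f (cpt r t))). now apply circ_cint. Qed.

Lemma cmean_const k r : cmean (fun _ => k) r = (RtoC (2 * PI) * k)%C.
Proof. unfold cmean. rewrite CInt_const. now rewrite Rminus_0_r. Qed.

Lemma cmean_ext f g r : 0 <= r -> (forall z, Cmod z = r -> f z = g z) -> cmean f r = cmean g r.
Proof.
intros Hr H. apply CInt_ext; [assert (Z := PI_RGT_0); lra|]. intros t _. apply H. now apply Cmod_cpt.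
Qed.

Lemma cmean_bound f r M : 0 <= r -> circ_cont f r -> (forall z, Cmod z = r -> Cmod (f z) <= M) ->
  Cmod (cmean f r) <= 2 * PI * M.
Proof.
intros Hr Hf HM. replace (2 * PI) with (2 * PI - 0) at 1 by ring. unfold cmean. apply CInt_bound.
- assert (Z := PI_RGT_0); lra.
- now apply circ_cint.
- intros t _. apply HM. now apply Cmod_cpt.
Qed.

(* Goursat's theorem in the coordinate [s + i t] with [z = exp (s + i t)]. *)
Lemma cmean_invariance (q : C -> C) R rho r1 r2 :
  (forall z, 0 < Cmod z < R -> ccont (U := C_UniformSpace) q z) ->
  (forall z, 0 < Cmod z < R -> Cmod z <> rho -> exists l, Cdiff q z l) ->
  0 < r1 < R -> 0 < r2 < R -> cmean q r1 = cmean q r2.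
Proof.
intros Hc Hd.
assert (main : forall r1 r2, 0 < r1 -> r1 < r2 < R -> cmean q r1 = cmean q r2).
2: { intros h1 h2. destruct (Rtotal_order r1 r2) as [H|[->|H]]; [|reflexivity|symmetry]; apply main; lra. }
clear r1 r2; intros r1 r2 h1 h2.
assert (Hln : ln r1 < ln r2) by (apply ln_increasing; lra).
assert (HP := PI_RGT_0).
pose (Q := fun z => q (Cexp z)).
assert (Hmod : forall x y, ln r1 <= x <= ln r2 -> 0 < Cmod (Cexp (x, y)) < R).
{ intros x y Hx. rewrite Cmod_Cexp. simpl. split; [apply exp_pos|].
  apply Rle_lt_trans with r2; [|lra]. rewrite <- (exp_ln r2) by lra.
  destruct (Rle_lt_or_eq_dec x (ln r2)) as [K|K]; [lra | |rewrite K; lra].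
  left; now apply exp_increasing. }
(* The circle of radius rho is the vertical line over ln rho. As exp never vanishes, rho = 0
   describes the case without exceptional circle. *)
assert (G := Goursat Q (ln r1) (ln r2) 0 (2 * PI) (ln rho) Hln ltac:(lra)).
assert (G0 : rectI Q (ln r1) (ln r2) 0 (2 * PI) = 0).
{ apply G.
  - intros x y Hx Hy. apply (ccont_comp (U := C_UniformSpace) Cexp q); [apply ccont_Cexp|].
    apply Hc. now apply Hmod.
  - intros x y Hx Hy Hs. destruct (Hd (Cexp (x, y))) as [l Hl].
    + now apply Hmod.
    + rewrite Cmod_Cexp. simpl. intros E. apply Hs. rewrite <- E. now rewrite ln_exp.
    + eexists. apply (Cdiff_comp q Cexp); [apply Cdiff_Cexp | exact Hl]. }
clear G. unfold rectI in G0.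
(* The horizontal sides cancel by periodicity; the vertical ones are the two circle integrals. *)
rewrite (CInt_ext (fun t => Q (t, 2 * PI)) (fun t => Q (t, 0))) in G0; [|lra|].
2: { intros t _. unfold Q, Cexp. simpl. now rewrite cos_2PI, sin_2PI, cos_0, sin_0. }
assert (V : forall r, 0 < r -> CInt (fun s => Q (ln r, s)) 0 (2 * PI) = cmean q r).
{ intros r Hr. apply CInt_ext; [lra|]. intros t _. unfold Q, Cexp, cpt. simpl. now rewrite exp_ln. }
rewrite !V in G0 by lra.
assert (E : (Ci * (cmean q r2 - cmean q r1))%C = 0) by (rewrite <- G0; ring).
assert (E2 : (cmean q r2 - cmean q r1)%C = 0).
{ transitivity (- Ci * (Ci * (cmean q r2 - cmean q r1)))%C; [|rewrite E; ring].
  transitivity (- (Ci * Ci) * (cmean q r2 - cmean q r1))%C; [|ring].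
  replace (- (Ci * Ci))%C with (RtoC 1); [ring|]. unfold Ci, Cmult, Copp, RtoC; simpl. f_equal; ring. }
symmetry. now apply Ceq_minus.
Qed.

(** The circle is shrunk towards the origin by [cmean_invariance], and continuity at the origin
    identifies the limit. *)
Lemma mean_value (q : C -> C) R rho r :
  (forall z, Cmod z < R -> ccont (U := C_UniformSpace) q z) ->
  (forall z, 0 < Cmod z < R -> Cmod z <> rho -> exists l, Cdiff q z l) ->
  0 < r < R -> cmean q r = (RtoC (2 * PI) * q (RtoC 0))%C.
Proof.
intros Hc Hd Hr. assert (HP := PI_RGT_0). apply Ceq_minus. apply Cmod_eq_0.
apply Rle_antisym; [|apply Cmod_ge_0]. apply le_epsilon. intros eps He. rewrite Rplus_0_l.
destruct (proj1 (ccont_C_eps q 0) (Hc 0 ltac:(rewrite Cmod_0; lra)) (eps / (2 * PI))) as [d [Hd0 K]].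
{ apply Rdiv_lt_0_compat; lra. }
set (r' := Rmin r (d / 2)). assert (L1 : r' <= r) by apply Rmin_l. assert (L2 : r' <= d / 2) by apply Rmin_r.
assert (L3 : 0 < r') by (apply Rmin_pos; lra).
rewrite (cmean_invariance q R rho r r'); auto; try lra.
2: { intros z Hz. apply Hc; lra. }
assert (C1 : circ_cont q r') by (intros z Hz; apply Hc; lra).
assert (C2 : circ_cont (fun _ => q 0) r') by (intros z Hz; apply ccont_const).
rewrite <- (cmean_const _ r'), <- cmean_minus; auto; [|lra].
replace eps with (2 * PI * (eps / (2 * PI))) by (field; lra).
apply cmean_bound; [lra| |].
- intros z Hz. apply ccont_minus; auto.
- intros z Hz. left. apply K. replace (z - 0)%C with z by ring. lra.
Qed.

Lemma Cdiff_inv_pow n (z : C) : z <> 0 -> exists l, Cdiff (fun z => / z ^ n)%C z l.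
Proof. intros Hz. eexists. apply Cdiff_inv; [apply Cdiff_pow | now apply Cpow_nz]. Qed.

Lemma ccont_inv_pow n (z : C) : z <> 0 -> ccont (U := C_UniformSpace) (fun z => / z ^ n)%C z.
Proof. intros Hz. destruct (Cdiff_inv_pow n z Hz) as [l Hl]. now apply Cdiff_cont in Hl. Qed.

(** The circle is enlarged instead: on a radius r' >= 1 the integral is at most 2 PI / r', which is
    arbitrarily small. *)
Lemma cmean_inv_pow n r : 0 < r -> (0 < n)%nat -> cmean (fun z => / z ^ n)%C r = 0.
Proof.
intros Hr Hn. assert (HP := PI_RGT_0). apply Cmod_eq_0. apply Rle_antisym; [|apply Cmod_ge_0].
apply le_epsilon. intros eps He. rewrite Rplus_0_l.
set (r' := Rmax 1 (Rmax r (2 * PI / eps))).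
assert (L1 : 1 <= r') by apply Rmax_l.
assert (L2 : r <= r') by (eapply Rle_trans; [apply Rmax_l | apply Rmax_r]).
assert (L3 : 2 * PI / eps <= r') by (eapply Rle_trans; [apply Rmax_r | apply Rmax_r]).
assert (Hnz : forall z, 0 < Cmod z -> z <> 0) by (intros z; apply Cmod_gt_0).
rewrite (cmean_invariance _ (r' + 1) 0 r r'); try lra.
- apply Rle_trans with (2 * PI * (/ r')).
  + apply cmean_bound; [lra| |].
    * intros z Hz. apply ccont_inv_pow, Hnz. lra.
    * intros z Hz. rewrite Cmod_inv, Cmod_pow, Hz by (apply Cpow_nz, Hnz; lra).
      apply Rinv_le_contravar; [lra|]. destruct n as [|n]; [lia|]. simpl.
      assert (1 <= r' ^ n) by (apply pow_R1_Rle; lra). nra.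
  + apply Rmult_le_reg_r with r'; [lra|]. rewrite Rmult_assoc, Rinv_l, Rmult_1_r by lra.
    apply Rmult_le_reg_r with (/ eps); [now apply Rinv_0_lt_compat|].
    replace (eps * r' * / eps) with r' by (field; lra). exact L3.
- intros z Hz. apply ccont_inv_pow, Hnz; lra.
- intros z Hz _. apply Cdiff_inv_pow, Hnz; lra.
Qed.

(** * Geometric expansion of the Cauchy kernel, Cauchy's formula and Taylor remainders *)

Fixpoint csum (a : nat -> C) (n : nat) : C :=
  match n with O => RtoC 0 | S k => (csum a k + a k)%C end.

Section Kernel.
Variables (f : C -> C) (r : R) (w : C).
Hypothesis Hf : circ_cont f r.
Hypothesis Hw : Cmod w < r.

Lemma kernel_r_pos : 0 < r.
Proof. apply Rle_lt_trans with (2 := Hw). apply Cmod_ge_0. Qed.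

Lemma kernel_ne z : Cmod z = r -> z <> 0 /\ (z - w)%C <> 0.
Proof.
intros Hz. assert (Hr := kernel_r_pos). split.
- apply Cmod_gt_0. lra.
- apply Cminus_eq_contra. intros E. rewrite E in Hz. lra.
Qed.

Lemma kernel_cont n : circ_cont (fun z => f z * / z ^ n * (z / (z - w)))%C r.
Proof.
intros z Hz. destruct (kernel_ne z Hz) as [H1 H2].
apply (ccont_mult (U := C_UniformSpace)); [apply (ccont_mult (U := C_UniformSpace))|].
- now apply Hf.
- now apply ccont_inv_pow.
- apply (ccont_mult (U := C_UniformSpace)); [apply ccont_id|].
  apply (ccont_inv (U := C_UniformSpace) (fun z => z - w)%C); [|exact H2].
  apply ccont_minus; [apply ccont_id | apply ccont_const].
Qed.

Lemma coef_cont n : circ_cont (fun z => f z * / z ^ n)%C r.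
Proof.
intros z Hz. destruct (kernel_ne z Hz) as [H1 H2].
apply (ccont_mult (U := C_UniformSpace)); [now apply Hf | now apply ccont_inv_pow].
Qed.

(** Iterates z / (z - w) = 1 + (w / z) (z / (z - w)). Keeping the exact remainder avoids exchanging
    a series with an integral. *)
Lemma kernel_expansion N :
  cmean (fun z => f z * (z / (z - w)))%C r =
  (csum (fun n => w ^ n * cmean (fun z => f z * / z ^ n) r) N +
   w ^ N * cmean (fun z => f z * / z ^ N * (z / (z - w))) r)%C.
Proof.
assert (Hr := kernel_r_pos).
induction N as [|N IH]; simpl csum.
- rewrite Cplus_0_l. simpl Cpow. rewrite Cmult_1_l. apply cmean_ext; [lra|]. intros z Hz.
  destruct (kernel_ne z Hz). field. auto.
- rewrite IH, <- Cplus_assoc. f_equal.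
  rewrite (cmean_ext (fun z => f z * / z ^ N * (z / (z - w)))%C
    (fun z => f z * / z ^ N + w * (f z * / z ^ S N * (z / (z - w))))%C); [|lra|].
  + rewrite (cmean_plus (fun z => f z * / z ^ N)%C (fun z => w * (f z * / z ^ S N * (z / (z - w))))%C);
      [|lra|apply coef_cont|].
    * rewrite (cmean_scal w (fun z => f z * / z ^ S N * (z / (z - w)))%C); [|lra|apply kernel_cont].
      rewrite Cmult_plus_distr_l. f_equal. rewrite (Cpow_S w N). ring.
    * intros z Hz. apply (ccont_mult (U := C_UniformSpace)); [apply ccont_const|]. now apply kernel_cont.
  + intros z Hz. destruct (kernel_ne z Hz) as [H1 H2]. rewrite (Cpow_S z N). field.
    repeat split; auto. now apply Cpow_nz.
Qed.

Lemma kernel_rem_bound M N : (forall z, Cmod z = r -> Cmod (f z) <= M) ->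
  Cmod (w ^ N * cmean (fun z => f z * / z ^ N * (z / (z - w)))%C r)%C <=
  2 * PI * M * (Cmod w / r) ^ N * (r / (r - Cmod w)).
Proof.
intros HM. assert (Hr := kernel_r_pos). assert (HP := PI_RGT_0).
assert (HM0 : 0 <= M).
{ eapply Rle_trans; [|apply (HM (RtoC r))]; [apply Cmod_ge_0|]. rewrite Cmod_R. apply Rabs_pos_eq; lra. }
rewrite Cmod_mult, Cmod_pow.
replace (2 * PI * M * (Cmod w / r) ^ N * (r / (r - Cmod w))) with
  (Cmod w ^ N * (2 * PI * (M * / r ^ N * (r * / (r - Cmod w))))).
2: { unfold Rdiv. rewrite Rpow_mult_distr, pow_inv. ring. }
apply Rmult_le_compat_l; [apply pow_le, Cmod_ge_0|].
apply cmean_bound; [lra|apply kernel_cont|].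
intros z Hz. destruct (kernel_ne z Hz) as [H1 H2].
assert (Hn := Cpow_nz z N H1).
unfold Cdiv. rewrite !Cmod_mult, !Cmod_inv, Cmod_pow, Hz by auto.
assert (0 < / r ^ N) by (apply Rinv_0_lt_compat, pow_lt; lra).
assert (Hd : / Cmod (z - w) <= / (r - Cmod w)).
{ apply Rinv_le_contravar; [lra|]. assert (T := Cmod_triangle (z - w) w).
  replace (z - w + w)%C with z in T by ring. lra. }
assert (0 < / Cmod (z - w)) by (apply Rinv_0_lt_compat; now apply Cmod_gt_0).
apply Rmult_le_compat.
- apply Rmult_le_pos; [apply Cmod_ge_0 | lra].
- apply Rmult_le_pos; lra.
- apply Rmult_le_compat_r; [lra | now apply HM].
- apply Rmult_le_compat_l; lra.
Qed.
End Kernel.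

(** Expand the kernel against the constant 1: only the term of index 0 has a nonzero mean, and the
    remainder is geometrically small. *)
Lemma kernel_one r w : Cmod w < r -> cmean (fun z => z / (z - w))%C r = RtoC (2 * PI).
Proof.
intros Hw. assert (Hr : 0 < r) by (apply Rle_lt_trans with (2 := Hw); apply Cmod_ge_0).
assert (HP := PI_RGT_0).
assert (H1 : circ_cont (fun _ => RtoC 1) r) by (intros z _; apply ccont_const).
apply Ceq_minus, Cmod_eq_0, Rle_antisym; [|apply Cmod_ge_0].
set (K := 2 * PI * 1 * (r / (r - Cmod w))).
assert (HK : 0 < K).
{ unfold K. apply Rmult_lt_0_compat; [lra|]. apply Rdiv_lt_0_compat; lra. }
apply le_epsilon. intros eps He. rewrite Rplus_0_l.
destruct (pow_lt_1_zero (Cmod w / r)) with (y := eps / K) as [N HN].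
{ rewrite Rabs_pos_eq. - apply Rmult_lt_reg_r with r; [lra|]. unfold Rdiv. rewrite Rmult_assoc, Rinv_l; lra.
  - apply Rdiv_le_0_compat; [apply Cmod_ge_0 | lra]. }
{ now apply Rdiv_lt_0_compat. }
specialize (HN (S N) ltac:(lia)).
assert (E := kernel_expansion (fun _ => RtoC 1) r w H1 Hw (S N)).
rewrite (cmean_ext _ (fun z => z / (z - w))%C) in E; [|lra|intros; ring].
rewrite E.
assert (S1 : forall n, csum (fun n => w ^ n * cmean (fun z => 1 * / z ^ n) r)%C (S n) = RtoC (2 * PI)).
{ induction n as [|n IH].
  - simpl. rewrite (cmean_ext _ (fun _ => RtoC 1)); [|lra|intros; field].
    rewrite cmean_const. ring.
  - change (csum (fun n => w ^ n * cmean (fun z => 1 * / z ^ n) r)%C (S n) +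
      w ^ S n * cmean (fun z => 1 * / z ^ S n) r = RtoC (2 * PI))%C. rewrite IH.
    rewrite (cmean_ext _ (fun z => / z ^ S n)%C); [|lra|intros; ring].
    rewrite cmean_inv_pow by (auto; lia). ring. }
rewrite S1.
match goal with |- Cmod (_ + ?u - _) <= _ => replace (RtoC (2 * PI) + u - RtoC (2 * PI))%C with u by ring end.
eapply Rle_trans; [apply (kernel_rem_bound (fun _ => RtoC 1) r w H1 Hw 1)|].
- intros z _. rewrite Cmod_1. lra.
- rewrite Rabs_pos_eq in HN by (apply pow_le, Rdiv_le_0_compat; [apply Cmod_ge_0 | lra]).
  replace (2 * PI * 1 * (Cmod w / r) ^ S N * (r / (r - Cmod w))) with ((Cmod w / r) ^ S N * K) by (unfold K; ring).
  replace eps with (eps / K * K) by (field; lra). apply Rmult_le_compat_r; lra.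
Qed.

Definition diff_on (R : R) (f : C -> C) : Prop := forall z, Cmod z < R -> exists l, Cdiff f z l.

Lemma diff_on_cont R f z : diff_on R f -> Cmod z < R -> ccont (U := C_UniformSpace) f z.
Proof. intros H Hz. destruct (H z Hz) as [l Hl]. now apply Cdiff_cont in Hl. Qed.

(** Write f(z) z / (z - w) = f(w) z / (z - w) + z q(z) with Caratheodory's slope q at w. The last
    term vanishes at 0, so its mean is 0; the only point where q may fail to be differentiable is w,
    which lies on the circle |z| = |w| that [mean_value] tolerates. *)
Theorem Cauchy_formula f R r w : diff_on R f -> Cmod w < r -> r < R ->
  cmean (fun z => f z * (z / (z - w)))%C r = (RtoC (2 * PI) * f w)%C.
Proof.
intros Hf Hw HrR. assert (Hr : 0 < r) by (apply Rle_lt_trans with (2 := Hw); apply Cmod_ge_0).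
destruct (Hf w ltac:(lra)) as [l [q [Hq [Cq Eq]]]].
assert (Cf : forall z, Cmod z < R -> ccont (U := C_UniformSpace) f z) by (intros; now apply (diff_on_cont R)).
assert (Hqz : forall z, z <> w -> exists d, 0 < d /\ forall x, Cmod (x - z) < d -> q x = ((f x - f w) / (x - w))%C).
{ intros z Hz. exists (Cmod (z - w)). split; [now apply Cmod_gt_0, Cminus_eq_contra|].
  intros x Hx. assert (x <> w).
  { intros ->. replace (w - z)%C with (- (z - w))%C in Hx by ring. rewrite Cmod_opp in Hx. lra. }
  rewrite (Eq x). field. now apply Cminus_eq_contra. }
assert (Dq : forall z, Cmod z < R -> z <> w -> exists l, Cdiff q z l).
{ intros z HzR Hz. destruct (Hqz z Hz) as [d [Hd K]]. destruct (Hf z HzR) as [lz Hlz]. eexists.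
  apply (Cdiff_ext_loc (fun x => (f x - f w) * / (x - w))%C q z _ d Hd).
  - intros x Hx. now rewrite K.
  - apply Cdiff_mult.
    + apply Cdiff_minus; [exact Hlz | apply Cdiff_const].
    + apply (Cdiff_inv (fun x => x - w)%C).
      * apply Cdiff_minus; [apply Cdiff_id | apply Cdiff_const].
      * now apply Cminus_eq_contra. }
assert (Ccq : forall z, Cmod z < R -> ccont (U := C_UniformSpace) q z).
{ intros z HzR. destruct (Ceq_dec z w) as [->|Hz]; [exact Cq|].
  destruct (Dq z HzR Hz) as [l' Hl']. now apply Cdiff_cont in Hl'. }
assert (M := mean_value (fun z => z * q z)%C R (Cmod w) r).
cbv beta in M. rewrite Cmult_0_l, Cmult_0_r in M.
assert (M0 : cmean (fun z => z * q z)%C r = 0).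
{ apply M; [| |lra].
  - intros z Hz. apply ccont_mult; [apply ccont_id | auto].
  - intros z Hz Hzw. destruct (Dq z) as [l' Hl']; [lra|congruence|]. eexists.
    apply Cdiff_mult; [apply Cdiff_id | exact Hl']. }
assert (Hne : forall z, Cmod z = r -> (z - w)%C <> 0).
{ intros z Hz. apply Cminus_eq_contra. intros ->. lra. }
assert (Ck : circ_cont (fun z => z / (z - w))%C r).
{ intros z Hz. apply (ccont_mult (U := C_UniformSpace)); [apply ccont_id|].
  apply (ccont_inv (U := C_UniformSpace) (fun z => z - w)%C); [|now apply Hne].
  apply ccont_minus; [apply ccont_id | apply ccont_const]. }
rewrite (cmean_ext _ (fun z => f w * (z / (z - w)) + z * q z)%C); [|lra|].
- rewrite (cmean_plus (fun z => f w * (z / (z - w)))%C (fun z => z * q z)%C), M0, cmean_scal, kernel_one; auto; try lra.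
  + ring.
  + intros z Hz. apply ccont_mult; [apply ccont_const | now apply Ck].
  + intros z Hz. apply ccont_mult; [apply ccont_id | apply Ccq; lra].
- intros z Hz. rewrite (Eq z). field. now apply Hne.
Qed.

Definition coef (f : C -> C) (r : R) (n : nat) : C := (cmean (fun z => f z * / z ^ n) r / RtoC (2 * PI))%C.

Lemma coef_indep f R r1 r2 n : diff_on R f -> 0 < r1 < R -> 0 < r2 < R -> coef f r1 n = coef f r2 n.
Proof.
intros Hf H1 H2. unfold coef. f_equal.
assert (D : forall z, 0 < Cmod z < R -> exists l, Cdiff (fun z => f z * / z ^ n)%C z l).
{ intros z Hz. destruct (Hf z) as [l Hl]; [lra|].
  destruct (Cdiff_inv_pow n z) as [l' Hl']; [apply Cmod_gt_0; lra|].
  eexists. apply Cdiff_mult; eassumption. }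
apply (cmean_invariance _ R 0); auto.
intros z Hz. destruct (D z Hz) as [l Hl]. now apply Cdiff_cont in Hl.
Qed.

Lemma polar_form (z : C) : exists t, - PI <= t <= PI /\ z = cpt (Cmod z) t.
Proof.
assert (HP := PI_RGT_0). destruct z as [x y]. assert (Z := Cmod2_alt (x, y)).
assert (Hr := Cmod_ge_0 (x, y)). set (r := Cmod (x, y)) in *. clearbody r. simpl in Z.
destruct (Rle_lt_or_eq_dec _ _ Hr) as [Hr'|<-].
2: { exists 0. split; [lra|]. unfold cpt. f_equal; nra. }
assert (Hx : -1 <= x / r <= 1).
{ split; apply Rmult_le_reg_r with (1 := Hr'); unfold Rdiv; rewrite Rmult_assoc, Rinv_l by lra; nra. }
assert (B := acos_bound (x / r)).
assert (Hs : sin (acos (x / r)) * r = Rabs y).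
{ rewrite sin_acos by auto. replace r with (sqrt (r * r)) at 2 by (apply sqrt_square; lra).
  rewrite <- sqrt_mult_alt.
  2: { unfold Rsqr. assert (x / r * (x / r) <= 1) by nra. lra. }
  rewrite <- sqrt_Rsqr_abs. f_equal. unfold Rsqr. field_simplify; [|lra]. nra. }
destruct (Rle_dec 0 y) as [Hy|Hy].
- exists (acos (x / r)). split; [lra|]. unfold cpt. rewrite cos_acos by auto.
  rewrite Rabs_pos_eq in Hs by auto. f_equal; [field; lra | lra].
- exists (- acos (x / r)). split; [lra|]. unfold cpt. rewrite cos_neg, sin_neg, cos_acos by auto.
  rewrite Rabs_left in Hs by lra. f_equal; [field; lra | lra].
Qed.

Lemma circ_max f r : 0 <= r -> circ_cont f r -> exists M, forall z, Cmod z = r -> Cmod (f z) <= M.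
Proof.
intros Hr Hf. assert (HP := PI_RGT_0).
destruct (continuity_ab_maj (fun t => Cmod (f (cpt r t))) (- PI) PI) as [t0 [Ht0 _]]; [lra| |].
- intros t _. apply continuity_pt_filterlim.
  apply (continuous_Cmod (fun t => f (cpt r t))). now apply circ_ccont.
- exists (Cmod (f (cpt r t0))). intros z Hz. destruct (polar_form z) as [t [Ht ->]].
  rewrite Hz. now apply Ht0.
Qed.

(** M is uniform in both w and N: fixing N = 4 gives third order expansions at the origin, and
    letting N grow gives convergence of the series. *)
Theorem Taylor_remainder f R r : diff_on R f -> 0 < r < R ->
  exists M, 0 <= M /\ forall w N, Cmod w < r ->
    Cmod (f w - csum (fun n => coef f r n * w ^ n)%C N) <= M * (Cmod w / r) ^ N * (r / (r - Cmod w)).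
Proof.
intros Hf Hr. assert (HP := PI_RGT_0).
assert (Hc : circ_cont f r) by (intros z Hz; apply (diff_on_cont R); auto; lra).
destruct (circ_max f r) as [M HM]; [lra|auto|].
assert (HM0 : 0 <= M).
{ eapply Rle_trans; [|apply (HM (RtoC r))]; [apply Cmod_ge_0|]. rewrite Cmod_R. apply Rabs_pos_eq; lra. }
exists M. split; [exact HM0|]. intros w N Hw.
assert (E := kernel_expansion f r w Hc Hw N). rewrite (Cauchy_formula f R) in E; auto; [|lra].
assert (B := kernel_rem_bound f r w Hc Hw M N HM).
set (rem := (w ^ N * cmean (fun z => f z * / z ^ N * (z / (z - w))) r)%C) in *.
assert (P2 : RtoC (2 * PI) <> 0) by (intros E'; apply RtoC_inj in E'; lra).
assert (S1 : forall N, csum (fun n => w ^ n * cmean (fun z => f z * / z ^ n) r)%C N =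
   (RtoC (2 * PI) * csum (fun n => coef f r n * w ^ n) N)%C).
{ clear -P2. induction N as [|N IH]; simpl; [ring|]. rewrite IH. unfold coef. field. exact P2. }
rewrite S1 in E.
replace (f w - csum (fun n => coef f r n * w ^ n)%C N)%C with (rem / RtoC (2 * PI))%C.
2: { transitivity ((RtoC (2 * PI) * f w - RtoC (2 * PI) * csum (fun n => coef f r n * w ^ n) N) / RtoC (2 * PI))%C.
  - f_equal. rewrite E. ring.
  - field. exact P2. }
rewrite Cmod_div, Cmod_R, Rabs_pos_eq by (auto; lra).
apply Rmult_le_reg_r with (2 * PI); [lra|]. unfold Rdiv at 1. rewrite Rmult_assoc, Rinv_l by lra. lra.
Qed.

(** * Coefficients of Schwarz functions and Harnack's inequality *)

Lemma Re_cmean_le f g r : 0 <= r -> circ_cont f r -> circ_cont g r ->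
  (forall z, Cmod z = r -> Re (f z) <= Re (g z)) -> Re (cmean f r) <= Re (cmean g r).
Proof.
intros Hr Hf Hg H. assert (HP := PI_RGT_0).
assert (If := CInt_correct _ _ _ (circ_cint f r Hr Hf)).
assert (Ig := CInt_correct _ _ _ (circ_cint g r Hr Hg)).
apply (is_RInt_fct_extend_fst (U := R_NormedModule) (V := R_NormedModule)) in If.
apply (is_RInt_fct_extend_fst (U := R_NormedModule) (V := R_NormedModule)) in Ig.
apply (is_RInt_le (fun t => Re (f (cpt r t))) (fun t => Re (g (cpt r t))) 0 (2 * PI)); auto; [lra|].
intros t _. apply H. now apply Cmod_cpt.
Qed.

Lemma rotate_to_modulus (c : C) : exists u : C, Cmod u = 1 /\ (u * c)%C = RtoC (Cmod c).
Proof.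
destruct (Ceq_dec c 0) as [->|Hc].
- exists 1. rewrite Cmod_1, Cmod_0. split; [easy|ring].
- assert (Hm := proj1 (Cmod_gt_0 _) Hc).
  assert (Hm' : RtoC (Cmod c) <> 0) by (intros E; apply RtoC_inj in E; lra).
  exists (Cconj c / RtoC (Cmod c))%C. split.
  + rewrite Cmod_div, Cmod_conj, Cmod_R, Rabs_pos_eq by (auto; lra). field. lra.
  + transitivity (c * Cconj c / RtoC (Cmod c))%C; [field; auto|].
    rewrite <- Cmod2_conj, <- RtoC_div by (lra). f_equal. simpl. field. lra.
Qed.

(** On a circle conjugation agrees with a function holomorphic off 0, so real parts of powers become
    Laurent polynomials whose means can be computed. *)
Lemma conj_on_circle z r : 0 < r -> Cmod z = r -> (Cconj z = RtoC (r * r) / z)%C.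
Proof.
intros Hr Hz. assert (Hn : z <> 0) by (apply Cmod_gt_0; lra).
assert (E := Cmod2_conj z). rewrite Hz in E. simpl in E. rewrite Rmult_1_r in E. rewrite E. field. exact Hn.
Qed.

Lemma diff_on_mult_pow R f n : diff_on R f -> diff_on R (fun z => f z * z ^ n)%C.
Proof.
intros Hf z Hz. destruct (Hf z Hz) as [l Hl]. eexists.
apply Cdiff_mult; [exact Hl | apply Cdiff_pow].
Qed.

Lemma diff_on_mean R f r : diff_on R f -> 0 < r < R -> cmean f r = (RtoC (2 * PI) * f (RtoC 0))%C.
Proof.
intros Hf Hr. apply (mean_value f R 0 r); auto.
- intros z Hz. now apply (diff_on_cont R).
- intros z [_ Hz] _. now apply Hf.
Qed.

Lemma RtoC_neq x y : x <> y -> RtoC x <> RtoC y.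
Proof. intros H E. now apply RtoC_inj in E. Qed.

(* Integrate [om] against [u z^-1 (1 + Re (mu (r/z)^k))], which is [u/z] times a nonnegative
   kernel of mean 1. *)
Theorem Schwarz_coef (om : C -> C) (k : nat) : (0 < k)%nat ->
  diff_on 1 om -> om 0 = 0 -> (forall z, Cmod z < 1 -> Cmod (om z) <= 1) ->
  Cmod (coef om (1 / 2) 1) + Cmod (coef om (1 / 2) (S k)) / 2 <= 1.
Proof.
intros Hk Hd H0 H1. assert (HP := PI_RGT_0).
set (c1 := coef om (1 / 2) 1). set (c2 := coef om (1 / 2) (S k)).
assert (main : forall r, 0 < r < 1 -> r * (Cmod c1 + r ^ k * Cmod c2 / 2) <= 1).
{ intros r Hr.
  assert (Hc : circ_cont om r) by (intros z Hz; apply (diff_on_cont 1); auto; lra).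
  assert (Hnz : forall z, Cmod z = r -> z <> 0) by (intros z Hz; apply Cmod_gt_0; lra).
  assert (Hr0 : RtoC r <> 0) by (apply RtoC_neq; lra).
  (* The rotations u and mu make u c1 and mu u c2 real and nonnegative, so the two contributions add
     up without cancellation. *)
  destruct (rotate_to_modulus c1) as [u [Hu Eu]].
  destruct (rotate_to_modulus (u * c2)) as [mu [Hmu Emu]].
  rewrite Cmod_mult, Hu, Rmult_1_l in Emu.
  (* A z^-k and B z^k are X / 2 and its conjugate on |z| = r, where X = mu (r / z)^k. The conjugate
     term contributes [T3], whose mean is 0 because om(0) = 0. *)
  set (A := (mu * RtoC (r ^ k) / 2)%C). set (B := (Cconj mu / (2 * RtoC (r ^ k)))%C).
  pose (T1 := fun z => (om z * / z ^ 1)%C). pose (T2 := fun z => (om z * / z ^ S k)%C).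
  pose (T3 := fun z => (om z * z ^ pred k)%C).
  pose (T := fun z => (u * (T1 z + (A * T2 z + B * T3 z)))%C).
  assert (CT1 : circ_cont T1 r).
  { intros z Hz. apply (ccont_mult (U := C_UniformSpace)); [now apply Hc | apply ccont_inv_pow; auto]. }
  assert (CT2 : circ_cont T2 r).
  { intros z Hz. apply (ccont_mult (U := C_UniformSpace)); [now apply Hc | apply ccont_inv_pow; auto]. }
  assert (CT3 : circ_cont T3 r).
  { intros z Hz. apply (ccont_mult (U := C_UniformSpace)); [now apply Hc|].
    apply (ccont_pow (U := C_UniformSpace) (fun z => z)), ccont_id. }
  assert (Csc : forall (k : C) f, circ_cont f r -> circ_cont (fun z => k * f z)%C r).
  { intros k' f Hf z Hz. apply (ccont_mult (U := C_UniformSpace)); [apply ccont_const | now apply Hf]. }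
  assert (Cpl : forall f g, circ_cont f r -> circ_cont g r -> circ_cont (fun z => f z + g z)%C r).
  { intros f g Hf Hg z Hz. apply (ccont_plus (U := C_UniformSpace)); [now apply Hf | now apply Hg]. }
  assert (P2 : RtoC (2 * PI) <> 0) by (apply RtoC_neq; lra).
  assert (M1 : cmean T1 r = (RtoC (2 * PI) * c1)%C).
  { unfold c1. rewrite (coef_indep om 1 (1 / 2) r) by (auto; lra). unfold coef, T1. field. exact P2. }
  assert (M2 : cmean T2 r = (RtoC (2 * PI) * c2)%C).
  { unfold c2. rewrite (coef_indep om 1 (1 / 2) r) by (auto; lra). unfold coef, T2. field. exact P2. }
  assert (M3 : cmean T3 r = 0).
  { unfold T3. rewrite (diff_on_mean 1) by (auto using diff_on_mult_pow). rewrite H0. ring. }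
  assert (MT : cmean T r = RtoC (2 * PI * (Cmod c1 + r ^ k * Cmod c2 / 2))).
  { unfold T. rewrite cmean_scal; [|lra|auto].
    rewrite (cmean_plus T1 (fun z => A * T2 z + B * T3 z)%C); [|lra|auto|auto].
    rewrite (cmean_plus (fun z => A * T2 z)%C (fun z => B * T3 z)%C), !cmean_scal, M1, M2, M3; auto; try lra.
    rewrite (RtoC_mult (2 * PI)), RtoC_plus, RtoC_div, (RtoC_mult (r ^ k)), <- Eu, <- Emu by lra.
    unfold A. field. }
  (* On the circle the real part of G is the nonnegative kernel 1 + Re X divided by r, a majorant of
     Re T since |om| <= 1. *)
  pose (G := fun z => (/ RtoC r * (1 + (mu * RtoC (r ^ k)) * / z ^ k))%C).
  assert (CG1 : circ_cont (fun z => / z ^ k)%C r) by (intros z Hz; apply ccont_inv_pow; auto).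
  assert (C1 : circ_cont (fun _ => RtoC 1) r) by (intros z Hz; apply ccont_const).
  assert (MG : cmean G r = RtoC (2 * PI / r)).
  { unfold G. rewrite cmean_scal; [|lra|auto].
    rewrite (cmean_plus (fun _ => RtoC 1) (fun z => (mu * RtoC (r ^ k)) * / z ^ k)%C); [|lra|auto|auto].
    rewrite cmean_scal, cmean_inv_pow, cmean_const; auto; try lra.
    unfold Rdiv. rewrite (RtoC_mult (2 * PI)), RtoC_inv by lra. ring. }
  assert (L := Re_cmean_le T G r ltac:(lra)). rewrite MT, MG, !re_RtoC in L.
  assert (L' : 2 * PI * (Cmod c1 + r ^ k * Cmod c2 / 2) <= 2 * PI / r).
  { apply L; [unfold T; auto | unfold G; auto |].
    intros z Hz. specialize (Hnz z Hz).
    assert (Hzk := Cpow_nz z k Hnz). assert (Hrk := Cpow_nz (RtoC r) k Hr0).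
    set (X := (mu * RtoC (r ^ k) * / z ^ k)%C).
    assert (EX : Cconj X = (Cconj mu * z ^ k / RtoC (r ^ k))%C).
    { unfold X. rewrite !Cmult_conj, Cinv_conj, Cpow_conj, (conj_on_circle z r) by (auto; lra).
      rewrite !RtoC_pow. unfold Cdiv at 1. rewrite Cpow_mult_l, Cpow_inv by auto.
      rewrite RtoC_mult, Cpow_mult_l.
      replace (Cconj (RtoC r ^ k)) with (RtoC r ^ k)%C; [field; auto|].
      rewrite Cpow_conj. f_equal. unfold Cconj, RtoC; simpl. f_equal. ring. }
    assert (Hre : RtoC (Re X) = ((X + Cconj X) / 2)%C) by apply re_alt.
    assert (HX : Cmod X = 1).
    { unfold X. rewrite !Cmod_mult, Cmod_inv, Cmod_pow, Cmod_R, Hmu, Hz by auto.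
      rewrite Rabs_pos_eq by (apply pow_le; lra). field. apply pow_nonzero; lra. }
    assert (ET : T z = (u * (om z * / z) * RtoC (1 + Re X))%C).
    { rewrite RtoC_plus, Hre, EX. unfold T, T1, T2, T3, A, B, X.
      rewrite RtoC_pow. replace (z ^ k)%C with (z * z ^ pred k)%C by (destruct k; [lia|reflexivity]).
      rewrite (Cpow_S z k), Cpow_1_r.
      replace (z ^ k)%C with (z * z ^ pred k)%C by (destruct k; [lia|reflexivity]). field.
      repeat split; auto. now apply Cpow_nz. }
    assert (HreX : -1 <= Re X).
    { assert (Q := re_le_Cmod X). rewrite HX in Q. apply Rabs_le_between in Q. lra. }
    assert (EG : Re (G z) = / r * (1 + Re X)).
    { unfold G. fold X. rewrite <- RtoC_inv by lra. rewrite re_scal_l, re_plus, re_RtoC. reflexivity. }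
    rewrite EG. eapply Rle_trans; [apply Rle_abs|]. eapply Rle_trans; [apply re_le_Cmod|].
    rewrite ET, !Cmod_mult, Cmod_inv, Hu, Hz, Cmod_R by auto.
    rewrite (Rabs_pos_eq (1 + Re X)), Rmult_1_l by lra.
    apply Rmult_le_compat_r; [lra|]. rewrite <- (Rmult_1_l (/ r)) at 2.
    apply Rmult_le_compat_r; [left; apply Rinv_0_lt_compat; lra|]. apply H1. lra. }
  apply Rmult_le_reg_l with (2 * PI / r); [apply Rdiv_lt_0_compat; lra|].
  replace (2 * PI / r * (r * (Cmod c1 + r ^ k * Cmod c2 / 2)))
    with (2 * PI * (Cmod c1 + r ^ k * Cmod c2 / 2)) by (field; lra). lra. }
assert (p1 := Cmod_ge_0 c1). assert (p2 := Cmod_ge_0 c2).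
set (S0 := Cmod c1 + Cmod c2 / 2). fold S0.
destruct (Rle_lt_dec S0 1) as [|HS]; auto. exfalso.
set (m := INR (S k)). assert (Hm : 1 <= m).
{ unfold m. rewrite S_INR. assert (Z := pos_INR k). lra. }
(* Passage r -> 1 with r = 1 - t: by Bernoulli's inequality r^(k+1) >= 1 - m t, and this t makes (1
   - m t) S0 = (S0 + 1) / 2 > 1. *)
set (t := (S0 - 1) / (2 * S0 * m)).
assert (Hpos : 0 < 2 * S0 * m) by (repeat apply Rmult_lt_0_compat; lra).
assert (Ht0 : 0 < t) by (apply Rdiv_lt_0_compat; lra).
assert (Ht : t * (2 * S0 * m) = S0 - 1) by (unfold t; field; lra).
assert (Ht1 : t < 1).
{ apply Rmult_lt_reg_r with (1 := Hpos). rewrite Ht. nra. }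
assert (Bern : forall n, 1 - INR n * t <= (1 - t) ^ n).
{ induction n as [|n IH]; [simpl; lra|]. rewrite S_INR. simpl. assert (Z := pos_INR n).
  apply Rle_trans with ((1 - t) * (1 - INR n * t)); [nra | apply Rmult_le_compat_l; lra]. }
specialize (main (1 - t) ltac:(lra)).
assert (B := Bern (S k)). fold m in B. simpl in B. set (q := (1 - t) ^ k) in *.
assert (Hq : q <= 1).
{ apply Rle_trans with (1 ^ k); [apply pow_incr; lra | rewrite pow1; lra]. }
assert ((1 - m * t) * S0 <= 1).
{ apply Rle_trans with ((1 - t) * q * S0); [apply Rmult_le_compat_r; unfold S0; lra|].
  apply Rle_trans with (2 := main). unfold S0.
  rewrite Rmult_assoc. apply Rmult_le_compat_l; [lra|]. nra. }
nra.
Qed.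

(** On |z| = r the Poisson kernel (r^2 - |w|^2) / |z - w|^2 is the sum of z / (z - w), which
    reproduces P(w) by Cauchy's formula, and of a term holomorphic past the circle and vanishing at
    0, whose mean is 0. The kernel is at least (r - |w|) / (r + |w|); then r tends to 1. *)
Theorem Harnack P w : diff_on 1 P -> (forall z, Cmod z < 1 -> 0 <= Re (P z)) -> Cmod w < 1 ->
  (1 - Cmod w) * Re (P 0) <= (1 + Cmod w) * Re (P w).
Proof.
intros Hd Hpos Hw. assert (HP := PI_RGT_0). set (a := Cmod w) in *. assert (Ha := Cmod_ge_0 w). fold a in Ha.
assert (main : forall r, a < r < 1 -> (r - a) * Re (P 0) <= (r + a) * Re (P w)).
{ intros r Hr.
  assert (Hc : circ_cont P r) by (intros z Hz; apply (diff_on_cont 1); auto; lra).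
  assert (Hk := kernel_cont P r w Hc (proj1 Hr) 0).
  assert (Cauchy := Cauchy_formula P 1 r w Hd (proj1 Hr) (proj2 Hr)).
  pose (T1 := fun z => (P z * (z / (z - w)))%C).
  assert (CT1 : circ_cont T1 r).
  { intros z Hz. apply (ccont_ext (U := C_UniformSpace) (fun z => P z * / z ^ 0 * (z / (z - w)))%C).
    - intros t. unfold T1. simpl. f_equal. field. 
    - now apply Hk. }
  pose (T2 := fun z => (P z * (z * (Cconj w * / (RtoC (r * r) - Cconj w * z))))%C).
  (* The denominator r^2 - conj(w) z vanishes only for |z| = r^2 / a. The radius 2 r^2 / (r + a)
     does not exceed this, is larger than r, and remains meaningful for a = 0. *)
  set (R' := Rmin 1 (2 * r * r / (r + a))).
  assert (HR1 : R' <= 1) by apply Rmin_l.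
  assert (HR2 : R' <= 2 * r * r / (r + a)) by apply Rmin_r.
  assert (HR3 : r < R').
  { apply Rmin_glb_lt; [lra|]. apply Rmult_lt_reg_r with (r + a); [lra|].
    unfold Rdiv. rewrite Rmult_assoc, Rinv_l by lra. nra. }
  assert (Hden : forall z, Cmod z < R' -> (RtoC (r * r) - Cconj w * z)%C <> 0).
  { intros z Hz E. assert (E' : Cmod (Cconj w * z) = Cmod (RtoC (r * r))).
    { f_equal. apply Ceq_minus in E. now symmetry. }
    rewrite Cmod_mult, Cmod_conj, Cmod_R, Rabs_pos_eq in E' by nra. fold a in E'.
    assert (Z := Cmod_ge_0 z).
    assert (K : Cmod z * (r + a) < 2 * r * r).
    { apply Rmult_lt_reg_r with (/ (r + a)); [apply Rinv_0_lt_compat; lra|].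
      rewrite Rmult_assoc, Rinv_r by lra. unfold Rdiv in HR2. lra. }
    nra. }
  assert (DT2 : diff_on R' T2).
  { intros z Hz. destruct (Hd z ltac:(lra)) as [l Hl]. eexists. unfold T2.
    apply Cdiff_mult; [exact Hl|]. apply Cdiff_mult; [apply Cdiff_id|].
    apply Cdiff_mult; [apply Cdiff_const|].
    apply (Cdiff_inv (fun z => RtoC (r * r) - Cconj w * z)%C); [|now apply Hden].
    apply Cdiff_minus; [apply Cdiff_const|]. apply Cdiff_mult; [apply Cdiff_const | apply Cdiff_id]. }
  assert (CT2 : circ_cont T2 r) by (intros z Hz; apply (diff_on_cont R'); auto; lra).
  assert (M2 : cmean T2 r = 0).
  { rewrite (diff_on_mean R') by (auto; lra). unfold T2. ring. }
  pose (G := fun z => (RtoC ((r - a) / (r + a)) * P z)%C).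
  assert (CG : circ_cont G r).
  { intros z Hz. apply (ccont_mult (U := C_UniformSpace)); [apply ccont_const | now apply Hc]. }
  assert (MG : cmean G r = (RtoC (2 * PI) * (RtoC ((r - a) / (r + a)) * P 0))%C).
  { unfold G. rewrite cmean_scal, (diff_on_mean 1) by (auto; lra). ring. }
  assert (L : Re (cmean G r) <= Re (cmean (fun z => T1 z + T2 z)%C r)).
  { apply Re_cmean_le; [lra|auto| |].
    { intros z Hz. apply (ccont_plus (U := C_UniformSpace)); auto. }
    intros z Hz. assert (Hnz : z <> 0) by (apply Cmod_gt_0; lra).
    assert (Hzw : (z - w)%C <> 0) by (apply Cminus_eq_contra; intros ->; fold a in Hz; lra).
    assert (Hm := proj1 (Cmod_gt_0 _) Hzw).
    assert (E : (T1 z + T2 z)%C = (RtoC ((r * r - a * a) / (Cmod (z - w) * Cmod (z - w))) * P z)%C).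
    { unfold Rdiv. rewrite RtoC_mult, RtoC_inv by nra.
      replace (RtoC (Cmod (z - w) * Cmod (z - w))) with ((z - w) * Cconj (z - w))%C.
      2: { rewrite <- Cmod2_conj. f_equal. simpl. ring. }
      replace (RtoC (r * r - a * a)) with (z * Cconj z - w * Cconj w)%C.
      2: { rewrite <- !Cmod2_conj, Hz. fold a. rewrite <- RtoC_minus. f_equal. simpl. ring. }
      unfold T1, T2.
      replace (RtoC (r * r)) with (z * Cconj z)%C.
      2: { rewrite <- !Cmod2_conj, Hz. f_equal. simpl. ring. }
      assert (Hcz : Cconj (z - w) <> 0) by (apply Cmod_gt_0; now rewrite Cmod_conj).
      rewrite Cminus_conj in *. field. repeat split; auto.
      replace (z * Cconj z - Cconj w * z)%C with (z * (Cconj z - Cconj w))%C by ring.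
      now apply Cmult_neq_0. }
    rewrite E. unfold G. rewrite !re_scal_l. apply Rmult_le_compat_r; [apply Hpos; lra|].
    assert (T := Cmod_triangle z (- w)). rewrite Cmod_opp, Hz in T. fold a in T.
    change (Cmod (z - w) <= r + a) in T. set (m := Cmod (z - w)) in *.
    apply Rle_trans with ((r * r - a * a) / ((r + a) * (r + a))).
    - right. field. lra.
    - apply Rmult_le_compat_l; [nra|]. apply Rinv_le_contravar; nra. }
  rewrite MG, (cmean_plus T1 T2), M2 in L; auto; [|lra].
  unfold T1 in L. rewrite Cauchy, Cplus_0_r, !re_scal_l in L.
  apply Rmult_le_reg_l with (2 * PI / (r + a)); [apply Rdiv_lt_0_compat; lra|].
  replace (2 * PI / (r + a) * ((r - a) * Re (P 0))) with (2 * PI * ((r - a) / (r + a) * Re (P 0))) by (field; lra).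
  replace (2 * PI / (r + a) * ((r + a) * Re (P w))) with (2 * PI * Re (P w)) by (field; lra). exact L. }
set (p0 := Re (P 0)) in *. set (pw := Re (P w)) in *.
destruct (Rle_lt_dec ((1 - a) * p0) ((1 + a) * pw)) as [|HS]; auto. exfalso.
set (D := (1 - a) * p0 - (1 + a) * pw). assert (HD : 0 < D) by (unfold D; lra).
set (m := 1 + Rabs (p0 - pw)). assert (Hm : 1 <= m) by (unfold m; assert (Z := Rabs_pos (p0 - pw)); lra).
(* For r = 1 - t the inequality reads D <= t (p0 - pw), and this t bounds the right side by D /
   2. *)
set (t := Rmin ((1 - a) / 2) (D / (2 * m))).
assert (Ht1 : t <= (1 - a) / 2) by apply Rmin_l. assert (Ht2 : t <= D / (2 * m)) by apply Rmin_r.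
assert (Ht0 : 0 < t) by (apply Rmin_pos; [lra | apply Rdiv_lt_0_compat; lra]).
specialize (main (1 - t) ltac:(lra)).
assert (K : t * m <= D / 2).
{ apply Rle_trans with (D / (2 * m) * m); [apply Rmult_le_compat_r; lra|]. right. field. lra. }
assert (Z := Rle_abs (p0 - pw)). unfold m, D in *. nra.
Qed.

(** * Third order expansions at the origin *)

(** The origin is left out, so that expressions obtained by dividing by z can be estimated whatever
    their value at 0. *)
Definition bigO (n : nat) (f : C -> C) : Prop :=
  exists K d, 0 <= K /\ 0 < d /\ forall z, 0 < Cmod z < d -> Cmod (f z) <= K * Cmod z ^ n.

Lemma bigO_ext_loc n f g d : 0 < d -> (forall z, 0 < Cmod z < d -> f z = g z) -> bigO n f -> bigO n g.
Proof.
intros Hd E [K [d' [HK [Hd' H]]]]. exists K, (Rmin d d'). split; auto. split; [now apply Rmin_pos|].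
intros z Hz. assert (L1 := Rmin_l d d'). assert (L2 := Rmin_r d d').
rewrite <- E by lra. apply H; lra.
Qed.

Lemma bigO_ext n f g : (forall z, f z = g z) -> bigO n f -> bigO n g.
Proof. intros E. apply (bigO_ext_loc n f g 1); auto. lra. Qed.

Lemma bigO_plus n f g : bigO n f -> bigO n g -> bigO n (fun z => f z + g z)%C.
Proof.
intros [K [d [HK [Hd H]]]] [K' [d' [HK' [Hd' H']]]]. exists (K + K'), (Rmin d d').
split; [lra|]. split; [now apply Rmin_pos|].
intros z Hz. assert (L1 := Rmin_l d d'). assert (L2 := Rmin_r d d').
eapply Rle_trans; [apply Cmod_triangle|]. rewrite Rmult_plus_distr_r.
apply Rplus_le_compat; [apply H | apply H']; lra.
Qed.

Lemma bigO_mult n m f g : bigO n f -> bigO m g -> bigO (n + m) (fun z => f z * g z)%C.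
Proof.
intros [K [d [HK [Hd H]]]] [K' [d' [HK' [Hd' H']]]]. exists (K * K'), (Rmin d d').
split; [now apply Rmult_le_pos|]. split; [now apply Rmin_pos|].
intros z Hz. assert (L1 := Rmin_l d d'). assert (L2 := Rmin_r d d').
rewrite Cmod_mult, pow_add.
replace (K * K' * (Cmod z ^ n * Cmod z ^ m)) with (K * Cmod z ^ n * (K' * Cmod z ^ m)) by ring.
apply Rmult_le_compat; try apply Cmod_ge_0; [apply H | apply H']; lra.
Qed.

Lemma bigO_opp n f : bigO n f -> bigO n (fun z => - f z)%C.
Proof.
intros [K [d [HK [Hd H]]]]. exists K, d. repeat split; auto. intros z Hz. rewrite Cmod_opp. auto.
Qed.

Lemma bigO_minus n f g : bigO n f -> bigO n g -> bigO n (fun z => f z - g z)%C.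
Proof. intros H1 H2. apply bigO_plus; [exact H1 | now apply bigO_opp]. Qed.

Lemma bigO_weaken n m f : (m <= n)%nat -> bigO n f -> bigO m f.
Proof.
intros Hnm [K [d [HK [Hd H]]]]. exists K, (Rmin 1 d). split; auto. split; [apply Rmin_pos; lra|].
intros z Hz. assert (L1 := Rmin_l 1 d). assert (L2 := Rmin_r 1 d).
eapply Rle_trans; [apply H; lra|]. apply Rmult_le_compat_l; auto.
replace n with (m + (n - m))%nat by lia. rewrite pow_add. rewrite <- (Rmult_1_r (Cmod z ^ m)) at 2.
apply Rmult_le_compat_l; [apply pow_le; lra|].
rewrite <- (pow1 (n - m)). apply pow_incr. lra.
Qed.

Lemma bigO_ccont (f : C -> C) : ccont (U := C_UniformSpace) f (RtoC 0) -> bigO 0 f.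
Proof.
intros H. destruct (proj1 (ccont_C_eps _ _) H 1 Rlt_0_1) as [d [Hd K]].
exists (Cmod (f 0) + 1), d. assert (Z := Cmod_ge_0 (f 0)). split; [lra|]. split; auto.
intros z Hz. simpl. rewrite Rmult_1_r.
specialize (K z). replace (z - 0)%C with z in K by ring. specialize (K (proj2 Hz)).
assert (T := Cmod_triangle (f z - f 0) (f 0)). replace (f z - f 0 + f 0)%C with (f z) in T by ring. lra.
Qed.

Lemma bigO_pow n : bigO n (fun z => z ^ n)%C.
Proof.
exists 1, 1. split; [lra|]. split; [lra|]. intros z _. rewrite Cmod_pow. lra.
Qed.

(** The inner function may vanish off the origin, where the punctured estimate says nothing about f;
    f(0) = 0 covers those points. *)
Lemma bigO_comp n (f om : C -> C) : f 0 = 0 -> (0 < n)%nat -> bigO n f -> bigO 1 om -> bigO n (fun z => f (om z)).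
Proof.
intros Hf0 Hn [K [d [HK [Hd H]]]] [K' [d' [HK' [Hd' H']]]].
exists (K * K' ^ n), (Rmin d' (d / (K' + 1))).
assert (Hdk : 0 < d / (K' + 1)) by (apply Rdiv_lt_0_compat; lra).
split; [apply Rmult_le_pos; auto; now apply pow_le|]. split; [now apply Rmin_pos|].
intros z Hz. assert (L1 := Rmin_l d' (d / (K' + 1))). assert (L2 := Rmin_r d' (d / (K' + 1))).
specialize (H' z ltac:(lra)). rewrite pow_1 in H'.
assert (B : Cmod (om z) ^ n <= (K' * Cmod z) ^ n).
{ apply pow_incr. split; auto. apply Cmod_ge_0. }
rewrite Rpow_mult_distr in B. rewrite Rmult_assoc.
destruct (Ceq_dec (om z) 0) as [E|E].
- rewrite E, Hf0, Cmod_0. apply Rmult_le_pos; auto. apply Rmult_le_pos; apply pow_le; lra.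
- eapply Rle_trans; [apply H|now apply Rmult_le_compat_l].
  split; [now apply Cmod_gt_0|]. apply Rle_lt_trans with (1 := H').
  apply Rle_lt_trans with ((K' + 1) * Cmod z); [apply Rmult_le_compat_r; lra|].
  apply Rlt_le_trans with ((K' + 1) * (d / (K' + 1))).
  + apply Rmult_lt_compat_l; lra.
  + right. field. lra.
Qed.

(** The mean value inequality on the segment from 0 to z gains one factor |z|. This is the device by
    which all expansions below are obtained from differential equations. *)
Lemma bigO_integrate n (f df : C -> C) d : 0 < d -> f 0 = 0 -> ccont (U := C_UniformSpace) f (RtoC 0) ->
  (forall z, 0 < Cmod z < d -> Cdiff f z (df z)) -> bigO n df -> bigO (S n) f.
Proof.
intros Hd Hf0 Hc HD [K [d' [HK [Hd' H]]]]. exists K, (Rmin d d'). split; auto. split; [now apply Rmin_pos|].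
intros z Hz. assert (L1 := Rmin_l d d'). assert (L2 := Rmin_r d d').
assert (B := seg_bound f (fun t => df (0 + RtoC t * z)%C) 0 z (K * Cmod z ^ n)).
assert (Hm : forall t, 0 < t -> Cmod (0 + RtoC t * z) = t * Cmod z).
{ intros t Ht. rewrite Cplus_0_l, Cmod_mult, Cmod_R, Rabs_pos_eq; lra. }
assert (Hm' : forall t, 0 < t <= 1 -> 0 < Cmod (0 + RtoC t * z) <= Cmod z).
{ intros t Ht. rewrite Hm by lra. split; [apply Rmult_lt_0_compat; lra | nra]. }
replace (f z) with (f (0 + z)%C - f 0)%C by (rewrite Hf0, Cplus_0_l; ring).
simpl. replace (K * (Cmod z * Cmod z ^ n)) with (K * Cmod z ^ n * Cmod z) by ring.
apply B.
- intros t Ht. apply HD. assert (Q := Hm' t ltac:(lra)). lra.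
- intros t Ht. destruct (Rle_lt_or_eq_dec 0 t (proj1 Ht)) as [Ht0|<-].
  + eapply Cdiff_cont, HD. assert (Q := Hm' t ltac:(lra)). lra.
  + replace (0 + RtoC 0 * z)%C with (RtoC 0) by ring. exact Hc.
- intros t Ht. assert (Q := Hm' t ltac:(lra)). eapply Rle_trans; [apply H; lra|].
  apply Rmult_le_compat_l; auto. apply pow_incr. lra.
Qed.

Lemma bigO_const_0 n (c : C) : bigO (S n) (fun _ => c) -> c = 0.
Proof.
intros H. apply (bigO_weaken _ 1) in H; [|lia]. destruct H as [K [d [HK [Hd H]]]].
apply Cmod_eq_0. apply Rle_antisym; [|apply Cmod_ge_0]. apply le_epsilon. intros eps He. rewrite Rplus_0_l.
set (t := Rmin (d / 2) (eps / (K + 1))).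
assert (L1 : t <= d / 2) by apply Rmin_l. assert (L2 : t <= eps / (K + 1)) by apply Rmin_r.
assert (Ht : 0 < t) by (apply Rmin_pos; [lra | apply Rdiv_lt_0_compat; lra]).
specialize (H (RtoC t)). rewrite Cmod_R, Rabs_pos_eq, pow_1 in H by lra.
eapply Rle_trans; [apply H; lra|]. apply Rle_trans with ((K + 1) * (eps / (K + 1))).
- apply Rmult_le_compat; lra.
- right. field. lra.
Qed.

Lemma bigO_divide n f : bigO (S n) (fun z => z * f z)%C -> bigO n f.
Proof.
intros [K [d [HK [Hd H]]]]. exists K, d. repeat split; auto. intros z Hz.
apply Rmult_le_reg_l with (Cmod z); [lra|]. rewrite <- Cmod_mult.
eapply Rle_trans; [now apply H|]. simpl. right. ring.
Qed.

Definition jet (f : C -> C) (a0 a1 a2 a3 : C) : Prop :=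
  bigO 4 (fun z => f z - (a0 + a1 * z + a2 * z ^ 2 + a3 * z ^ 3))%C.

Lemma jet_eq f a0 a1 a2 a3 b0 b1 b2 b3 : jet f a0 a1 a2 a3 ->
  a0 = b0 -> a1 = b1 -> a2 = b2 -> a3 = b3 -> jet f b0 b1 b2 b3.
Proof. intros H -> -> -> ->. exact H. Qed.

Ltac poly_cont := cbv beta; repeat match goal with
  | |- ccont (fun _ => ?c) _ => apply (ccont_const c)
  | |- ccont (fun z => z) _ => apply ccont_id
  | |- ccont (fun z => Cplus (@?f z) (@?g z)) _ => apply (ccont_plus (U := C_UniformSpace) f g)
  | |- ccont (fun z => Cminus (@?f z) (@?g z)) _ => apply (ccont_minus (U := C_UniformSpace) f g)
  | |- ccont (fun z => Cmult (@?f z) (@?g z)) _ => apply (ccont_mult (U := C_UniformSpace) f g)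
  | |- ccont (fun z => Cpow (@?f z) ?n) _ => apply (ccont_pow (U := C_UniformSpace) f n)
  end.

Lemma jet_poly a0 a1 a2 a3 : jet (fun z => a0 + a1 * z + a2 * z ^ 2 + a3 * z ^ 3)%C a0 a1 a2 a3.
Proof.
exists 0, 1. split; [lra|]. split; [lra|]. intros z _.
match goal with |- Cmod ?u <= _ => replace u with (RtoC 0) by ring end. rewrite Cmod_0. lra.
Qed.

Lemma jet_ext_loc f g d a0 a1 a2 a3 : 0 < d -> (forall z, 0 < Cmod z < d -> f z = g z) ->
  jet f a0 a1 a2 a3 -> jet g a0 a1 a2 a3.
Proof. intros Hd E. apply (bigO_ext_loc 4 _ _ d Hd). intros z Hz. now rewrite E. Qed.

Lemma jet_bounded f a0 a1 a2 a3 : jet f a0 a1 a2 a3 -> bigO 0 f.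
Proof.
intros H. apply (bigO_ext 0 (fun z => (f z - (a0 + a1 * z + a2 * z ^ 2 + a3 * z ^ 3)) +
  (a0 + a1 * z + a2 * z ^ 2 + a3 * z ^ 3))%C); [intros; ring|].
apply bigO_plus; [apply (bigO_weaken 4); [lia|exact H]|]. apply bigO_ccont. poly_cont.
Qed.

Lemma jet_plus f g a0 a1 a2 a3 b0 b1 b2 b3 : jet f a0 a1 a2 a3 -> jet g b0 b1 b2 b3 ->
  jet (fun z => f z + g z)%C (a0 + b0) (a1 + b1) (a2 + b2) (a3 + b3).
Proof.
intros H1 H2. eapply bigO_ext; [|exact (bigO_plus _ _ _ H1 H2)]. intros z. cbv beta. ring.
Qed.

Lemma jet_mult f g a0 a1 a2 a3 b0 b1 b2 b3 : jet f a0 a1 a2 a3 -> jet g b0 b1 b2 b3 ->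
  jet (fun z => f z * g z)%C (a0 * b0) (a0 * b1 + a1 * b0) (a0 * b2 + a1 * b1 + a2 * b0)
    (a0 * b3 + a1 * b2 + a2 * b1 + a3 * b0).
Proof.
intros H1 H2. assert (B := jet_bounded _ _ _ _ _ H1).
assert (H3 := bigO_mult 0 4 _ _ B H2).
assert (H4 : bigO (4 + 0) (fun z => (f z - (a0 + a1 * z + a2 * z ^ 2 + a3 * z ^ 3)) *
   (b0 + b1 * z + b2 * z ^ 2 + b3 * z ^ 3))%C).
{ apply bigO_mult; [exact H1|]. apply bigO_ccont. poly_cont. }
(* The terms of degrees 4 to 6 in the product of the two cubic polynomials. *)
assert (H5 : bigO (4 + 0) (fun z => z ^ 4 * ((a1 * b3 + a2 * b2 + a3 * b1) + (a2 * b3 + a3 * b2) * z +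
   a3 * b3 * z ^ 2))%C).
{ apply bigO_mult; [apply bigO_pow|]. apply bigO_ccont. poly_cont. }
simpl plus in H3, H4, H5.
eapply bigO_ext; [|exact (bigO_plus _ _ _ (bigO_plus _ _ _ H3 H4) H5)]. intros z. cbv beta. ring.
Qed.

Lemma jet_const c : jet (fun _ => c) c 0 0 0.
Proof. eapply bigO_ext; [|exact (jet_poly c 0 0 0)]. intros z. cbv beta. ring. Qed.

Lemma jet_id : jet (fun z => z) 0 1 0 0.
Proof. eapply bigO_ext; [|exact (jet_poly 0 1 0 0)]. intros z. cbv beta. ring. Qed.

Lemma jet_scal k f a0 a1 a2 a3 : jet f a0 a1 a2 a3 ->
  jet (fun z => k * f z)%C (k * a0) (k * a1) (k * a2) (k * a3).
Proof.
intros H. eapply jet_eq; [exact (jet_mult _ _ _ _ _ _ _ _ _ _ (jet_const k) H)|..]; ring.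
Qed.

Lemma jet_bigO1 f a1 a2 a3 : jet f 0 a1 a2 a3 -> bigO 1 f.
Proof.
intros H. apply (bigO_ext 1 (fun z => (f z - (0 + a1 * z + a2 * z ^ 2 + a3 * z ^ 3)) +
  z ^ 1 * (a1 + a2 * z + a3 * z ^ 2))%C); [intros; ring|].
apply bigO_plus; [apply (bigO_weaken 4); [lia|exact H]|].
apply (bigO_mult 1 0); [apply bigO_pow|]. apply bigO_ccont. poly_cont.
Qed.

Lemma jet_comp (f om : C -> C) a0 a1 a2 a3 b1 b2 b3 : f 0 = a0 -> jet f a0 a1 a2 a3 -> jet om 0 b1 b2 b3 ->
  jet (fun z => f (om z)) a0 (a1 * b1) (a1 * b2 + a2 * b1 ^ 2)
    (a1 * b3 + 2 * a2 * b1 * b2 + a3 * b1 ^ 3).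
Proof.
intros Hf0 Hf Hom.
assert (E0 : (f 0 - (a0 + a1 * 0 + a2 * 0 ^ 2 + a3 * 0 ^ 3))%C = 0) by (rewrite Hf0; ring).
assert (H4 := bigO_comp 4 _ om E0 ltac:(lia) Hf (jet_bigO1 _ _ _ _ Hom)).
assert (J2 := jet_mult _ _ _ _ _ _ _ _ _ _ Hom Hom).
assert (J3 := jet_mult _ _ _ _ _ _ _ _ _ _ Hom J2).
assert (J := jet_plus _ _ _ _ _ _ _ _ _ _ (jet_plus _ _ _ _ _ _ _ _ _ _
   (jet_plus _ _ _ _ _ _ _ _ _ _ (jet_const a0) (jet_scal a1 _ _ _ _ _ Hom))
   (jet_scal a2 _ _ _ _ _ J2)) (jet_scal a3 _ _ _ _ _ J3)).
eapply bigO_ext; [|exact (bigO_plus _ _ _ H4 J)]. intros z. cbv beta. ring.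
Qed.

(** The difference of the two polynomials is written in Horner form, so its coefficients can be
    shown to vanish one at a time, dividing by z in between. *)
Lemma jet_unique f a0 a1 a2 a3 b0 b1 b2 b3 : jet f a0 a1 a2 a3 -> jet f b0 b1 b2 b3 ->
  a0 = b0 /\ a1 = b1 /\ a2 = b2 /\ a3 = b3.
Proof.
intros H1 H2.
set (e0 := (b0 - a0)%C). set (e1 := (b1 - a1)%C). set (e2 := (b2 - a2)%C). set (e3 := (b3 - a3)%C).
assert (H : bigO 4 (fun z => e0 + z * (e1 + z * (e2 + z * e3)))%C).
{ eapply bigO_ext; [|exact (bigO_minus _ _ _ H1 H2)]. intros z. unfold e0, e1, e2, e3. cbv beta. ring. }
assert (step : forall n e g, ccont (U := C_UniformSpace) g (RtoC 0) ->
   bigO (S n) (fun z => e + z * g z)%C -> e = 0 /\ bigO n g).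
{ intros n e g Hg Hb.
  assert (E : e = 0).
  { apply (bigO_const_0 0). eapply bigO_ext; [|apply bigO_minus; [apply (bigO_weaken _ 1) in Hb; [exact Hb|lia]|
      exact (bigO_mult 1 0 (fun z => z ^ 1)%C g (bigO_pow 1) (bigO_ccont g Hg))]].
    intros z. cbv beta. ring. }
  split; auto. apply bigO_divide. eapply bigO_ext; [|exact Hb]. intros z. cbv beta. rewrite E. ring. }
apply step in H; [|poly_cont]. destruct H as [E0 H].
apply step in H; [|poly_cont]. destruct H as [E1 H].
apply (step 1%nat e2 (fun _ => e3)) in H; [|poly_cont]. destruct H as [E2 H].
apply bigO_const_0 in H.
assert (R : forall a b : C, (b - a)%C = 0 -> a = b).
{ intros a b E. symmetry. now apply Ceq_minus. }
repeat split; apply R; assumption.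
Qed.

(** The error satisfies E' = E + z^3 / 6 and E(0) = 0; starting from boundedness, each integration
    raises its order by one, up to 4. *)
Lemma Cexp_jet : jet Cexp 1 1 (1 / 2) (1 / 6).
Proof.
set (P := fun z => (1 + 1 * z + 1 / 2 * z ^ 2 + 1 / 6 * z ^ 3)%C).
set (E := fun z => (Cexp z - P z)%C).
assert (HD : forall z, Cdiff E z (E z + 1 / 6 * z ^ 3)%C).
{ intros z. eapply Cdiff_eq.
  - apply Cdiff_minus; [apply Cdiff_Cexp|].
    repeat apply Cdiff_plus; repeat (apply Cdiff_mult; try apply Cdiff_const; try apply Cdiff_pow; try apply Cdiff_id).
    apply Cdiff_const.
  - unfold E, P. simpl. rewrite ?RtoC_plus. field. }
assert (HE0 : E 0 = 0) by (unfold E, P; rewrite Cexp_0; ring).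
assert (step : forall n, (n <= 3)%nat -> bigO n E -> bigO (S n) E).
{ intros n Hn HE. apply (bigO_integrate n E _ 1 Rlt_0_1 HE0 (Cdiff_cont _ _ _ (HD _)) (fun z _ => HD z)).
  apply bigO_plus; auto. apply (bigO_weaken 3); auto.
  apply (bigO_mult 0 3 (fun _ => 1 / 6)%C); [|apply bigO_pow]. apply bigO_ccont, ccont_const. }
apply (step 3%nat); auto. apply (step 2%nat); auto. apply (step 1%nat); auto. apply (step 0%nat); auto.
exact (bigO_ccont E (Cdiff_cont _ _ _ (HD _))).
Qed.

(** * The inverse logarithmic coefficients *)

Lemma Re_one_plus z : Cmod z < 1 -> 0 < Re (1 + z).
Proof.
intros Hz. rewrite re_plus, re_RtoC. assert (H := re_le_Cmod z). apply Rabs_le_between in H. lra.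
Qed.

Lemma one_plus_neq_0 z : Cmod z < 1 -> (1 + z)%C <> 0.
Proof. intros Hz E. assert (H := Re_one_plus z Hz). rewrite E in H. simpl in H. lra. Qed.

Lemma Re_Csqrt_gt_0 z : 0 < Re z -> 0 < Re (Csqrt z).
Proof.
intros Hz. simpl. apply sqrt_lt_R0. assert (H := Cmod_ge_0 z). lra.
Qed.

(* The difference quotient of the square root is 1 / (sqrt x + sqrt z). *)
Lemma Cdiff_Csqrt z : 0 < Re (Csqrt z) -> Cdiff Csqrt z (/ (2 * Csqrt z)).
Proof.
intros Hs. set (m := Re (Csqrt z)) in *.
assert (Hre : forall x, m <= Cmod (Csqrt x + Csqrt z)).
{ intros x. apply Rle_trans with (Re (Csqrt x + Csqrt z)).
  - rewrite re_plus. assert (H := Re_Csqrt_ge_0 x). unfold m. lra.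
  - eapply Rle_trans; [apply Rle_abs | apply re_le_Cmod]. }
assert (Hne : forall x, (Csqrt x + Csqrt z)%C <> 0).
{ intros x. apply Cmod_gt_0. specialize (Hre x). lra. }
assert (Hfac : forall x, ((Csqrt x - Csqrt z) * (Csqrt x + Csqrt z))%C = (x - z)%C).
{ intros x. transitivity (Csqrt x * Csqrt x - Csqrt z * Csqrt z)%C; [ring|]. now rewrite !Csqrt_sqr. }
assert (Hc : ccont (U := C_UniformSpace) Csqrt z).
{ apply ccont_C_eps. intros eps He. exists (eps * m). split; [now apply Rmult_lt_0_compat|].
  intros x Hx. rewrite <- Hfac, Cmod_mult in Hx. specialize (Hre x).
  assert (P := Cmod_ge_0 (Csqrt x - Csqrt z)). nra. }
exists (fun x => / (Csqrt x + Csqrt z))%C. split; [|split].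
- f_equal. ring.
- apply (ccont_inv (U := C_UniformSpace) (fun x => Csqrt x + Csqrt z)%C); [|apply Hne].
  apply (ccont_plus (U := C_UniformSpace)); [exact Hc | apply ccont_const].
- intros x. rewrite <- (Hfac x). field. apply Hne.
Qed.

Lemma Csqrt_1 : Csqrt 1 = 1.
Proof.
unfold Csqrt. rewrite Cmod_1. simpl. destruct (Rlt_dec 0 0); [lra|].
replace ((1 + 1) / 2) with 1 by field. replace ((1 - 1) / 2) with 0 by field.
now rewrite sqrt_1, sqrt_0.
Qed.

Lemma psi_AP_0 : psi_AP 0 = 1.
Proof. unfold psi_AP. rewrite Cexp_0, Cplus_0_r, Csqrt_1. ring. Qed.

Lemma psi_AP_diff z : Cmod z < 1 -> Cdiff psi_AP z (psi_AP z * (1 + / (2 * (1 + z)))).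
Proof.
intros Hz. assert (Hp := Re_Csqrt_gt_0 _ (Re_one_plus z Hz)).
assert (Hn : Csqrt (1 + z) <> 0).
{ intros E. rewrite E in Hp. simpl in Hp. lra. }
eapply Cdiff_eq.
- unfold psi_AP. apply Cdiff_mult; [apply Cdiff_Cexp|].
  apply (Cdiff_comp Csqrt (fun z => 1 + z)%C).
  + apply Cdiff_plus; [apply Cdiff_const | apply Cdiff_id].
  + now apply Cdiff_Csqrt.
- unfold psi_AP. transitivity (Cexp z * Csqrt (1 + z) * (1 + / (2 * (Csqrt (1 + z) * Csqrt (1 + z)))))%C.
  + field. exact Hn.
  + now rewrite Csqrt_sqr.
Qed.

(** Same bootstrap as for the exponential, now from psi' = psi (1 + 1 / (2 (1 + z))). *)
Lemma psi_AP_jet : jet psi_AP 1 (3 / 2) (7 / 8) (17 / 48).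
Proof.
set (P := fun z => (1 + 3 / 2 * z + 7 / 8 * z ^ 2 + 17 / 48 * z ^ 3)%C).
set (E := fun z => (psi_AP z - P z)%C).
set (k := fun z => (1 + / (2 * (1 + z)))%C).
(* Q = P k - P'. The coefficients of P are exactly those that cancel its terms of degree below 3. *)
set (Q := fun z => (z ^ 3 * ((33 / 48 + 34 / 48 * z) * / (2 * (1 + z))))%C).
assert (HD : forall z, Cmod z < 1 -> Cdiff E z (E z * k z + Q z)%C).
{ intros z Hz. eapply Cdiff_eq.
  - apply Cdiff_minus; [now apply psi_AP_diff|].
    repeat apply Cdiff_plus; repeat (apply Cdiff_mult; try apply Cdiff_const; try apply Cdiff_pow; try apply Cdiff_id).
    apply Cdiff_const.
  - unfold E, P, k, Q. simpl. rewrite ?RtoC_plus. field. now apply one_plus_neq_0. }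
assert (Z0 : Cmod 0 < 1) by (rewrite Cmod_0; lra).
assert (HE0 : E 0 = 0) by (unfold E, P; rewrite psi_AP_0; ring).
assert (HEc := Cdiff_cont _ _ _ (HD 0 Z0)).
assert (Hinv : ccont (U := C_UniformSpace) (fun z => / (2 * (1 + z)))%C (RtoC 0)).
{ apply (ccont_inv (U := C_UniformSpace) (fun z => 2 * (1 + z))%C); [poly_cont|].
  rewrite Cplus_0_r, Cmult_1_r. apply RtoC_neq. lra. }
assert (Hk : bigO 0 k).
{ apply bigO_ccont. apply (ccont_plus (U := C_UniformSpace)); [apply ccont_const|exact Hinv]. }
assert (HQ : bigO 3 Q).
{ apply (bigO_mult 3 0); [apply bigO_pow|]. apply bigO_ccont.
  apply (ccont_mult (U := C_UniformSpace)); [poly_cont | exact Hinv]. }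
assert (step : forall n, (n <= 3)%nat -> bigO n E -> bigO (S n) E).
{ intros n Hn HE. apply (bigO_integrate n E (fun z => E z * k z + Q z)%C 1); auto; try lra.
  - intros z Hz. apply HD. lra.
  - apply bigO_plus; [|now apply (bigO_weaken 3)].
    replace n with (n + 0)%nat by lia. now apply bigO_mult. }
apply (step 3%nat); auto. apply (step 2%nat); auto. apply (step 1%nat); auto. apply (step 0%nat); auto.
now apply bigO_ccont.
Qed.

Lemma diff_on_jet f R r : diff_on R f -> 0 < r < R ->
  coef f r 0 = f 0 /\ jet f (coef f r 0) (coef f r 1) (coef f r 2) (coef f r 3).
Proof.
intros Hf Hr. destruct (Taylor_remainder f R r Hf Hr) as [M [HM H]]. split.
- specialize (H 0 1%nat). rewrite Cmod_0 in H. specialize (H (proj1 Hr)). simpl in H.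
  assert (E : (f 0 - coef f r 0)%C = 0).
  { apply Cmod_eq_0. apply Rle_antisym; [|apply Cmod_ge_0].
    replace (f 0 - coef f r 0)%C with (f 0 - (0 + coef f r 0 * 1))%C by ring.
    eapply Rle_trans; [exact H|]. right. field. lra. }
  symmetry. now apply Ceq_minus.
- exists (M * (/ r) ^ 4 * 2), (r / 2). split; [|split; [lra|]].
  + apply Rmult_le_pos; [|lra]. apply Rmult_le_pos; auto. apply pow_le. left. apply Rinv_0_lt_compat; lra.
  + intros z Hz. specialize (H z 4%nat ltac:(lra)). simpl csum in H.
    replace (f z - (coef f r 0 + coef f r 1 * z + coef f r 2 * z ^ 2 + coef f r 3 * z ^ 3))%C with
     (f z - (0 + coef f r 0 * z ^ 0 + coef f r 1 * z ^ 1 + coef f r 2 * z ^ 2 + coef f r 3 * z ^ 3))%C by ring.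
    eapply Rle_trans; [exact H|].
    assert (Hq : r / (r - Cmod z) <= 2).
    { apply Rmult_le_reg_r with (r - Cmod z); [lra|]. unfold Rdiv. rewrite Rmult_assoc, Rinv_l; lra. }
    unfold Rdiv. rewrite Rpow_mult_distr.
    replace (M * (/ r) ^ 4 * 2 * Cmod z ^ 4) with (M * (Cmod z ^ 4 * (/ r) ^ 4) * 2) by ring.
    apply Rmult_le_compat_l; [|exact Hq].
    apply Rmult_le_pos; auto. apply Rmult_le_pos; apply pow_le; [lra|]. left. apply Rinv_0_lt_compat; lra.
Qed.

Lemma bounded_of_eventually (u : nat -> R) N B : (forall n, (N <= n)%nat -> u n <= B) ->
  exists B', forall n, u n <= B'.
Proof.
revert B. induction N as [|N IH]; intros B H.
- exists B. intros n. apply H. lia.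
- apply (IH (Rmax B (u N))). intros n Hn. destruct (Nat.eq_dec n N) as [->|Hne].
  + apply Rmax_r.
  + eapply Rle_trans; [apply H; lia | apply Rmax_l].
Qed.

(** [csum a n] stops before index n while [sum_n] includes it, hence the successor. *)
Lemma is_series_eps (a : nat -> C) (l : C) : is_series (K := C_AbsRing) (V := C_NormedModule) a l <->
  forall eps, 0 < eps -> exists N, forall n, (N <= n)%nat -> Cmod (csum a (S n) - l) < eps.
Proof.
assert (E : forall n, sum_n (G := C_AbelianMonoid) a n = csum a (S n)).
{ induction n as [|n IH].
  - rewrite sum_O. simpl. ring.
  - rewrite sum_Sn, IH. reflexivity. }
unfold is_series.
change (filterlim (sum_n (G := C_AbelianMonoid) a) eventually (locally (T := C_UniformSpace) l) <->
  forall eps, 0 < eps -> exists N, forall n, (N <= n)%nat -> Cmod (csum a (S n) - l) < eps).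
rewrite (filterlim_Cmod eventually). split; intros H eps He; destruct (H eps He) as [N HN]; exists N; intros n Hn.
- rewrite <- E. now apply HN.
- rewrite E. now apply HN.
Qed.

(** Only convergence is given. At s = r / 2 consecutive partial sums are eventually close, so the
    terms are bounded there; for |w| < s / 2 the tail from degree 4 on is then dominated by a
    geometric series of ratio at most 1/2. *)
Lemma series_jet (l : C -> C) (a : nat -> C) (r : R) : 0 < r ->
  (forall w, Cmod w < r ->
     is_series (K := C_AbsRing) (V := C_NormedModule) (fun n => (2 * (a (S n) * w ^ S n))%C) (l w)) ->
  jet l 0 (2 * a 1%nat) (2 * a 2%nat) (2 * a 3%nat).
Proof.
intros Hr H. set (s := r / 2). assert (Hs : 0 < s) by (unfold s; lra).
assert (HB : exists B, forall n, Cmod (2 * a (S n)) * s ^ S n <= B).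
{ assert (H0 := H (RtoC s)). rewrite Cmod_R, Rabs_pos_eq in H0 by lra. specialize (H0 ltac:(unfold s; lra)).
  destruct (proj1 (is_series_eps _ _) H0 1 Rlt_0_1) as [N HN].
  apply (bounded_of_eventually _ (S N) 2). intros n Hn.
  assert (h1 := HN n ltac:(lia)). assert (h2 := HN (pred n) ltac:(lia)).
  replace (S (pred n)) with n in h2 by lia. simpl csum in h1.
  set (u := csum _ n) in *.
  replace (Cmod (2 * a (S n)) * s ^ S n) with (Cmod (2 * (a (S n) * RtoC s ^ S n))).
  2: { rewrite !Cmod_mult, Cmod_pow, (Cmod_R s), (Rabs_pos_eq s) by lra. ring. }
  set (t := (2 * (a (S n) * RtoC s ^ S n))%C) in *.
  replace t with ((u + t - l (RtoC s)) + - (u - l (RtoC s)))%C by ring.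
  eapply Rle_trans; [apply Cmod_triangle|]. rewrite Cmod_opp.
  change (2 * (a (S n) * (RtoC s * RtoC s ^ n)))%C with t in h1. lra. }
destruct HB as [B HB].
assert (HB0 : 0 <= B).
{ eapply Rle_trans; [|apply (HB 0%nat)]. apply Rmult_le_pos; [apply Cmod_ge_0 | apply pow_le; lra]. }
exists (2 * B * (/ s) ^ 4), (s / 2). split; [|split; [lra|]].
{ apply Rmult_le_pos; [lra|]. apply pow_le. left. now apply Rinv_0_lt_compat. }
intros w Hw. set (q := Cmod w / s).
assert (Hq0 : 0 <= q) by (apply Rdiv_le_0_compat; lra).
assert (Hq : q <= 1 / 2).
{ apply Rmult_le_reg_r with s; auto. unfold q, Rdiv. rewrite Rmult_assoc, Rinv_l; lra. }
set (b := fun n => (2 * (a (S n) * w ^ S n))%C).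
assert (Hb : forall n, Cmod (b n) <= B * q ^ S n).
{ intros n. unfold b, q, Rdiv. rewrite Rpow_mult_distr, pow_inv, !Cmod_mult, Cmod_pow.
  specialize (HB n). rewrite Cmod_mult in HB.
  assert (P : 0 < s ^ S n) by (apply pow_lt; lra).
  replace (Cmod 2 * (Cmod (a (S n)) * Cmod w ^ S n)) with
    (Cmod 2 * Cmod (a (S n)) * s ^ S n * (Cmod w ^ S n * / s ^ S n)) by (field; lra).
  apply Rmult_le_compat_r; auto. apply Rmult_le_pos; [apply pow_le; lra | left; now apply Rinv_0_lt_compat]. }
(* The bound telescopes: q <= 1/2 gives q^j <= 2 (q^j - q^(j+1)). *)
assert (Hk : forall k, Cmod (csum b (3 + k) - csum b 3) <= 2 * B * (q ^ 4 - q ^ (4 + k))).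
{ induction k as [|k IH].
  - replace (csum b (3 + 0) - csum b 3)%C with (RtoC 0) by (simpl; ring). rewrite Cmod_0, Nat.add_0_r. lra.
  - replace (3 + S k)%nat with (S (3 + k)) by lia.
    replace (csum b (S (3 + k)) - csum b 3)%C with ((csum b (3 + k) - csum b 3) + b (3 + k)%nat)%C
      by (cbn [csum]; ring).
    eapply Rle_trans; [apply Cmod_triangle|]. specialize (Hb (3 + k)%nat).
    replace (4 + S k)%nat with (S (4 + k)) by lia. replace (S (3 + k)) with (4 + k)%nat in Hb by lia.
    cbn [pow] in *. assert (P : 0 <= q ^ (4 + k)) by now apply pow_le.
    set (X := q ^ (4 + k)) in *. set (Y := q * (q * (q * (q * 1)))) in *.
    assert (0 <= B * X) by now apply Rmult_le_pos. nra. }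
replace (l w - (0 + 2 * a 1%nat * w + 2 * a 2%nat * w ^ 2 + 2 * a 3%nat * w ^ 3))%C with (l w - csum b 3)%C.
2: { unfold b. simpl. ring. }
replace (2 * B * (/ s) ^ 4 * Cmod w ^ 4) with (2 * B * q ^ 4) by (unfold q, Rdiv; ring).
apply le_epsilon. intros eps He.
destruct (proj1 (is_series_eps _ _) (H w ltac:(unfold s in Hw; lra)) eps He) as [N HN].
specialize (HN (3 + N)%nat ltac:(lia)). fold b in HN.
specialize (Hk (S N)). replace (3 + S N)%nat with (S (3 + N)) in Hk by lia.
replace (l w - csum b 3)%C with (- (csum b (S (3 + N)) - l w) + (csum b (S (3 + N)) - csum b 3))%C by ring.
eapply Rle_trans; [apply Cmod_triangle|]. rewrite Cmod_opp.
assert (P : 0 <= q ^ (4 + S N)) by now apply pow_le.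
assert (0 <= 2 * B * q ^ (4 + S N)) by (apply Rmult_le_pos; lra). lra.
Qed.

(* With [L z = l (f z)] one has [f z = z exp (- L z)], hence [z L' = 1 - psi (om z)]; comparing
   coefficients in [L = l o f] yields the Gamma's. *)
Theorem Gamma_formulas (f om : C -> C) (Gamma : nat -> C) :
  normalized_analytic f -> (forall z, Defs.disc 1 z -> z <> 0 -> f z <> 0) -> schwarz_function om ->
  (forall z, Defs.disc 1 z -> starlike_quotient f z = psi_AP (om z)) ->
  inverse_log_coefficients f Gamma ->
  forall c1 c2 c3, jet om 0 c1 c2 c3 ->
  Gamma 1%nat = (- (3 / 4) * c1)%C /\
  Gamma 2%nat = (- (3 / 8) * c2 + 29 / 32 * c1 ^ 2)%C /\
  Gamma 3%nat = (- (1 / 4) * (c3 - 67 / 12 * c1 * c2 + 925 / 144 * c1 ^ 3))%C.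
Proof.
intros [Hf [Hf0 _]] Hnz [Hom [Hom0 Hom1]] Hq [g [l [Hg [[Hl [Hl0 Hlg]] Hs]]]] c1 c2 c3 Jom.
assert (Z0 : Cmod 0 < 1) by (rewrite Cmod_0; lra).
assert (Df : forall z, Cmod z < 1 -> Cdiff f z (C_derive f z)) by (intros z Hz; now apply ex_derive_Cdiff, Hf).
assert (Dl : forall z, Cmod z < 1 / 4 -> Cdiff l z (C_derive l z)) by (intros z Hz; now apply ex_derive_Cdiff, Hl).
(* Near the origin |f z| < 1/4, where l is analytic and g inverts f. *)
destruct (proj1 (ccont_C_eps f 0) (Cdiff_cont _ _ _ (Df 0 Z0)) (1 / 4)) as [d0 [Hd0 K0]]; [lra|].
set (d := Rmin 1 d0). assert (d1 : d <= 1) by apply Rmin_l. assert (d2 : d <= d0) by apply Rmin_r.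
assert (Hd : 0 < d) by (apply Rmin_pos; lra).
assert (Hfq : forall z, Cmod z < d -> Cmod (f z) < 1 / 4).
{ intros z Hz. specialize (K0 z). rewrite Hf0 in K0.
  replace (z - 0)%C with z in K0 by ring. replace (f z - 0)%C with (f z) in K0 by ring. apply K0. lra. }
pose (L := fun z => l (f z)).
assert (DL : forall z, Cmod z < d -> Cdiff L z (C_derive l (f z) * C_derive f z)).
{ intros z Hz. apply (Cdiff_comp l f); [apply Df; lra | apply Dl; auto]. }
assert (HL0 : L 0 = 0) by (unfold L; now rewrite Hf0).
(* At w = f(z) one has g(w) = z, so exp(l(w)) = z / f(z). *)
assert (HA : forall z, Cmod z < d -> f z = (z * Cexp (- L z))%C).
{ intros z Hz. destruct (Ceq_dec z 0) as [->|Hz0]; [rewrite Hf0; ring|].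
  assert (Hfz : f z <> 0) by (apply Hnz; auto; unfold Defs.disc; lra).
  destruct (Hg (f z) (Hfq z Hz)) as [_ G].
  assert (Gz : z = g (f z)) by (apply G; auto; unfold Defs.disc; lra).
  assert (E := Hlg (f z) (Hfq z Hz) Hfz). rewrite <- Gz in E. fold (L z) in E.
  rewrite Cexp_opp, E. field. auto. }
set (q1 := (3 / 2 * c1)%C). set (q2 := (3 / 2 * c2 + 7 / 8 * c1 ^ 2)%C).
set (q3 := (3 / 2 * c3 + 2 * (7 / 8) * c1 * c2 + 17 / 48 * c1 ^ 3)%C).
assert (Jp : jet (fun z => psi_AP (om z)) 1 q1 q2 q3) by exact (jet_comp _ _ _ _ _ _ _ _ _ psi_AP_0 psi_AP_jet Jom).
assert (HL' : forall z, 0 < Cmod z < d -> (z * (C_derive l (f z) * C_derive f z))%C = (1 - psi_AP (om z))%C).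
{ intros z Hz. assert (Hz0 : z <> 0) by (apply Cmod_gt_0; lra).
  assert (Hfz : f z <> 0) by (apply Hnz; auto; unfold Defs.disc; lra).
  set (L' := (C_derive l (f z) * C_derive f z)%C).
  assert (D2 : Cdiff f z (1 * Cexp (- L z) + z * (Cexp (- L z) * - L'))%C).
  { apply (Cdiff_ext_loc (fun z => z * Cexp (- L z))%C f z _ (d - Cmod z)); [lra| |].
    - intros x Hx. symmetry. apply HA. assert (T := Cmod_triangle (x - z) z).
      replace (x - z + z)%C with x in T by ring. lra.
    - apply (Cdiff_mult (fun z => z) (fun z => Cexp (- L z)) z 1); [apply Cdiff_id|].
      apply (Cdiff_comp Cexp (fun z => - L z)%C); [|apply Cdiff_Cexp].
      apply Cdiff_opp, DL. lra. }
  apply Cdiff_C_derive in D2.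
  assert (E := Hq z ltac:(unfold Defs.disc; lra)). unfold starlike_quotient in E.
  destruct (Ceq_dec z 0) as [|_]; [contradiction|].
  rewrite <- E, D2, HA by lra. field. split; [apply Cexp_neq_0 | exact Hz0]. }
(* z L' = 1 - psi(om z) has no constant term; dividing by z and integrating divides the coefficient
   of z^k by k. *)
assert (JL : jet L 0 (- q1) (- q2 / 2) (- q3 / 3)).
{ apply (bigO_integrate 3 _ (fun z => C_derive l (f z) * C_derive f z + (q1 + q2 * z + q3 * z ^ 2))%C d Hd).
  - rewrite HL0. ring.
  - apply (ccont_minus (U := C_UniformSpace)); [|poly_cont].
    apply (Cdiff_cont _ _ _ (DL 0 ltac:(rewrite Cmod_0; lra))).
  - intros z Hz. eapply Cdiff_eq.
    + apply Cdiff_minus; [apply DL; lra|].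
      repeat apply Cdiff_plus; repeat (apply Cdiff_mult; try apply Cdiff_const; try apply Cdiff_pow; try apply Cdiff_id).
      apply Cdiff_const.
    + simpl. rewrite ?RtoC_plus. field.
  - apply bigO_divide. apply (bigO_ext_loc 4 (fun z => - (psi_AP (om z) - (1 + q1 * z + q2 * z ^ 2 + q3 * z ^ 3)))%C _ d Hd).
    + intros z Hz. rewrite Cmult_plus_distr_l, HL' by auto. ring.
    + now apply bigO_opp. }
assert (JmL : jet (fun z => - L z)%C 0 q1 (q2 / 2) (q3 / 3)).
{ eapply jet_ext_loc with (d := 1); [lra| |eapply jet_eq; [exact (jet_scal (- (1)) _ _ _ _ _ JL)|..]].
  - intros z _. cbv beta. ring.
  - ring. - ring. - field. - field. }
assert (Je := jet_comp _ _ _ _ _ _ _ _ _ Cexp_0 Cexp_jet JmL).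
assert (Jf : jet f 0 1 q1 (q2 / 2 + q1 ^ 2 / 2)).
{ eapply jet_ext_loc with (d := d); [exact Hd| |eapply jet_eq; [exact (jet_mult _ _ _ _ _ _ _ _ _ _ jet_id Je)|..]].
  - intros z Hz. cbv beta. rewrite HA by lra. reflexivity.
  - ring. - ring. - ring. - field. }
assert (Jl := series_jet l Gamma (1 / 4) ltac:(lra) Hs).
assert (Jlf := jet_comp _ _ _ _ _ _ _ _ _ Hl0 Jl Jf).
(* Equating coefficients gives a triangular system, solved for Gamma_1, Gamma_2, Gamma_3 in turn. *)
destruct (jet_unique _ _ _ _ _ _ _ _ _ Jlf JL) as [_ [E1 [E2 E3]]].
set (G1 := Gamma 1%nat) in *. set (G2 := Gamma 2%nat) in *. set (G3 := Gamma 3%nat) in *.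
assert (F1 : G1 = (- q1 / 2)%C).
{ transitivity ((2 * G1 * 1) / 2)%C; [field|]. rewrite E1. reflexivity. }
assert (F2 : G2 = (- q2 / 4 + q1 ^ 2 / 2)%C).
{ transitivity ((2 * G1 * q1 + 2 * G2 * 1 ^ 2) / 2 - G1 * q1)%C; [simpl; field|]. rewrite E2, F1. field. }
assert (F3 : G3 = (- q3 / 6 + 3 / 4 * q1 * q2 - 3 / 4 * q1 ^ 3)%C).
{ transitivity ((2 * G1 * (q2 / 2 + q1 ^ 2 / 2) + 2 * (2 * G2) * 1 * q1 + 2 * G3 * 1 ^ 3) / 2
    - G1 * (q2 / 2 + q1 ^ 2 / 2) - 2 * G2 * q1)%C; [simpl; field|].
  rewrite E3, F2, F1. simpl. field. }
rewrite F1, F2, F3. unfold q1, q2, q3. repeat split; simpl; field.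
Qed.

Lemma schwarz_function_diff om : schwarz_function om -> diff_on 1 om.
Proof. intros [H _] z Hz. eexists. apply ex_derive_Cdiff, H. exact Hz. Qed.

Theorem Gamma_bounds (f : C -> C) (Gamma : nat -> C) : S_AP f -> inverse_log_coefficients f Gamma ->
  Cmod (Gamma 1%nat) <= 3 / 4 /\ Cmod (Gamma 2%nat) <= 29 / 32 /\ Cmod (Gamma 3%nat) <= 925 / 576.
Proof.
intros [Hf [Hnz [om [Hom Hq]]]] HG.
assert (Hd := schwarz_function_diff om Hom).
destruct (diff_on_jet om 1 (1 / 2) Hd ltac:(lra)) as [E0 J].
destruct Hom as [Hom [Hom0 Hom1]]. rewrite Hom0 in E0. rewrite E0 in J.
assert (S1 := Schwarz_coef om 1 ltac:(lia) Hd Hom0 (fun z Hz => Rlt_le _ _ (Hom1 z Hz))).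
assert (S2 := Schwarz_coef om 2 ltac:(lia) Hd Hom0 (fun z Hz => Rlt_le _ _ (Hom1 z Hz))).
destruct (Gamma_formulas f om Gamma Hf Hnz (conj Hom (conj Hom0 Hom1)) Hq HG _ _ _ J) as [G1 [G2 G3]].
set (c1 := coef om (1 / 2) 1) in *. set (c2 := coef om (1 / 2) 2) in *. set (c3 := coef om (1 / 2) 3) in *.
rewrite G1, G2, G3. clear G1 G2 G3.
assert (p1 := Cmod_ge_0 c1). assert (p2 := Cmod_ge_0 c2). assert (p3 := Cmod_ge_0 c3).
assert (Q : forall x : R, Cmod x = Rabs x) by exact Cmod_R.
assert (K1 : forall a b : R, 0 < b -> 0 <= a -> Cmod (a / b) = a / b).
{ intros a b Hb Ha. rewrite <- RtoC_div, Cmod_R by lra. apply Rabs_pos_eq. now apply Rdiv_le_0_compat. }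
set (x := Cmod c1) in *. set (y := Cmod c2) in *. set (t := Cmod c3) in *.
repeat split.
- rewrite Cmod_mult, Cmod_opp, K1 by lra. fold x. lra.
(* With y <= 2 (1 - x) it remains that 3/4 (1 - x) <= 29/32 (1 - x) (1 + x). *)
- eapply Rle_trans; [apply Cmod_triangle|].
  rewrite !Cmod_mult, Cmod_opp, !K1, Cmod_pow by lra. fold x y. nra.
- rewrite Cmod_mult, Cmod_opp, K1 by lra.
  apply Rle_trans with (1 / 4 * (t + 67 / 12 * x * y + 925 / 144 * x ^ 3)).
  + apply Rmult_le_compat_l; [lra|].
    eapply Rle_trans; [apply Cmod_triangle|]. apply Rplus_le_compat.
    * eapply Rle_trans; [apply Cmod_triangle|].
      rewrite Cmod_opp, !Cmod_mult, K1 by lra. fold t x y. lra.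
    * rewrite Cmod_mult, Cmod_pow, K1 by lra. fold x. lra.
  (* Both y and t are at most 2 (1 - x). Once 1 - x is cancelled there remains 2 + 67/6 x <= 925/144
     (1 + x + x^2), a quadratic inequality with negative discriminant. *)
  + assert (B : t + 67 / 12 * x * y <= 2 * (1 - x) * (1 + 67 / 12 * x)).
    { assert (x * y <= x * (2 * (1 - x))) by (apply Rmult_le_compat_l; lra). lra. }
    assert (D : 2 * (1 - x) * (1 + 67 / 12 * x) <= 925 / 144 * (1 - x ^ 3)).
    { replace (1 - x ^ 3) with ((1 - x) * (1 + x + x * x)) by ring.
      assert (0 <= 1 - x) by lra.
      replace (2 * (1 - x) * (1 + 67 / 12 * x)) with ((1 - x) * (2 + 67 / 6 * x)) by field.
      replace (925 / 144 * ((1 - x) * (1 + x + x * x))) with ((1 - x) * (925 / 144 * (1 + x + x * x))) by field.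
      apply Rmult_le_compat_l; auto. nra. }
    lra.
Qed.

(** * Positivity of psi, fixed points and primitives *)

(* With [phi = atan (b / a)] the claim is [phi + 2 a b < PI / 2]; the hypothesis gives
   [2 a b <= sin (4 phi)], which is at most 1 for [phi <= PI / 6] and at most [PI - 4 phi] beyond. *)
Lemma lemniscate_positive (a b : R) : 0 < a -> 0 <= b ->
  (a * a + b * b) * (a * a + b * b) < 2 * (a * a - b * b) ->
  0 < a * cos (2 * a * b) - b * sin (2 * a * b).
Proof.
intros Ha Hb H.
set (u := b / a). assert (Hu0 : 0 <= u) by (apply Rdiv_le_0_compat; lra).
assert (Eb : b = a * u) by (unfold u; field; lra).
assert (Hu1 : u < 1).
{ destruct (Rlt_le_dec u 1) as [|K]; auto. exfalso.
  assert (a <= b) by (rewrite Eb; nra). nra. }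
set (phi := atan u).
assert (Hphi0 : 0 <= phi).
{ unfold phi. rewrite <- atan_0. destruct Hu0 as [K|K]; [left; now apply atan_increasing | rewrite K; lra]. }
assert (Hphi1 : phi < PI / 4) by (unfold phi; rewrite <- atan_1; now apply atan_increasing).
assert (HP := PI_RGT_0).
assert (HP3 : 3 < PI) by (assert (Z := PI2_3_2); lra).
assert (Hc : 0 < cos phi) by (apply cos_gt_0; lra).
assert (Hs : sin phi = u * cos phi).
{ assert (T := tan_atan u). fold phi in T. unfold tan in T. rewrite <- T. field. lra. }
assert (Hsc := sin2_cos2 phi). unfold Rsqr in Hsc.
set (c := cos phi) in *.
assert (Hcu : c * c * (1 + u * u) = 1) by (rewrite Hs in Hsc; nra).
set (y := 2 * a * b).
assert (Hy : y <= sin (4 * phi)).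
{ replace (4 * phi) with (2 * (2 * phi)) by ring. rewrite sin_2a, sin_2a, cos_2a. fold c. rewrite Hs.
  unfold y. rewrite Eb. rewrite Eb in H.
  assert (H1 : a * a * ((1 + u * u) * (1 + u * u)) < 2 * (1 - u * u)).
  { apply Rmult_lt_reg_l with (a * a); [nra|]. nra. }
  assert (H2 : a * a <= 2 * (1 - u * u) * (c * c * (c * c))).
  { replace (a * a) with (a * a * ((1 + u * u) * (1 + u * u)) * (c * c * (c * c))).
    - apply Rmult_le_compat_r; [nra|]. lra.
    - transitivity (a * a * (c * c * (1 + u * u)) * (c * c * (1 + u * u))); [ring|]. rewrite Hcu. ring. }
  replace (2 * (2 * (u * c) * c) * (c * c - u * c * (u * c))) with (2 * u * (2 * (1 - u * u) * (c * c * (c * c)))) by ring.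
  replace (2 * a * (a * u)) with (2 * u * (a * a)) by ring.
  apply Rmult_le_compat_l; lra. }
assert (Hy0 : 0 <= y) by (unfold y; apply Rmult_le_pos; lra).
(* For phi <= PI / 6 use y <= 1 < PI / 3. Otherwise y <= sin (PI - 4 phi) < PI - 4 phi, so phi + y <
   PI - 3 phi < PI / 2. *)
assert (Hsum : phi + y < PI / 2).
{ destruct (Rle_lt_dec phi (PI / 6)) as [K|K].
  - assert (Z := SIN_bound (4 * phi)). lra.
  - assert (E : sin (4 * phi) = sin (PI - 4 * phi)) by (rewrite sin_PI_x; reflexivity).
    assert (Z := sin_lt_x (PI - 4 * phi) ltac:(lra)). lra. }
(* cos (phi + y) is cos phi / a times the quantity in question. *)
assert (Hpos : 0 < cos (phi + y)) by (apply cos_gt_0; lra).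
rewrite cos_plus, Hs in Hpos. fold c in Hpos.
rewrite Eb at 1. apply Rmult_lt_reg_r with c; auto. nra.
Qed.

(** Put sqrt(1 + z) = a + i b. Then |z| < 1 is the lemniscate condition, y = Im z = 2 a b, and Re
    psi = exp(Re z) (a cos y - b sin y). Negative b is reduced to positive b by conjugation. *)
Lemma psi_AP_Re_pos z : Cmod z < 1 -> 0 < Re (psi_AP z).
Proof.
intros Hz. assert (Hp := Re_Csqrt_gt_0 _ (Re_one_plus z Hz)).
assert (Hsq := Csqrt_sqr (1 + z)). unfold psi_AP. rewrite re_mult.
destruct (Csqrt (1 + z)) as [a b]. destruct z as [x y]. cbn [Re Im fst snd] in *.
unfold Cmult, Cplus, RtoC in Hsq. simpl in Hsq. injection Hsq as E1 E2.
assert (Z := Cmod2_alt (x, y)). cbn [Re Im fst snd] in Z. assert (Zp := Cmod_ge_0 (x, y)).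
set (m := Cmod (x, y)) in *.
assert (Hxy : x * x + y * y < 1) by nra.
assert (Ex : x = a * a - b * b - 1) by lra. assert (Ey : y = 2 * a * b) by lra.
assert (Hl : (a * a + b * b) * (a * a + b * b) < 2 * (a * a - b * b)).
{ rewrite Ex, Ey in Hxy. nra. }
unfold Cexp. cbn [Re Im fst snd].
assert (Q : 0 < a * cos y - b * sin y).
{ destruct (Rle_dec 0 b) as [Hb|Hb].
  - rewrite Ey. now apply lemniscate_positive.
  - assert (K := lemniscate_positive a (- b) Hp ltac:(lra)).
    replace (2 * a * - b) with (- y) in K by (rewrite Ey; ring). rewrite cos_neg, sin_neg in K.
    assert (K' : 0 < a * cos y - - b * - sin y) by (apply K; nra). lra. }
assert (Ep := exp_pos x). nra.
Qed.

(** A crude bound: exp 1 <= 3 and |sqrt(1 + z)| <= 2. Its square 36 sets the step length of the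
    contraction in [extremal_F_surj]. *)
Lemma psi_AP_bound z : Cmod z < 1 -> Cmod (psi_AP z) <= 6.
Proof.
intros Hz. unfold psi_AP. rewrite Cmod_mult, Cmod_Cexp.
assert (H1 : exp (Re z) <= 3).
{ assert (K := re_le_Cmod z). apply Rabs_le_between in K.
  apply Rle_trans with (exp 1); [left; apply exp_increasing; lra | apply exp_le_3]. }
assert (H2 : Cmod (Csqrt (1 + z)) <= 2).
{ assert (E : Cmod (Csqrt (1 + z)) * Cmod (Csqrt (1 + z)) = Cmod (1 + z)) by (now rewrite <- Cmod_mult, Csqrt_sqr).
  assert (T := Cmod_triangle 1 z). rewrite Cmod_1 in T. assert (P := Cmod_ge_0 (Csqrt (1 + z))). nra. }
assert (P := exp_pos (Re z)). assert (P' := Cmod_ge_0 (Csqrt (1 + z))). nra.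
Qed.

Lemma psi_AP_Harnack z r : Cmod z <= r -> r < 1 -> (1 - r) / (1 + r) <= Re (psi_AP z).
Proof.
intros Hz Hr. assert (Hz0 := Cmod_ge_0 z).
assert (H := Harnack psi_AP z). rewrite psi_AP_0, re_RtoC, Rmult_1_r in H.
assert (K : 1 - Cmod z <= (1 + Cmod z) * Re (psi_AP z)).
{ apply H; [|intros x Hx; left; now apply psi_AP_Re_pos | lra].
  intros x Hx. eexists. now apply psi_AP_diff. }
assert (P := psi_AP_Re_pos z ltac:(lra)).
apply Rmult_le_reg_r with (1 + r); [lra|]. unfold Rdiv. rewrite Rmult_assoc, Rinv_l by lra. nra.
Qed.

(** * The contraction principle *)

Lemma Ccomplete (u : nat -> C) :
  (forall eps, 0 < eps -> exists N, forall n m, (N <= n)%nat -> (N <= m)%nat -> Cmod (u n - u m) < eps) ->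
  exists l, forall eps, 0 < eps -> exists N, forall n, (N <= n)%nat -> Cmod (u n - l) < eps.
Proof.
intros H.
destruct (Rcomplete.R_complete (fun n => Re (u n))) as [x Hx].
{ intros eps He. destruct (H eps He) as [N HN]. exists N. intros n m Hn Hm.
  eapply Rle_lt_trans; [|apply (HN n m); lia]. unfold Rdist.
  replace (Re (u n) - Re (u m)) with (Re (u n - u m)) by (unfold Cminus; rewrite re_plus, re_opp; ring).
  apply re_le_Cmod. }
destruct (Rcomplete.R_complete (fun n => Im (u n))) as [y Hy].
{ intros eps He. destruct (H eps He) as [N HN]. exists N. intros n m Hn Hm.
  eapply Rle_lt_trans; [|apply (HN n m); lia]. unfold Rdist.
  replace (Im (u n) - Im (u m)) with (Im (u n - u m)) by (unfold Cminus; rewrite im_plus, im_opp; ring).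
  apply im_le_Cmod. }
exists (x, y). intros eps He.
destruct (Hx (eps / 2) ltac:(lra)) as [N HN]. destruct (Hy (eps / 2) ltac:(lra)) as [M HM].
exists (N + M)%nat. intros n Hn. eapply Rle_lt_trans; [apply Cmod_le_parts|].
unfold Cminus. rewrite re_plus, re_opp, im_plus, im_opp. simpl Re. simpl Im.
specialize (HN n ltac:(lia)). specialize (HM n ltac:(lia)). unfold Rdist, Rminus in HN, HM. simpl in *. lra.
Qed.

Lemma contraction_fixpoint (T : C -> C) (P : C -> Prop) (k : R) (z0 : C) : 0 <= k < 1 -> P z0 ->
  (forall z, P z -> P (T z)) ->
  (forall z, (forall eps, 0 < eps -> exists x, P x /\ Cmod (x - z) < eps) -> P z) ->
  (forall x y, P x -> P y -> Cmod (T x - T y) <= k * Cmod (x - y)) ->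
  exists z, P z /\ T z = z.
Proof.
intros Hk H0 HT Hcl HL.
pose (u := fun n => Nat.iter n T z0).
assert (Pu : forall n, P (u n)) by (induction n; simpl; auto).
set (D := Cmod (T z0 - z0)). assert (HD : 0 <= D) by apply Cmod_ge_0.
assert (step : forall n, Cmod (u (S n) - u n) <= k ^ n * D).
{ induction n as [|n IH]; [simpl; unfold D; lra|].
  eapply Rle_trans; [apply (HL (u (S n)) (u n)); auto|]. simpl pow. rewrite Rmult_assoc.
  apply Rmult_le_compat_l; lra. }
assert (Hkn : forall n, 0 <= k ^ n) by (intros n; apply pow_le; lra).
assert (far : forall n m, Cmod (u (n + m)%nat - u n) * (1 - k) <= (k ^ n - k ^ (n + m)) * D).
{ intros n m. induction m as [|m IH].
  - rewrite Nat.add_0_r. replace (u n - u n)%C with (RtoC 0) by ring. rewrite Cmod_0. lra.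
  - rewrite Nat.add_succ_r. specialize (step (n + m)%nat).
    assert (E := Cmod_triangle (u (S (n + m)) - u (n + m)%nat) (u (n + m)%nat - u n)).
    replace (u (S (n + m)) - u (n + m)%nat + (u (n + m)%nat - u n))%C with (u (S (n + m)) - u n)%C in E by ring.
    simpl pow. nra. }
assert (cauchy : forall n m, Cmod (u (n + m)%nat - u n) <= k ^ n * (D / (1 - k))).
{ intros n m. apply Rmult_le_reg_r with (1 - k); [lra|]. eapply Rle_trans; [apply far|].
  replace (k ^ n * (D / (1 - k)) * (1 - k)) with (k ^ n * D) by (field; lra).
  apply Rmult_le_compat_r; auto. assert (Z := Hkn (n + m)%nat). lra. }
set (Q := D / (1 - k)) in *. assert (HQ : 0 <= Q) by (apply Rdiv_le_0_compat; lra).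
destruct (Ccomplete u) as [l Hl].
{ intros eps He.
  destruct (pow_lt_1_zero k) with (y := eps / (2 * (Q + 1))) as [N HN].
  { rewrite Rabs_pos_eq; lra. } { apply Rdiv_lt_0_compat; lra. }
  specialize (HN N (le_n N)). rewrite Rabs_pos_eq in HN by auto.
  assert (B : forall n, (N <= n)%nat -> Cmod (u n - u N) < eps / 2).
  { intros n Hn. replace n with (N + (n - N))%nat by lia. eapply Rle_lt_trans; [apply cauchy|].
    apply Rle_lt_trans with (k ^ N * (Q + 1)); [apply Rmult_le_compat_l; auto; lra|].
    replace (eps / 2) with (eps / (2 * (Q + 1)) * (Q + 1)) by (field; lra).
    apply Rmult_lt_compat_r; lra. }
  exists N. intros n m Hn Hm. replace (u n - u m)%C with ((u n - u N) + - (u m - u N))%C by ring.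
  eapply Rle_lt_trans; [apply Cmod_triangle|]. rewrite Cmod_opp.
  assert (b1 := B n Hn). assert (b2 := B m Hm). lra. }
assert (Pl : P l).
{ apply Hcl. intros eps He. destruct (Hl eps He) as [N HN]. exists (u N). split; auto. }
exists l. split; auto. apply Ceq_minus, Cmod_eq_0, Rle_antisym; [|apply Cmod_ge_0].
apply le_epsilon. intros eps He. rewrite Rplus_0_l.
destruct (Hl (eps / 2) ltac:(lra)) as [N HN].
replace (T l - l)%C with (- (T (u N) - T l) + (u (S N) - l))%C by (simpl; ring).
eapply Rle_trans; [apply Cmod_triangle|]. rewrite Cmod_opp.
assert (b1 := HL (u N) l (Pu N) Pl). assert (b2 := HN N ltac:(lia)). assert (b3 := HN (S N) ltac:(lia)).
assert (Z := Cmod_ge_0 (u N - l)). nra.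
Qed.

(** * Oriented rectangles and primitives *)

Lemma cint_ccont_oriented f a b :
  (forall t, Rmin a b <= t <= Rmax a b -> ccont f t) -> cint f a b.
Proof. intros H. apply (ex_RInt_continuous (V := C_R_CompleteNormedModule)). exact H. Qed.

Lemma CInt_swap f a b : cint f a b -> CInt f b a = (- CInt f a b)%C.
Proof. intros H. symmetry. apply (opp_RInt_swap (V := C_R_CompleteNormedModule) f a b H). Qed.

Lemma cint_swap f a b : cint f a b -> cint f b a.
Proof. apply ex_RInt_swap. Qed.

Lemma CInt_bound_oriented f a b M :
  (forall t, Rmin a b <= t <= Rmax a b -> ccont f t) ->
  (forall t, Rmin a b <= t <= Rmax a b -> Cmod (f t) <= M) ->
  Cmod (CInt f a b) <= Rabs (b - a) * M.
Proof.
intros Hc HM. assert (I := cint_ccont_oriented f a b Hc).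
destruct (Rle_dec a b) as [H|H].
- rewrite Rmin_left, Rmax_right in HM by lra. rewrite Rabs_pos_eq by lra. now apply CInt_bound.
- rewrite Rmin_right, Rmax_left in HM by lra. rewrite Rabs_left by lra.
  apply cint_swap in I. rewrite CInt_swap, Cmod_opp by auto.
  eapply Rle_trans; [apply (CInt_bound f b a M); auto; lra|]. right; ring.
Qed.

Lemma Goursat_oriented f a b c d s0 :
  (forall x y, Rmin a b <= x <= Rmax a b -> Rmin c d <= y <= Rmax c d -> ccont (U := C_UniformSpace) f (x, y)) ->
  (forall x y, Rmin a b <= x <= Rmax a b -> Rmin c d <= y <= Rmax c d -> x <> s0 -> exists l, Cdiff f (x, y) l) ->
  rectI f a b c d = 0.
Proof.
intros Hc Hd.
assert (Hh : forall y, Rmin c d <= y <= Rmax c d -> cint (fun t => f (t, y)) a b).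
{ intros y Hy. apply cint_ccont_oriented. intros t Ht. apply ccont_hline. auto. }
assert (Hv : forall x, Rmin a b <= x <= Rmax a b -> cint (fun s => f (x, s)) c d).
{ intros x Hx. apply cint_ccont_oriented. intros t Ht. apply ccont_vline. auto. }
assert (Z1 := Rmin_l a b). assert (Z2 := Rmin_r a b). assert (Z3 := Rmax_l a b). assert (Z4 := Rmax_r a b).
assert (Z5 := Rmin_l c d). assert (Z6 := Rmin_r c d). assert (Z7 := Rmax_l c d). assert (Z8 := Rmax_r c d).
assert (Sab : rectI f b a c d = (- rectI f a b c d)%C).
{ unfold rectI. rewrite (CInt_swap (fun t => f (t, c)) a b), (CInt_swap (fun t => f (t, d)) a b) by (apply Hh; lra). ring. }
assert (Scd : rectI f a b d c = (- rectI f a b c d)%C).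
{ unfold rectI. rewrite (CInt_swap (fun s => f (b, s)) c d), (CInt_swap (fun s => f (a, s)) c d) by (apply Hv; lra). ring. }
assert (Sabcd : rectI f b a d c = (rectI f a b c d)%C).
{ unfold rectI. rewrite (CInt_swap (fun t => f (t, c)) a b), (CInt_swap (fun t => f (t, d)) a b) by (apply Hh; lra).
  rewrite (CInt_swap (fun s => f (b, s)) c d), (CInt_swap (fun s => f (a, s)) c d) by (apply Hv; lra). ring. }
assert (point : forall g (t : R), CInt g t t = 0) by (intros g t; apply (RInt_point (V := C_R_CompleteNormedModule))).
assert (opp0 : forall z : C, (- z)%C = 0 -> z = 0).
{ intros z E. replace z with (- - z)%C by ring. rewrite E. ring. }
destruct (Rtotal_order a b) as [Hab|[Hab|Hab]]; destruct (Rtotal_order c d) as [Hcd|[Hcd|Hcd]];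
  try (subst; unfold rectI; rewrite ?point; ring).
- rewrite Rmin_left, Rmax_right in Hc, Hd by lra. rewrite Rmin_left, Rmax_right in Hc, Hd by lra.
  now apply (Goursat f a b c d s0).
- rewrite Rmin_left, Rmax_right in Hc, Hd by lra. rewrite Rmin_right, Rmax_left in Hc, Hd by lra.
  apply opp0. rewrite <- Scd. now apply (Goursat f a b d c s0).
- rewrite Rmin_right, Rmax_left in Hc, Hd by lra. rewrite Rmin_left, Rmax_right in Hc, Hd by lra.
  apply opp0. rewrite <- Sab. now apply (Goursat f b a c d s0).
- rewrite Rmin_right, Rmax_left in Hc, Hd by lra. rewrite Rmin_right, Rmax_left in Hc, Hd by lra.
  rewrite <- Sabcd. now apply (Goursat f b a d c s0).
Qed.

Lemma Cmod_rect_corner x y u v : Rmin 0 u <= x <= Rmax 0 u -> Rmin 0 v <= y <= Rmax 0 v ->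
  Cmod (x, y) <= Cmod (u, v).
Proof.
intros Hx Hy. unfold Cmod. simpl. apply sqrt_le_1_alt.
assert (forall p q, Rmin 0 q <= p <= Rmax 0 q -> p * (p * 1) <= q * (q * 1)).
{ intros p q. unfold Rmin, Rmax. destruct (Rle_dec 0 q); intros; nra. }
apply Rplus_le_compat; auto.
Qed.

(** H integrates from 0 first horizontally, then vertically; Goursat's theorem makes the other order
    of the sides equal. The point 0, where q may fail to be differentiable, lies on the exceptional
    line Re z = 0. *)
Theorem primitive_on_disc (q : C -> C) (r : R) : 0 < r ->
  (forall z, Cmod z < r -> ccont (U := C_UniformSpace) q z) ->
  (forall z, Cmod z < r -> z <> 0 -> exists l, Cdiff q z l) ->
  exists H : C -> C, H 0 = 0 /\ forall z, Cmod z < r -> Cdiff H z (q z).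
Proof.
intros Hr Hc Hd.
pose (A := fun x y => CInt (fun t => q (t, y)) 0 x).
pose (B := fun x y => CInt (fun s => q (x, s)) 0 y).
pose (H := fun z : C => (A (fst z) 0 + Ci * B (fst z) (snd z))%C).
assert (alt : forall x y, Cmod (x, y) < r -> H (x, y) = (A x y + Ci * B 0 y)%C).
{ intros x y Hxy. unfold H; simpl. apply Ceq_minus.
  transitivity (rectI q 0 x 0 y); [unfold rectI, A, B; ring|].
  apply (Goursat_oriented q 0 x 0 y 0).
  - intros u v Hu Hv. apply Hc. eapply Rle_lt_trans; [apply Cmod_rect_corner|]; eassumption.
  - intros u v Hu Hv Hn. apply Hd.
    + eapply Rle_lt_trans; [apply Cmod_rect_corner|]; eassumption.
    + intros E. apply Hn. now injection E. }
exists H. split.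
{ unfold H, A, B, CInt; simpl. rewrite !(RInt_point (V := C_R_CompleteNormedModule)).
  change (zero (G := C_R_CompleteNormedModule)) with (RtoC 0). ring. }
intros z Hz. apply Cdiff_eps. intros eps He.
destruct (proj1 (ccont_C_eps q z) (Hc z Hz) (eps / 2) ltac:(lra)) as [d0 [Hd0 K]].
exists (Rmin (d0 / 2) ((r - Cmod z) / 2)). split; [apply Rmin_pos; lra|].
intros w Hw. assert (L1 := Rmin_l (d0 / 2) ((r - Cmod z) / 2)). assert (L2 := Rmin_r (d0 / 2) ((r - Cmod z) / 2)).
destruct z as [x y]. destruct w as [u v]. set (z := (x, y)) in *. set (w := (u, v)) in *.
set (m := Cmod (w - z)) in *.
assert (hu : Rabs (u - x) <= m) by exact (re_le_Cmod (w - z)).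
assert (hv : Rabs (v - y) <= m) by exact (im_le_Cmod (w - z)).
assert (near : forall p, Cmod (p - z) <= 2 * m -> Cmod p < r /\ Cmod (q p - q z) <= eps / 2).
{ intros p Hp. split.
  - assert (T := Cmod_triangle (p - z) z). replace (p - z + z)%C with p in T by ring. lra.
  - left. apply K. lra. }
assert (onh : forall t, Rmin x u <= t <= Rmax x u -> Cmod ((t, y) - z) <= 2 * m).
{ intros t Ht. eapply Rle_trans; [apply Cmod_le_parts|]. simpl.
  replace (y + - y) with 0 by ring. rewrite Rabs_R0.
  assert (Rabs (t + - x) <= Rabs (u - x)).
  { revert Ht. unfold Rmin, Rmax. destruct (Rle_dec x u); intros Ht.
    - rewrite !Rabs_pos_eq by lra. lra.
    - rewrite !Rabs_left1 by lra. lra. }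
  assert (0 <= m) by apply Cmod_ge_0. lra. }
assert (onv : forall s, Rmin y v <= s <= Rmax y v -> Cmod ((u, s) - z) <= 2 * m).
{ intros s Hs. eapply Rle_trans; [apply Cmod_le_parts|]. simpl.
  assert (Rabs (s + - y) <= Rabs (v - y)).
  { revert Hs. unfold Rmin, Rmax. destruct (Rle_dec y v); intros Hs.
    - rewrite !Rabs_pos_eq by lra. lra.
    - rewrite !Rabs_left1 by lra. lra. }
  unfold Rminus in *. lra. }
assert (Huy : Cmod (u, y) < r).
{ apply near, onh. split; [apply Rmin_r | apply Rmax_r]. }
assert (Huv : Cmod (u, v) < r).
{ apply near, onv. split; [apply Rmin_r | apply Rmax_r]. }
assert (ch : forall t, Rmin x u <= t <= Rmax x u -> ccont (fun t => q (t, y)) t).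
{ intros t Ht. apply ccont_hline, Hc, near, onh, Ht. }
assert (cv : forall s, Rmin y v <= s <= Rmax y v -> ccont (fun s => q (u, s)) s).
{ intros s Hs. apply ccont_vline, Hc, near, onv, Hs. }
assert (ih : forall p, Cmod (p, y) < r -> cint (fun t => q (t, y)) 0 p).
{ intros p Hp. apply cint_ccont_oriented. intros t Ht. apply ccont_hline, Hc.
  eapply Rle_lt_trans; [apply (Cmod_rect_corner t y p y Ht)|exact Hp].
  unfold Rmin, Rmax. destruct (Rle_dec 0 y); lra. }
assert (iv : forall p, Cmod (u, p) < r -> cint (fun s => q (u, s)) 0 p).
{ intros p Hp. apply cint_ccont_oriented. intros t Ht. apply ccont_vline, Hc.
  eapply Rle_lt_trans; [apply (Cmod_rect_corner u t u p)|exact Hp]; [|exact Ht].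
  unfold Rmin, Rmax. destruct (Rle_dec 0 u); lra. }
(* The horizontal increment is read off from [alt], where the horizontal side comes last, and the
   vertical one from the definition of H. *)
assert (E : (H w - H z)%C = (CInt (fun t => q (t, y)) x u + Ci * CInt (fun s => q (u, s)) y v)%C).
{ assert (E1 : (H (u, y) - H z)%C = CInt (fun t => q (t, y)) x u).
  { unfold z. rewrite !alt by (assumption || exact Hz). unfold A.
    rewrite <- (CInt_Chasles (fun t => q (t, y)) 0 x u); [ring | now apply ih | now apply cint_ccont_oriented]. }
  assert (E2 : (H w - H (u, y))%C = (Ci * CInt (fun s => q (u, s)) y v)%C).
  { unfold w, H, B. simpl.
    rewrite <- (CInt_Chasles (fun s => q (u, s)) 0 y v); [ring | now apply iv | now apply cint_ccont_oriented]. }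
  rewrite <- E1, <- E2. ring. }
assert (F : (H w - H z - q z * (w - z))%C =
   (CInt (fun t => q (t, y) - q z) x u + Ci * CInt (fun s => q (u, s) - q z) y v)%C).
{ rewrite E. rewrite (CInt_minus (fun t => q (t, y)) (fun _ => q z)), (CInt_minus (fun s => q (u, s)) (fun _ => q z)), !CInt_const;
    try (apply cint_ccont_oriented; auto; intros; apply ccont_const).
  unfold w, z. set (k := q (x, y)). clearbody k.
  replace ((u, v) - (x, y))%C with (RtoC (u - x) + Ci * RtoC (v - y))%C.
  - ring.
  - unfold Cplus, Cminus, Cmult, Copp, Ci, RtoC, Cplus; simpl. f_equal; ring. }
rewrite F. eapply Rle_trans; [apply Cmod_triangle|]. rewrite Cmod_mult, Cmod_Ci, Rmult_1_l.
assert (B1 : Cmod (CInt (fun t => q (t, y) - q z)%C x u) <= Rabs (u - x) * (eps / 2)).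
{ apply CInt_bound_oriented.
  - intros t Ht. apply ccont_minus; [now apply ch | apply ccont_const].
  - intros t Ht. apply near, onh, Ht. }
assert (B2 : Cmod (CInt (fun s => q (u, s) - q z)%C y v) <= Rabs (v - y) * (eps / 2)).
{ apply CInt_bound_oriented.
  - intros t Ht. apply ccont_minus; [now apply cv | apply ccont_const].
  - intros t Ht. apply near, onv, Ht. }
nra.
Qed.

(** * The extremal function *)

Lemma Cmod_sqr (z : C) : Cmod z * Cmod z = Re z * Re z + Im z * Im z.
Proof. assert (E := Cmod2_alt z). simpl in E. lra. Qed.

Lemma Cexp_surj (w : C) : w <> 0 -> exists W, Cexp W = w.
Proof.
intros Hw. destruct (polar_form w) as [t [_ Ht]]. exists (ln (Cmod w), t).
rewrite Ht at 2. unfold Cexp, cpt; simpl. rewrite exp_ln; [reflexivity | now apply Cmod_gt_0].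
Qed.

(* The extremal function is [z exp (H z)], and [q = H'] extends [(psi z - 1) / z] to the origin. *)
Lemma log_quotient_exists : exists q H : C -> C, H 0 = 0 /\
  (forall z, (z * q z)%C = (psi_AP z - 1)%C) /\
  (forall z, Cmod z < 1 -> Cdiff H z (q z)).
Proof.
assert (Z0 : Cmod 0 < 1) by (rewrite Cmod_0; lra).
(* Caratheodory's slope of psi at 0 is already the continuous extension of (psi(z) - 1) / z. *)
destruct (psi_AP_diff 0 Z0) as [q [_ [Cq Eq]]].
assert (Eq' : forall z, (z * q z)%C = (psi_AP z - 1)%C).
{ intros z. rewrite (Eq z), psi_AP_0. ring. }
assert (Dq : forall z, Cmod z < 1 -> z <> 0 -> exists l, Cdiff q z l).
{ intros z Hz Hz0. eexists.
  apply (Cdiff_ext_loc (fun x => (psi_AP x - 1) * / x)%C q z _ (Cmod z)); [now apply Cmod_gt_0| |].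
  - intros x Hx. rewrite <- Eq'. field. intros ->. replace (0 - z)%C with (- z)%C in Hx by ring.
    rewrite Cmod_opp in Hx. lra.
  - apply (Cdiff_mult (fun x => psi_AP x - 1)%C (fun x => / x)%C).
    + apply Cdiff_minus; [now apply psi_AP_diff | apply Cdiff_const].
    + apply (Cdiff_inv (fun x => x)); [apply Cdiff_id | exact Hz0]. }
destruct (primitive_on_disc q 1 Rlt_0_1) as [H [H0 HD]]; [|exact Dq|].
- intros z Hz. destruct (Ceq_dec z 0) as [->|Hz0]; [exact Cq|].
  destruct (Dq z Hz Hz0) as [l Hl]. now apply Cdiff_cont in Hl.
- exists q, H. auto.
Qed.

Section Extremal.
Variables q H : C -> C.
Hypothesis H0 : H 0 = 0.
Hypothesis Hq : forall z, (z * q z)%C = (psi_AP z - 1)%C.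
Hypothesis HD : forall z, Cmod z < 1 -> Cdiff H z (q z).

Let f (z : C) : C := (z * Cexp (H z))%C.
(** log f in the coordinate s = log z. It is single-valued on the half-plane Re s < 0, where F'(s) =
    psi(exp s). *)
Let F (s : C) : C := (s + H (Cexp s))%C.

Lemma extremal_f0 : f 0 = 0.
Proof. unfold f. ring. Qed.

Lemma extremal_df z : Cmod z < 1 -> Cdiff f z (Cexp (H z) * psi_AP z).
Proof.
intros Hz. eapply Cdiff_eq.
- apply (Cdiff_mult (fun z => z) (fun z => Cexp (H z))); [apply Cdiff_id|].
  apply (Cdiff_comp Cexp H); [now apply HD | apply Cdiff_Cexp].
- cbv beta. transitivity (Cexp (H z) * (1 + z * q z))%C; [ring|]. rewrite Hq. ring.
Qed.

Lemma extremal_nz (z : C) : z <> 0 -> f z <> 0.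
Proof. intros Hz. apply Cmult_neq_0; [exact Hz | apply Cexp_neq_0]. Qed.

Lemma extremal_quotient z : Cmod z < 1 -> starlike_quotient f z = psi_AP z.
Proof.
intros Hz. unfold starlike_quotient. destruct (Ceq_dec z 0) as [->|Hn].
- symmetry. apply psi_AP_0.
- rewrite (Cdiff_C_derive _ _ _ (extremal_df z Hz)). unfold f. field. split; [apply Cexp_neq_0 | exact Hn].
Qed.

Lemma extremal_normalized : normalized_analytic f.
Proof.
split; [|split].
- intros z Hz. eapply Cdiff_ex_derive, extremal_df. exact Hz.
- apply extremal_f0.
- rewrite (Cdiff_C_derive _ _ _ (extremal_df 0 ltac:(rewrite Cmod_0; lra))), H0, Cexp_0, psi_AP_0. ring.
Qed.

Lemma id_schwarz : schwarz_function (fun z => z).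
Proof.
split; [|split; auto]. intros z _. eapply Cdiff_ex_derive, Cdiff_id.
Qed.

Lemma extremal_S_AP : S_AP f.
Proof.
split; [apply extremal_normalized|]. split; [intros z _; apply extremal_nz|].
exists (fun z => z). split; [apply id_schwarz|]. intros z Hz. now apply extremal_quotient.
Qed.

(* Integrate the Harnack bound [Re psi (z) - 1 >= -2 |z| / (1 + |z|)] along the radius. *)
Lemma extremal_growth z : Cmod z < 1 -> - 2 * ln (1 + Cmod z) <= Re (H z).
Proof.
intros Hz. set (m := Cmod z) in *. assert (Hm : 0 <= m) by apply Cmod_ge_0.
assert (Hin : forall t, 0 <= t <= 1 -> Cmod (0 + RtoC t * z) = t * m).
{ intros t Ht. rewrite Cplus_0_l, Cmod_mult, Cmod_R, Rabs_pos_eq by lra. reflexivity. }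
assert (Hlt : forall t, 0 <= t <= 1 -> Cmod (0 + RtoC t * z) < 1).
{ intros t Ht. rewrite Hin by auto. nra. }
assert (Hd : forall t, 0 <= t <= 1 -> is_derive (fun t : R => Re (1 * H (0 + RtoC t * z)%C) + 2 * ln (1 + t * m)) t
   (Re (1 * q (0 + RtoC t * z)%C * z) + 2 * (m / (1 + t * m)))).
{ intros t Ht. assert (0 <= t * m) by (apply Rmult_le_pos; lra).
  apply (is_derive_plus (V := R_NormedModule) (fun t : R => Re (1 * H (0 + RtoC t * z)%C)) (fun t => 2 * ln (1 + t * m))).
  - apply seg_derive, HD. auto.
  - auto_derive; [lra|]. field. lra. }
(* The intermediate point may be the endpoint 0, where the Harnack bound cannot be divided by t; the
   value 0 assigned there is nonnegative as well. *)
destruct (MVT_gen (fun t : R => Re (1 * H (0 + RtoC t * z)%C) + 2 * ln (1 + t * m)) 0 1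
   (fun t => if Rlt_dec 0 t then Re (1 * q (0 + RtoC t * z)%C * z) + 2 * (m / (1 + t * m)) else 0)) as [t [Ht E]].
- rewrite Rmin_left, Rmax_right by lra. intros t Ht. destruct (Rlt_dec 0 t); [apply Hd|]; lra.
- rewrite Rmin_left, Rmax_right by lra. intros t Ht. apply continuity_pt_filterlim.
  exact (ex_derive_continuous (V := R_NormedModule) _ t (ex_intro _ _ (Hd t Ht))).
- rewrite Rmin_left, Rmax_right in Ht by lra.
  assert (P : 0 <= if Rlt_dec 0 t then Re (1 * q (0 + RtoC t * z)%C * z) + 2 * (m / (1 + t * m)) else 0).
  { destruct (Rlt_dec 0 t) as [Ht0|_]; [|lra]. set (x := (0 + RtoC t * z)%C) in *.
    assert (Hx : Cmod x = t * m) by now apply Hin.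
    assert (K := psi_AP_Harnack x (t * m) ltac:(lra) ltac:(nra)).
    assert (Ex : (RtoC t * (1 * q x * z))%C = (psi_AP x - 1)%C).
    { rewrite <- Hq. unfold x at 2. ring. }
    assert (Er : t * Re (1 * q x * z) = Re (psi_AP x) - 1).
    { rewrite <- re_scal_l, Ex. unfold Cminus. rewrite re_plus, re_opp, re_RtoC. ring. }
    assert (Htm : 0 <= t * m) by (apply Rmult_le_pos; lra).
    assert (K2 : (1 - t * m) / (1 + t * m) - 1 = - (t * (2 * (m / (1 + t * m))))) by (field; lra).
    apply Rmult_le_reg_l with t; [exact Ht0|]. rewrite Rmult_plus_distr_l, Er. lra. }
  match type of P with 0 <= ?u => set (X := u) in * end. clearbody X.
  replace (0 + RtoC 1 * z)%C with z in E by ring. replace (0 + RtoC 0 * z)%C with (RtoC 0) in E by ring.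
  rewrite H0, Rmult_0_l, Rplus_0_r, ln_1, Rmult_1_l, !Cmult_1_l, re_RtoC in E. lra.
Qed.

Lemma extremal_dF s : Re s < 0 -> Cdiff F s (psi_AP (Cexp s)).
Proof.
intros Hs.
assert (Hm : Cmod (Cexp s) < 1).
{ rewrite Cmod_Cexp, <- exp_0. now apply exp_increasing. }
eapply Cdiff_eq.
- apply Cdiff_plus; [apply Cdiff_id|]. apply (Cdiff_comp H Cexp); [apply Cdiff_Cexp | now apply HD].
- transitivity (1 + Cexp s * q (Cexp s))%C; [ring|]. rewrite Hq. ring.
Qed.

Lemma extremal_f_exp s : f (Cexp s) = Cexp (F s).
Proof. unfold f, F. now rewrite Cexp_plus. Qed.

(* Noshiro-Warschawski: [Re F' > 0] on a convex domain. *)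
Lemma extremal_F_inj s1 s2 : Re s1 < 0 -> Re s2 < 0 -> F s1 = F s2 -> s1 = s2.
Proof.
intros h1 h2 E. set (b := (s2 - s1)%C).
assert (Hre : forall t, 0 <= t <= 1 -> Re (s1 + RtoC t * b) < 0).
{ intros t Ht. rewrite re_plus, re_scal_l. unfold b, Cminus. rewrite re_plus, re_opp. nra. }
(* With the conjugate of b as test factor the derivative contributes |b|^2 Re psi, which must be
   0. *)
destruct (seg_MVT F (fun t => psi_AP (Cexp (s1 + RtoC t * b))) s1 b (Cconj b)) as [t [Ht K]].
- intros t Ht. apply extremal_dF, Hre. lra.
- intros t Ht. eapply Cdiff_cont, extremal_dF, Hre, Ht.
- replace (s1 + b)%C with s2 in K by (unfold b; ring). rewrite E in K.
  replace (Cconj b * (F s2 - F s2))%C with (RtoC 0) in K by ring. rewrite re_RtoC in K.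
  set (p := psi_AP (Cexp (s1 + RtoC t * b))) in *.
  assert (Pp : 0 < Re p).
  { apply psi_AP_Re_pos. rewrite Cmod_Cexp, <- exp_0. apply exp_increasing, Hre. lra. }
  replace (Cconj b * p * b)%C with (b * Cconj b * p)%C in K by ring.
  rewrite <- Cmod2_conj, re_scal_l in K.
  assert (Hb : Cmod b = 0).
  { assert (Z := Cmod_ge_0 b). destruct Z as [Z|Z]; [|now symmetry].
    exfalso. assert (0 < Cmod b ^ 2) by (apply pow_lt; lra). nra. }
  apply Cmod_eq_0, Ceq_minus in Hb. now symmetry.
Qed.

(** Equal values of f give F(s1) = F(s2) + a with exp(a) = 1. Adding such a period to s2 adds it to
    F(s2) too, so s1 = s2 + a by injectivity of F, and both have the same exponential. *)
Lemma extremal_inj z1 z2 : Cmod z1 < 1 -> Cmod z2 < 1 -> f z1 = f z2 -> z1 = z2.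
Proof.
intros h1 h2 E.
destruct (Ceq_dec z1 0) as [->|n1].
{ destruct (Ceq_dec z2 0) as [->|n2]; auto. exfalso. apply (extremal_nz z2 n2). rewrite <- E. apply extremal_f0. }
destruct (Ceq_dec z2 0) as [->|n2].
{ exfalso. apply (extremal_nz z1 n1). rewrite E. apply extremal_f0. }
destruct (Cexp_surj z1 n1) as [s1 <-]. destruct (Cexp_surj z2 n2) as [s2 <-].
rewrite !extremal_f_exp in E. rewrite Cmod_Cexp, <- exp_0 in h1, h2. apply exp_lt_inv in h1, h2.
set (a := (F s1 - F s2)%C).
assert (Ea : Cexp a = 1).
{ unfold a, Cminus. rewrite Cexp_plus, Cexp_opp, E. field. apply Cexp_neq_0. }
assert (Ra : Re a = 0).
{ apply exp_inv. rewrite <- Cmod_Cexp, Ea, Cmod_1, exp_0. reflexivity. }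
assert (Es : s1 = (s2 + a)%C).
{ apply extremal_F_inj; auto.
  - rewrite re_plus, Ra. lra.
  - unfold F at 2. rewrite Cexp_plus, Ea, Cmult_1_r. unfold a, F. ring. }
rewrite Es, Cexp_plus, Ea. ring.
Qed.

(* [s |-> s - lam (F s - W)] is a contraction of the half-plane [Re s <= ln r]. *)
Lemma extremal_F_surj r W : 0 < r < 1 -> Re W <= ln (r / ((1 + r) * (1 + r))) ->
  exists s, Re s <= ln r /\ F s = W.
Proof.
intros Hr HW.
assert (Hlr : ln r < 0) by (rewrite <- ln_1; apply ln_increasing; lra).
set (kap := (1 - r) / (1 + r)). assert (Hk : 0 < kap <= 1).
{ split; [apply Rdiv_lt_0_compat; lra|]. apply Rmult_le_reg_r with (1 + r); [lra|].
  unfold kap, Rdiv. rewrite Rmult_assoc, Rinv_l; lra. }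
(* |1 - lam p|^2 <= 1 - 2 lam kap + 36 lam^2 when Re p >= kap and |p| <= 6. This lam minimises the
   right side, giving 1 - kap^2 / 36 <= (1 - kap^2 / 72)^2. *)
set (lam := kap / 36). pose (T := fun s => (s - RtoC lam * (F s - W))%C).
set (P := fun s => Re s <= ln r).
assert (Hpsi : forall s, P s -> kap <= Re (psi_AP (Cexp s)) /\ Cmod (psi_AP (Cexp s)) <= 6).
{ intros s Hs. assert (Cmod (Cexp s) <= r).
  { rewrite Cmod_Cexp, <- (exp_ln r) by lra. destruct Hs as [Hs|Hs]; [left; now apply exp_increasing | rewrite Hs; lra]. }
  split; [apply psi_AP_Harnack; lra | apply psi_AP_bound; lra]. }
assert (DT : forall s, P s -> Cdiff T s (1 - RtoC lam * psi_AP (Cexp s))%C).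
{ intros s Hs. eapply Cdiff_eq.
  - apply Cdiff_minus; [apply Cdiff_id|]. apply (Cdiff_mult (fun _ => RtoC lam) (fun s => F s - W)%C); [apply Cdiff_const|].
    apply Cdiff_minus; [apply extremal_dF; unfold P in Hs; lra | apply Cdiff_const].
  - ring. }
assert (seg : forall x y t, P x -> P y -> 0 <= t <= 1 -> P (x + RtoC t * (y - x))%C).
{ intros x y t Hx Hy Ht. unfold P in *. unfold Cminus. rewrite re_plus, re_scal_l, re_plus, re_opp. nra. }
destruct (contraction_fixpoint T P (1 - kap * kap / 72) (RtoC (ln r))) as [s [Ps Es]].
- nra.
- unfold P. rewrite re_RtoC. lra.
(* Invariance of the half-plane: on horizontal lines Re T does not decrease to the right, since lam
   Re p <= 1, so T s is compared with T at the boundary point [sb]. There the growth bound gives Re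
   F >= Re W, and T moves [sb] to the left. *)
- intros s Hs. pose (sb := (ln r, Im s) : C). assert (Hsb : P sb) by (unfold P, sb; simpl; lra).
  set (b := (sb - s)%C). assert (Eb : b = RtoC (ln r - Re s)).
  { unfold b, sb. destruct s; unfold Cminus, Cplus, Copp, RtoC; simpl. f_equal; ring. }
  destruct (seg_MVT T (fun t => 1 - RtoC lam * psi_AP (Cexp (s + RtoC t * b)))%C s b 1) as [t [Ht K]].
  + intros t Ht. apply DT. apply seg; auto; lra.
  + intros t Ht. eapply Cdiff_cont, DT. now apply seg.
  + assert (Esb : (s + b)%C = sb) by (unfold b; ring). rewrite Esb, !Cmult_1_l in K.
    destruct (Hpsi (s + RtoC t * b)%C) as [p1 p2]; [apply seg; auto; lra|].
    set (p := psi_AP (Cexp (s + RtoC t * b))) in *.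
    rewrite Eb in K. unfold Cminus in K. rewrite re_scal_r, !re_plus, !re_opp, re_scal_l, re_RtoC in K.
    assert (Rp := re_le_Cmod p). apply Rabs_le_between in Rp.
    assert (Q1 : 0 <= (1 + - (lam * Re p)) * (ln r - Re s)).
    { apply Rmult_le_pos; [|unfold P in Hs; lra]. unfold lam. nra. }
    assert (Q2 : Re (T sb) <= ln r).
    { unfold T, Cminus. rewrite re_plus, re_opp, re_scal_l, re_plus, re_opp.
      assert (G : Re W <= Re (F sb)).
      { apply Rle_trans with (1 := HW). unfold F. rewrite re_plus. unfold sb at 1. simpl Re at 1.
        assert (Hm : Cmod (Cexp sb) = r) by (rewrite Cmod_Cexp; unfold sb; simpl; apply exp_ln; lra).
        assert (G := extremal_growth (Cexp sb) ltac:(lra)). rewrite Hm in G.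
        rewrite ln_div, ln_mult by nra. simpl in *. lra. }
      assert (0 <= lam * (Re (F sb) + - Re W)) by (apply Rmult_le_pos; unfold lam; lra).
      unfold sb at 1. simpl Re at 1. lra. }
    unfold P. lra.
- intros z Hz. unfold P in *. apply le_epsilon. intros eps He. destruct (Hz eps He) as [x [Hx Hxz]].
  assert (K := re_le_Cmod (x - z)). unfold Cminus in K. rewrite re_plus, re_opp in K.
  apply Rabs_le_between in K. fold (x - z)%C in K. lra.
- intros x y Hx Hy.
  replace (T x - T y)%C with (T (y + (x - y)) - T y)%C by (f_equal; f_equal; ring).
  apply (seg_bound T (fun t => 1 - RtoC lam * psi_AP (Cexp (y + RtoC t * (x - y))))%C).
  + intros t Ht. apply DT. apply seg; auto; lra.
  + intros t Ht. eapply Cdiff_cont, DT. now apply seg.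
  + intros t Ht. destruct (Hpsi (y + RtoC t * (x - y))%C) as [p1 p2]; [apply seg; auto; lra|].
    set (p := psi_AP (Cexp (y + RtoC t * (x - y)))) in *. clearbody p.
    apply Rsqr_incr_0_var; [|nra]. unfold Rsqr.
    assert (E2 := Cmod_sqr p). rewrite Cmod_sqr. unfold Cminus.
    rewrite re_plus, im_plus, re_opp, im_opp, re_scal_l, im_scal_l, re_RtoC, im_RtoC.
    assert (Cp := Cmod_ge_0 p).
    assert (Hp36 : Re p * Re p + Im p * Im p <= 36).
    { rewrite <- E2. replace 36 with (6 * 6) by ring. apply Rmult_le_compat; lra. }
    set (x0 := Re p) in *. set (y0 := Im p) in *.
    apply Rle_trans with (1 - 2 * lam * kap + lam * lam * 36).
    * assert (Hlam : 0 < lam) by (unfold lam; lra).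
      assert (0 <= lam * (x0 - kap)) by (apply Rmult_le_pos; lra).
      assert (0 <= lam * lam * (36 - (x0 * x0 + y0 * y0))) by (apply Rmult_le_pos; [apply Rmult_le_pos|]; lra).
      lra.
    * assert (Q := Rle_0_sqr (kap * kap / 72)). unfold Rsqr in Q. unfold lam. lra.
- exists s. split; [exact Ps|]. unfold T in Es.
  assert (E : (RtoC lam * (F s - W))%C = 0).
  { transitivity (s - (s - RtoC lam * (F s - W)))%C; [ring|]. rewrite Es. ring. }
  apply Ceq_minus. transitivity (/ RtoC lam * (RtoC lam * (F s - W)))%C.
  + field. apply RtoC_neq. unfold lam. lra.
  + rewrite E. ring.
Qed.

Lemma extremal_surj w : Cmod w < 1 / 4 -> exists z, Cmod z < 1 /\ f z = w.
Proof.
intros Hw. destruct (Ceq_dec w 0) as [->|Hw0].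
{ exists 0. rewrite Cmod_0. split; [lra | apply extremal_f0]. }
assert (Hm := proj1 (Cmod_gt_0 _) Hw0).
destruct (Cexp_surj w Hw0) as [W EW].
(* r / (1 + r)^2 falls short of 1/4 by (1 - r)^2 / (4 (1 + r)^2), a multiple of eta^2 that is
   smaller than eta; so it still exceeds |w|. *)
set (eta := 1 / 4 - Cmod w). set (r := 1 - eta).
destruct (extremal_F_surj r W) as [s [Hs Es]].
- unfold r, eta; lra.
- assert (EC : Cmod w = exp (Re W)) by (rewrite <- EW; apply Cmod_Cexp).
  rewrite <- (ln_exp (Re W)), <- EC.
  assert (K : Cmod w <= r / ((1 + r) * (1 + r))).
  { apply Rmult_le_reg_r with ((1 + r) * (1 + r)); [unfold r, eta; nra|].
    unfold Rdiv. rewrite Rmult_assoc, Rinv_l, Rmult_1_r by (unfold r, eta; nra). unfold r, eta. nra. }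
  destruct K as [K|K]; [left; now apply ln_increasing | rewrite K; lra].
- exists (Cexp s). split.
  + rewrite Cmod_Cexp. apply Rle_lt_trans with r; [|unfold r, eta; lra].
    rewrite <- (exp_ln r) by (unfold r, eta; lra).
    destruct Hs as [Hs|Hs]; [left; now apply exp_increasing | rewrite Hs; lra].
  + now rewrite extremal_f_exp, Es.
Qed.

(* Newton's simplified iteration [z |-> z - (f z - w) / f' z0]. *)
Lemma extremal_local_surj z0 eps : Cmod z0 < 1 -> 0 < eps -> exists d, 0 < d /\
  forall w, Cmod (w - f z0) < d -> exists z, Cmod z < 1 /\ Cmod (z - z0) < eps /\ f z = w.
Proof.
intros Hz0 He. pose (df := fun z => (Cexp (H z) * psi_AP z)%C).
assert (Hne : df z0 <> 0).
{ apply Cmult_neq_0; [apply Cexp_neq_0|]. intros E. assert (K := psi_AP_Re_pos z0 Hz0). rewrite E in K. simpl in K. lra. }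
assert (Hdm := proj1 (Cmod_gt_0 _) Hne). set (D := Cmod (df z0)) in *.
assert (Cdf : ccont (U := C_UniformSpace) df z0).
{ apply (ccont_mult (U := C_UniformSpace) (fun z => Cexp (H z)) psi_AP).
  - apply (ccont_comp (U := C_UniformSpace) H Cexp); [exact (Cdiff_cont _ _ _ (HD z0 Hz0)) | apply ccont_Cexp].
  - exact (Cdiff_cont _ _ _ (psi_AP_diff z0 Hz0)). }
destruct (proj1 (ccont_C_eps _ _) Cdf (D / 2) ltac:(lra)) as [d1 [Hd1 K]].
(* The closed disc of radius e stays within eps of z0, inside the unit disc, and where f' differs
   from f'(z0) by less than D / 2; the last makes T a contraction with constant 1/2. *)
set (e := Rmin (eps / 2) (Rmin (d1 / 2) ((1 - Cmod z0) / 2))).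
assert (L1 : e <= eps / 2) by apply Rmin_l.
assert (L2 : e <= d1 / 2) by (eapply Rle_trans; [apply Rmin_r | apply Rmin_l]).
assert (L3 : e <= (1 - Cmod z0) / 2) by (eapply Rle_trans; [apply Rmin_r | apply Rmin_r]).
assert (He' : 0 < e) by (repeat apply Rmin_pos; lra).
(* T moves the centre z0 by at most e / 2, and contraction adds at most e / 2, so the disc is
   invariant. *)
exists (D * (e / 2)). split; [apply Rmult_lt_0_compat; lra|]. intros w Hw.
pose (T := fun z => (z - / df z0 * (f z - w))%C). set (P := fun z => Cmod (z - z0) <= e).
assert (Pin : forall z, P z -> Cmod z < 1).
{ intros z Hz. unfold P in Hz. assert (Q := Cmod_triangle (z - z0) z0).
  replace (z - z0 + z0)%C with z in Q by ring. lra. }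
assert (P0 : P z0).
{ unfold P. replace (z0 - z0)%C with (RtoC 0) by ring. rewrite Cmod_0. lra. }
assert (seg : forall x y t, P x -> P y -> 0 <= t <= 1 -> P (x + RtoC t * (y - x))%C).
{ intros x y t Hx Hy Ht. unfold P in *.
  replace (x + RtoC t * (y - x) - z0)%C with (RtoC (1 - t) * (x - z0) + RtoC t * (y - z0))%C by (rewrite RtoC_minus; ring).
  eapply Rle_trans; [apply Cmod_triangle|]. rewrite !Cmod_mult, !Cmod_R, !Rabs_pos_eq by lra. nra. }
assert (DT : forall z, P z -> Cdiff T z (1 - / df z0 * df z)%C).
{ intros z Hz. eapply Cdiff_eq.
  - apply Cdiff_minus; [apply Cdiff_id|]. apply (Cdiff_mult (fun _ => / df z0)%C (fun z => f z - w)%C); [apply Cdiff_const|].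
    apply Cdiff_minus; [apply extremal_df, Pin, Hz | apply Cdiff_const].
  - unfold df. ring. }
assert (HT : forall x y, P x -> P y -> Cmod (T x - T y) <= 1 / 2 * Cmod (x - y)).
{ intros x y Hx Hy.
  replace (T x - T y)%C with (T (y + (x - y)) - T y)%C by (f_equal; f_equal; ring).
  apply (seg_bound T (fun t => 1 - / df z0 * df (y + RtoC t * (x - y)))%C).
  - intros t Ht. apply DT. apply seg; auto; lra.
  - intros t Ht. eapply Cdiff_cont, DT. now apply seg.
  - intros t Ht. assert (Hp := seg y x t Hy Hx ltac:(lra)). unfold P in Hp.
    set (p := (y + RtoC t * (x - y))%C) in *. specialize (K p ltac:(lra)).
    replace (1 - / df z0 * df p)%C with (/ df z0 * - (df p - df z0))%C by (field; auto).
    rewrite Cmod_mult, Cmod_opp, Cmod_inv by auto. fold D.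
    apply Rmult_le_reg_l with D; [exact Hdm|]. rewrite <- Rmult_assoc, Rinv_r, Rmult_1_l by lra. lra. }
destruct (contraction_fixpoint T P (1 / 2) z0) as [z [Pz Ez]]; auto; [lra| | |].
- intros z Hz. unfold P. replace (T z - z0)%C with ((T z - T z0) + / df z0 * (w - f z0))%C by (unfold T; ring).
  eapply Rle_trans; [apply Cmod_triangle|]. rewrite Cmod_mult, Cmod_inv by auto. fold D.
  assert (B1 := HT z z0 Hz P0). unfold P in Hz.
  assert (B2 : / D * Cmod (w - f z0) <= e / 2).
  { apply Rmult_le_reg_l with D; [exact Hdm|]. rewrite <- Rmult_assoc, Rinv_r, Rmult_1_l by lra. lra. }
  lra.
- intros z Hz. unfold P in *. apply le_epsilon. intros ep Hep. destruct (Hz ep Hep) as [x [Hx Hxz]].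
  assert (Q := Cmod_triangle (- (x - z)) (x - z0)). rewrite Cmod_opp in Q.
  replace (- (x - z) + (x - z0))%C with (z - z0)%C in Q by ring. lra.
- exists z. split; [now apply Pin|]. split; [unfold P in Pz; lra|].
  unfold T in Ez. assert (E : (/ df z0 * (f z - w))%C = 0).
  { transitivity (z - (z - / df z0 * (f z - w)))%C; [ring|]. rewrite Ez. ring. }
  apply Ceq_minus. transitivity (df z0 * (/ df z0 * (f z - w)))%C; [field; auto|]. rewrite E. ring.
Qed.

(** Local surjectivity places a preimage of w near g(w0), and injectivity identifies it with g(w);
    hence g is continuous. Its slope at w0 is then 1 / Q(g(w)), with Q the slope of f at g(w0). *)
Lemma extremal_inverse : exists g : C -> C, (forall w, Cmod w < 1 / 4 -> Cmod (g w) < 1 /\ f (g w) = w) /\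
  (forall w, Cmod w < 1 / 4 -> exists l, Cdiff g w l).
Proof.
pose (g := fun w => epsilon (inhabits (RtoC 0)) (fun z => Cmod z < 1 /\ f z = w)).
assert (Hg : forall w, Cmod w < 1 / 4 -> Cmod (g w) < 1 /\ f (g w) = w).
{ intros w Hw. unfold g. apply epsilon_spec. now apply extremal_surj. }
exists g. split; [exact Hg|]. intros w0 Hw0. destruct (Hg w0 Hw0) as [g1 g2].
assert (Cg : ccont (U := C_UniformSpace) g w0).
{ apply ccont_C_eps. intros eps He. destruct (extremal_local_surj (g w0) eps g1 He) as [d [Hd K]].
  rewrite g2 in K. exists (Rmin d (1 / 4 - Cmod w0)). split; [apply Rmin_pos; lra|].
  intros w Hw. assert (L1 := Rmin_l d (1 / 4 - Cmod w0)). assert (L2 := Rmin_r d (1 / 4 - Cmod w0)).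
  destruct (K w ltac:(lra)) as [z [z1 [z2 z3]]].
  assert (Hw4 : Cmod w < 1 / 4).
  { assert (Q := Cmod_triangle (w - w0) w0). replace (w - w0 + w0)%C with w in Q by ring. lra. }
  destruct (Hg w Hw4) as [h1 h2]. replace (g w) with z; [exact z2|].
  apply extremal_inj; auto. now rewrite h2. }
set (D := (Cexp (H (g w0)) * psi_AP (g w0))%C).
assert (Hne : D <> 0).
{ apply Cmult_neq_0; [apply Cexp_neq_0|]. intros E. assert (K := psi_AP_Re_pos _ g1). rewrite E in K. simpl in K. lra. }
destruct (extremal_df (g w0) g1) as [Q [EQ [CQ HQ]]]. fold D in EQ.
(* Outside the disc g is an arbitrary choice, so it is replaced by the value that the slope identity
   forces. *)
pose (rep := fun w => (g w0 + / Q (g w) * (w - w0))%C).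
exists (/ D)%C.
apply (Cdiff_ext_loc (fun w => if Rlt_dec (Cmod (w - w0)) (1 / 4 - Cmod w0) then g w else rep w) g w0 _ (1 / 4 - Cmod w0)); [lra| |].
{ intros w Hw. destruct (Rlt_dec _ _); [reflexivity|contradiction]. }
exists (fun w => / Q (g w))%C. split; [now rewrite EQ|]. split.
- apply (ccont_inv (U := C_UniformSpace) (fun w => Q (g w))).
  + apply (ccont_comp (U := C_UniformSpace) g Q); [exact Cg | exact CQ].
  + now rewrite EQ.
- intros w. destruct (Rlt_dec (Cmod (w0 - w0)) _) as [_|n].
  2: { destruct n. replace (w0 - w0)%C with (RtoC 0) by ring. rewrite Cmod_0. lra. }
  destruct (Rlt_dec _ _) as [Hw|_]; [|reflexivity].
  assert (Hw4 : Cmod w < 1 / 4).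
  { assert (Z := Cmod_triangle (w - w0) w0). replace (w - w0 + w0)%C with w in Z by ring. lra. }
  destruct (Hg w Hw4) as [h1 h2]. assert (E := HQ (g w)). rewrite h2, g2 in E.
  destruct (Ceq_dec w w0) as [->|Hww]; [ring|].
  assert (Hn : Q (g w) <> 0).
  { intros E0. rewrite E0 in E. apply Hww. rewrite E. ring. }
  assert (E' : (w - w0)%C = (Q (g w) * (g w - g w0))%C) by (rewrite E at 1; ring).
  rewrite E'. field. exact Hn.
Qed.

(** From f(z) = z exp(H(z)) follows g(w) / w = exp(- H(g(w))), so the logarithm is - H o g, analytic
    on |w| < 1/4. Its Taylor coefficients are taken on the circle of radius 1/8 and moved to a
    radius beyond |w| by [coef_indep]. *)
Lemma extremal_inverse_log : exists Gamma, inverse_log_coefficients f Gamma.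
Proof.
destruct extremal_inverse as [g [Hg Dg]].
pose (l := fun w => (- H (g w))%C).
assert (Dl : diff_on (1 / 4) l).
{ intros w Hw. destruct (Dg w Hw) as [a Ha]. eexists. apply Cdiff_opp.
  apply (Cdiff_comp H g); [exact Ha | apply HD, Hg, Hw]. }
assert (Hz4 : Cmod 0 < 1 / 4) by (rewrite Cmod_0; lra).
assert (g0 : g 0 = 0).
{ destruct (Hg 0 Hz4) as [h1 h2]. apply extremal_inj; auto; [rewrite Cmod_0; lra|]. rewrite h2. symmetry. apply extremal_f0. }
assert (l0 : l 0 = 0) by (unfold l; rewrite g0, H0; ring).
exists (fun n => (coef l (1 / 8) n / 2)%C). exists g, l. split; [|split; [split; [|split]|]].
- intros w Hw. destruct (Hg w Hw) as [h1 h2]. split; [exact h1|]. intros z Hz. split.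
  + intros E. apply extremal_inj; auto. now rewrite h2.
  + intros ->. exact h2.
- intros w Hw. destruct (Dl w Hw) as [a Ha]. eapply Cdiff_ex_derive, Ha.
- exact l0.
- intros w Hw Hw0. destruct (Hg w Hw) as [h1 h2].
  assert (Hgn : g w <> 0) by (intros E; apply Hw0; rewrite <- h2, E; apply extremal_f0).
  unfold l. rewrite Cexp_opp. transitivity (g w / f (g w))%C; [|now rewrite h2].
  unfold f. field. split; [apply Cexp_neq_0 | exact Hgn].
- intros w Hw. unfold Defs.disc in Hw. assert (Hw0 := Cmod_ge_0 w).
  set (r := (Cmod w + 1 / 4) / 2). assert (Hr : Cmod w < r < 1 / 4) by (unfold r; lra).
  destruct (Taylor_remainder l (1 / 4) r Dl ltac:(lra)) as [M [HM HT]].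
  assert (c0 : coef l r 0 = 0).
  { destruct (diff_on_jet l (1 / 4) r Dl ltac:(lra)) as [c0 _]. now rewrite c0. }
  apply is_series_eps. intros eps He.
  set (K := M * (r / (r - Cmod w))). assert (HK : 0 <= K).
  { apply Rmult_le_pos; auto. apply Rdiv_le_0_compat; lra. }
  destruct (pow_lt_1_zero (Cmod w / r)) with (y := eps / (K + 1)) as [N HN].
  { rewrite Rabs_pos_eq by (apply Rdiv_le_0_compat; lra). apply Rmult_lt_reg_r with r; [lra|].
    unfold Rdiv. rewrite Rmult_assoc, Rinv_l; lra. }
  { apply Rdiv_lt_0_compat; lra. }
  exists N. intros n Hn. specialize (HN (S (S n)) ltac:(lia)).
  rewrite Rabs_pos_eq in HN by (apply pow_le, Rdiv_le_0_compat; lra).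
  specialize (HT w (S (S n)) (proj1 Hr)).
  (* The series starts at degree 1 and the Taylor sum at degree 0; the constant coefficient is l(0)
     = 0, which accounts for the shift. *)
  assert (E : forall n, csum (fun n => 2 * (coef l (1 / 8) (S n) / 2 * w ^ S n))%C n =
     csum (fun n => coef l r n * w ^ n)%C (S n)).
  { induction n0 as [|m IH].
    - simpl. rewrite c0. ring.
    - change (csum (fun n => 2 * (coef l (1 / 8) (S n) / 2 * w ^ S n)) m + 2 * (coef l (1 / 8) (S m) / 2 * w ^ S m) =
        csum (fun n => coef l r n * w ^ n) (S m) + coef l r (S m) * w ^ S m)%C.
      rewrite IH, (coef_indep l (1 / 4) (1 / 8) r) by (auto; lra). field. }
  rewrite E. set (S0 := csum _ (S (S n))) in *.
  replace (S0 - l w)%C with (- (l w - S0))%C by ring. rewrite Cmod_opp.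
  eapply Rle_lt_trans; [exact HT|].
  replace (M * (Cmod w / r) ^ S (S n) * (r / (r - Cmod w))) with ((Cmod w / r) ^ S (S n) * K) by (unfold K; ring).
  apply Rle_lt_trans with (eps / (K + 1) * K); [apply Rmult_le_compat_r; lra|].
  apply Rmult_lt_reg_r with (K + 1); [lra|].
  replace (eps / (K + 1) * K * (K + 1)) with (eps * K) by (field; lra). nra.
Qed.
End Extremal.

Theorem extremal_Gamma : exists (f : C -> C) (Gamma : nat -> C), S_AP f /\ inverse_log_coefficients f Gamma /\
  Cmod (Gamma 1%nat) = 3 / 4 /\ Cmod (Gamma 2%nat) = 29 / 32 /\ Cmod (Gamma 3%nat) = 925 / 576.
Proof.
destruct log_quotient_exists as [q [H [H0 [Hq HD]]]].
destruct (extremal_inverse_log q H H0 Hq HD) as [Gamma HG].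
exists (fun z => z * Cexp (H z))%C, Gamma. split; [now apply (extremal_S_AP q)|]. split; [exact HG|].
destruct (Gamma_formulas _ (fun z => z) Gamma (extremal_normalized q H H0 Hq HD)
  (fun z _ => extremal_nz H z) id_schwarz (fun z Hz => extremal_quotient q H Hq HD z Hz) HG 1 0 0 jet_id) as [G1 [G2 G3]].
assert (K1 : forall a b : R, 0 < b -> 0 <= a -> Cmod (a / b) = a / b).
{ intros a b Hb Ha. rewrite <- RtoC_div, Cmod_R by lra. apply Rabs_pos_eq. now apply Rdiv_le_0_compat. }
rewrite G1, G2, G3. repeat split.
- replace (- (3 / 4) * 1)%C with (- (3 / 4))%C by ring. rewrite Cmod_opp. apply K1; lra.
- replace (- (3 / 8) * 0 + 29 / 32 * 1 ^ 2)%C with (29 / 32)%C by ring. apply K1; lra.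
- replace (- (1 / 4) * (0 - 67 / 12 * 1 * 0 + 925 / 144 * 1 ^ 3))%C with (- (925 / 576))%C by field.
  rewrite Cmod_opp. apply K1; lra.
Qed.

Theorem theorem3p1 :
  (forall (f : C -> C) (Gamma : nat -> C),
     S_AP f -> inverse_log_coefficients f Gamma ->
     Cmod (Gamma 1%nat) <= 3 / 4 /\
     Cmod (Gamma 2%nat) <= 29 / 32 /\
     Cmod (Gamma 3%nat) <= 925 / 576) /\
  (exists (f : C -> C) (Gamma : nat -> C),
     S_AP f /\ inverse_log_coefficients f Gamma /\
     Cmod (Gamma 1%nat) = 3 / 4) /\
  (exists (f : C -> C) (Gamma : nat -> C),
     S_AP f /\ inverse_log_coefficients f Gamma /\
     Cmod (Gamma 2%nat) = 29 / 32) /\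
  (exists (f : C -> C) (Gamma : nat -> C),
     S_AP f /\ inverse_log_coefficients f Gamma /\
     Cmod (Gamma 3%nat) = 925 / 576).
Proof.
split; [exact Gamma_bounds|].
destruct extremal_Gamma as [f [Gamma [Hf [HG [E1 [E2 E3]]]]]].
repeat split; exists f, Gamma; auto.
Qed.
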